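(* Let $k\ge 3$ be a fixed integer and let $\sigma$ be fixed with $\max(\beta_k,\tfrac12)<\sigma<1$. Then for every $\varepsilon>0$, $$R(k,\sigma;T)\ll_\varepsilon T^{\frac{2(1-\sigma)}{1-\beta_k}+\varepsilon}\qquad (T\to\infty).$$
   Context: $\zeta(s)$ is the Riemann zeta-function, $s=\sigma+it$. For $k\in\mathbb N$, $d_k(n)$ is the number of ways of writing $n$ as an ordered product of $k$ positive integer factors (the coefficients of $\zeta^k(s)$). Define $R(k,\sigma;T)$ by $$\int_1^T|\zeta(\sigma+it)|^{2k}\,dt=T\sum_{n=1}^\infty d_k^2(n)n^{-2\sigma}+R(k,\sigma;T).$$ Write $\sum_{n\le x}d_k(n)=xP_{k-1}(\log x)+\Delta_k(x)$, where $xP_{k-1}(\log x)$ (with $P_{k-1}$ a polynomial of degree $k-1$) is the residue at $s=1$ of $\zeta^k(s)x^s/s$. Let $\beta_k=\inf\{b\ge0:\int_1^x\Delta_k^2(y)\,dy\ll x^{1+2b}\}$. *)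

(* Defs.v *)
(* Complex numbers are [R[i]] for an arbitrary [R : realType]; their topology
   and complex derivative are those of the regular normed module [R[i]^o]. *)
From HB Require Import structures.
From mathcomp Require Import all_boot all_order all_algebra.
From mathcomp Require Import all_classical all_reals all_analysis.
From mathcomp.real_closed Require Export complex.

Set Implicit Arguments.
Unset Strict Implicit.
Unset Printing Implicit Defensive.

Import Order.TTheory GRing.Theory Num.Theory.
Import numFieldNormedType.Exports.
Import ComplexField.Normc.

Local Open Scope classical_set_scope.
Local Open Scope ring_scope.
Local Open Scope complex_scope.

(* x^s with the principal value of log x; meaningful for 0 < x. *)
Definition cpow (R : realType) (x : R) (s : R[i]) : R[i] :=
  (x `^ complex.Re s)%:C
  * (cos (complex.Im s * ln x) +i* sin (complex.Im s * ln x)).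

Definition holomorphic_at (R : realType) (f : R[i] -> R[i]) (a : R[i]) : Prop :=
  \forall s \near (a : R[i]^o), derivable (f : R[i]^o -> R[i]^o) s 1.

(* The analytic continuation to C \ {1} of the Dirichlet series
   \sum_(n >= 1) n^(-s), Re s > 1. By the identity theorem this determines
   [zeta] everywhere except at the pole s = 1, where its value is arbitrary. *)
Definition is_riemann_zeta (R : realType) (zeta : R[i] -> R[i]) : Prop :=
  (forall s : R[i], 1 < complex.Re s ->
     series (fun n : nat => cpow n.+1%:R (- s) : R[i]^o) @ \oo
       --> (zeta s : R[i]^o)) /\
  (forall s : R[i], s != 1 -> holomorphic_at zeta s).

(* [f] has at worst a pole at [a] and [c] is the coefficient of (s - a)^(-1) in
   its Laurent expansion there: near [a], f is a polynomial [p] in 1/(s - a)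
   (whose linear coefficient is [c]) plus a function holomorphic at [a]. *)
Definition is_residue (R : realType) (f : R[i] -> R[i]) (a c : R[i]) : Prop :=
  exists (p : {poly R[i]}) (g : R[i] -> R[i]),
    [/\ holomorphic_at g a,
        \forall s \near (a : R[i]^o)^', f s = p.[(s - a)^-1] + g s
      & p`_1 = c].

(* The number of ordered factorizations n = t_0 * ... * t_(k-1), for 0 < n
   (each factor is then automatically positive and at most n). *)
Definition divisor_fun (k n : nat) : nat :=
  #|[pred t : {ffun 'I_k -> 'I_n.+1} | (\prod_(i < k) t i)%N == n]|.

(* P is P_(k-1): it has degree k - 1, i.e. [size P = k]. *)
Definition is_main_poly (R : realType) (zeta : R[i] -> R[i]) (k : nat)
    (P : {poly R}) : Prop :=
  size P = k /\
  forall x : R, 0 < x ->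
    is_residue (fun s => zeta s ^+ k * cpow x s / s) 1 (x * P.[ln x])%:C.

Definition Delta (R : realType) (k : nat) (P : {poly R}) (x : R) : R :=
  (\sum_(1 <= n < (Num.truncn x).+1) (divisor_fun k n)%:R) - x * P.[ln x].

(* Vinogradov's f(x) << g(x) as x -> +oo. *)
Definition vinogradov (R : realType) (f g : R -> R) : Prop :=
  exists C : R, \forall x \near +oo%R, `|f x| <= C * `|g x|.

Definition beta (R : realType) (k : nat) (P : {poly R}) : R :=
  inf [set b : R | 0 <= b /\
    vinogradov
      (fun x : R => (\int[lebesgue_measure]_(y in `[1%R, x]) Delta k P y ^+ 2)%R)
      (fun x : R => x `^ (1 + 2 * b))].

(* \sum_(n >= 1) d_k(n)^2 n^(-2 sigma), summed from index 0 by the shift n.+1. *)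
Definition mean_coef (R : realType) (k : nat) (sigma : R) : R :=
  limn (series (fun n : nat =>
    (divisor_fun k n.+1)%:R ^+ 2 * n.+1%:R `^ (- (2 * sigma)))).

Definition Rerr (R : realType) (zeta : R[i] -> R[i]) (k : nat) (sigma T : R)
    : R :=
  (\int[lebesgue_measure]_(t in `[1%R, T])
     normc (zeta (sigma +i* t)) ^+ (2 * k))%R
  - T * mean_coef k sigma.

(* Main.v *)
(* Choose b slightly larger than beta_k, put Y = T^(1/(1-b)) and pick X in [Y, 2Y] with Delta_k(X)^2 << X^(2b).
   Partial summation for Re s > 1, followed by analytic continuation to Re s > b, gives for s = sigma + it, t >= 1,
     zeta(s)^k = sum_(n <= X) d_k(n) n^(-s) + X^(1-s) (r_s - P)(log X) - Delta_k(X) X^(-s)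
                   + s int_X^oo Delta_k(x) x^(-s-1) dx,
   where the second term is O(X^(1-sigma+eps) / t). The square of the Dirichlet polynomial has the mean value
   T sum_(n <= X) d_k(n)^2 n^(-2 sigma), up to an error controlled by |log(m/n)| >= |m - n| / max(m, n) and harmonic
   sums. The last integral is treated by a Bessel inequality: the mean square of its Fourier transform in log x is
   << int_X^oo Delta_k(x)^2 x^(-1-2 sigma) dx << X^(2b - 2 sigma), and T^2 X^(2b - 2 sigma) << X^(2 - 2 sigma)
   since T <= X^(1-b). In the cross terms one integrates over t before x. All errors are
   << X^(2(1-sigma)+eps). *)
Require Import Defs.
From HB Require Import structures.
From mathcomp Require Import all_boot all_order all_algebra.
From mathcomp Require Import all_classical all_reals all_analysis.
From mathcomp Require Import measurable_realfun ring lra.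

Set Implicit Arguments.
Unset Strict Implicit.
Unset Printing Implicit Defensive.

Import Order.TTheory GRing.Theory Num.Theory.
Import numFieldNormedType.Exports.
Import ComplexField.Normc.

Local Open Scope classical_set_scope.
Local Open Scope ring_scope.
Local Open Scope complex_scope.

(** * Complex differentiability *)

Section ComplexDiff.
Variable R : realType.
Implicit Types (z w : R[i]) (f g : R[i] -> R[i]).

Lemma normcC (x : R) : normc (x%:C) = `|x|.
Proof. by rewrite /normc /= expr0n addr0 sqrtr_sqr. Qed.

Lemma normc_ge0 z : 0 <= normc z.
Proof. by case: z => a b; rewrite /normc sqrtr_ge0. Qed.

Lemma normcE z : `|z| = (normc z)%:C.
Proof. by []. Qed.

Lemma normc_Re z : `|complex.Re z| <= normc z.
Proof. by have := normc_ge_Re z; rewrite normcE lecR. Qed.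

Lemma normc_Im z : `|complex.Im z| <= normc z.
Proof.
case: z => a b /=; rewrite -[`|b|]ger0_norm// -sqrtr_sqr ler_wsqrtr//.
by rewrite real_normK ?num_real// lerDr sqr_ge0.
Qed.

Lemma normc_leD z : normc z <= `|complex.Re z| + `|complex.Im z|.
Proof.
rewrite {1}[z]complexE; apply: (le_trans (le_normcD _ _)).
by rewrite normcM !normcC {1}/normc expr0n expr1n add0r sqrtr1 mul1r.
Qed.

(* Sealed as an inductive so that unification never unfolds it to filters. *)
Variant ccont f z : Prop :=
  CCont of {for z, continuous (f : R[i]^o -> R[i]^o)}.

Lemma ccontP f z : ccont f z <-> forall e : R, 0 < e ->
  exists2 r, 0 < r & forall w, normc (w - z) < r -> normc (f w - f z) < e.
Proof.
split=> [[cf] e e0|H].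
  have /cvgrPdist_lt/(_ e%:C) := cf; rewrite ltcR => /(_ e0) /nbhs_ballP [d /=].
  case: d => d d'; rewrite ltcE/= => /andP[/eqP -> d0] dP.
  exists d => // w wd; have := dP w; rewrite /ball/= !normcE !ltcR.
  by rewrite -normcN opprB => /(_ wd); rewrite -normcN opprB.
have Fz := nbhs_filter (z : R[i]^o).
apply: CCont; apply/(@cvgrPdist_lt _ R[i]^o) => -[e e']; rewrite ltcE/= => /andP[/eqP -> e0].
have [r r0 rP] := H e e0.
exists r%:C => /=; first by rewrite ltcR.
move=> w; rewrite /ball_/= !normcE !ltcR -normcN opprB => /rP.
by rewrite -normcN opprB.
Qed.

(* Complex differentiability in Caratheodory's form, with q(z) = f'(z). *)
Definition cdiff f z : Prop :=
  exists2 q : R[i] -> R[i], ccont q z & forall w, f w = f z + (w - z) * q w.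

Lemma derivable_cdiff f z : derivable (f : R[i]^o -> R[i]^o) z 1 -> cdiff f z.
Proof.
move=> /cvg_ex[d /= /cvgrPdist_lt H].
exists (fun w => if w == z then d else (f w - f z) / (w - z)); last first.
  move=> w; have [->|wz] := eqVneq w z; first by rewrite subrr mul0r addr0.
  by rewrite mulrC divfK ?subr_eq0// addrC subrK.
apply/ccontP => e e0; have := H e%:C; rewrite ltcR => /(_ e0).
move=> /nbhs_ballP [[r r']] /=.
rewrite ltcE/= => /andP[/eqP -> r0] rP; exists r => // w wr; rewrite eqxx.
have [_|wz] := eqVneq w z; first by rewrite subrr normc0.
have := rP (w - z); rewrite /ball/= sub0r normrN normcE ltcR => /(_ wr).
rewrite subr_eq0 => /(_ wz).
rewrite scaler1 subrK normcE ltcR -normcN opprB.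
by rewrite /GRing.scale/= mulrC.
Qed.

Lemma ccont_cst c z : ccont (fun=> c) z.
Proof. by apply: CCont; exact: (@cst_continuous R[i]^o R[i]^o). Qed.
Lemma ccont_id z : ccont id z.
Proof. by apply/ccontP => e e0; exists e. Qed.
Lemma ccontD f g z : ccont f z -> ccont g z -> ccont (fun w => f w + g w) z.
Proof. move=> [cf] [cg]; apply: CCont; exact: (@cvgD R[i] R[i]^o R[i] (nbhs (z : R[i]^o)) (nbhs_filter (z : R[i]^o)) f g _ _ cf cg). Qed.
Lemma ccontN f z : ccont f z -> ccont (fun w => - f w) z.
Proof. move=> [cf]; apply: CCont; exact: (@cvgN R[i] R[i]^o R[i] (nbhs (z : R[i]^o)) (nbhs_filter (z : R[i]^o)) f _ cf). Qed.
Lemma ccontM f g z : ccont f z -> ccont g z -> ccont (fun w => f w * g w) z.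
Proof. move=> [cf] [cg]; apply: CCont; exact: (@cvgM R[i] R[i] (nbhs (z : R[i]^o)) (nbhs_filter (z : R[i]^o)) f g _ _ cf cg). Qed.
Lemma ccontV f z : f z != 0 -> ccont f z -> ccont (fun w => (f w)^-1) z.
Proof. move=> fz [cf]; apply: CCont; exact: (@cvgV R[i] R[i] (nbhs (z : R[i]^o)) (nbhs_filter (z : R[i]^o)) f _ fz cf). Qed.

Lemma cdiff_cont f z : cdiff f z -> ccont f z.
Proof.
move=> [q cq /funext ->]; apply: ccontD; first exact: ccont_cst.
by apply: ccontM => //; apply: ccontD; [exact: ccont_id|exact: ccont_cst].
Qed.

Lemma cdiff_cst c z : cdiff (fun=> c) z.
Proof. by exists (fun=> 0); [exact: ccont_cst|move=> w; rewrite mulr0 addr0]. Qed.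

Lemma cdiff_id z : cdiff id z.
Proof. by exists (fun=> 1); [exact: ccont_cst|move=> w /=; ring]. Qed.

Lemma cdiffD f g z : cdiff f z -> cdiff g z -> cdiff (fun w => f w + g w) z.
Proof.
move=> [q cq fq] [p cp gp]; exists (fun w => q w + p w); first exact: ccontD.
by move=> w; rewrite fq gp; ring.
Qed.

Lemma cdiffM f g z : cdiff f z -> cdiff g z -> cdiff (fun w => f w * g w) z.
Proof.
move=> df [p cp gp]; have cf := cdiff_cont df; case: df => q cq fq.
exists (fun w => q w * g z + f w * p w).
  by apply: ccontD; apply: ccontM => //; exact: ccont_cst.
by move=> w; rewrite gp mulrDr {1}fq; ring.
Qed.

Lemma cdiffN f z : cdiff f z -> cdiff (fun w => - f w) z.
Proof.
move=> [q cq fq]; exists (fun w => - q w); first exact: ccontN.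
by move=> w; rewrite fq; ring.
Qed.

Lemma cdiffB f g z : cdiff f z -> cdiff g z -> cdiff (fun w => f w - g w) z.
Proof. by move=> df /cdiffN; exact: cdiffD. Qed.

Lemma cdiffX f n z : cdiff f z -> cdiff (fun w => f w ^+ n) z.
Proof.
move=> df; elim: n => [|n IH]; first exact: cdiff_cst.
under [X in cdiff X]funext do rewrite exprS.
exact: cdiffM.
Qed.

Lemma cdiff_sum (I : Type) (r : seq I) (P : pred I) (F : I -> R[i] -> R[i]) z :
  (forall i, P i -> cdiff (F i) z) ->
  cdiff (fun w => \sum_(i <- r | P i) F i w) z.
Proof.
move=> H; elim: r => [|i r IH].
  by under [X in cdiff X]funext do rewrite big_nil; exact: cdiff_cst.
under [X in cdiff X]funext do rewrite big_cons.
by case: (boolP (P i)) => // Pi; apply: cdiffD => //; exact: H.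
Qed.

Lemma cdiff_near f g z (r : R) : 0 < r ->
  (forall w, normc (w - z) < r -> f w = g w) -> cdiff f z -> cdiff g z.
Proof.
move=> r0 fg [q cq fq].
exists (fun w => if w == z then q z else (g w - g z) / (w - z)); last first.
  move=> w; have [->|wz] := eqVneq w z; first by rewrite subrr mul0r addr0.
  by rewrite mulrC divfK ?subr_eq0// addrC subrK.
apply/ccontP => e e0; have /ccontP/(_ e e0)[d d0 dP] := cq.
exists (Num.min d r) => [|w]; first by rewrite lt_min d0.
rewrite lt_min => /andP[wd wr]; rewrite eqxx; have fz := fg z.
rewrite subrr normc0 in fz; have {}fz := fz r0.
have [_|wz] := eqVneq w z; first by rewrite subrr normc0.
by rewrite -fg// -fz fq addrAC subrr add0r mulrC mulKf ?subr_eq0//; exact: dP.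
Qed.

Lemma cdiffV f z : f z != 0 -> cdiff f z -> cdiff (fun w => (f w)^-1) z.
Proof.
move=> fz df; have cf := cdiff_cont df; case: df => q cq fq.
have /ccontP/(_ (normc (f z)))[|r r0 rP] := cf.
  rewrite lt_neqAle normc_ge0 andbT eq_sym.
  by apply: contra_neq fz => /eq0_normc.
have nz w : normc (w - z) < r -> f w != 0.
  move=> /rP; apply: contraTN => /eqP ->; rewrite sub0r -normcN opprK.
  by rewrite ltxx.
apply: (@cdiff_near (fun w => (f z)^-1 + (w - z) * (- q w / (f w * f z))) _ _ r) => //.
  move=> w /nz fw; rewrite mulrA mulrN -[_ * q w](addrK (f z)) [_ + f z]addrC -fq.
  by field; rewrite fz fw.
exists (fun w => - q w / (f w * f z)); last by move=> w; rewrite subrr mul0r addr0.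
apply: ccontM; first exact: ccontN.
apply: ccontV; first by rewrite mulf_neq0.
by apply: ccontM => //; exact: ccont_cst.
Qed.

Lemma cdiff_quadratic f z d (C r : R) : 0 < r ->
  (forall w, normc (w - z) < r ->
     normc (f w - f z - d * (w - z)) <= C * normc (w - z) ^+ 2) -> cdiff f z.
Proof.
move=> r0 H.
exists (fun w => if w == z then d else (f w - f z) / (w - z)); last first.
  move=> w; have [->|wz] := eqVneq w z; first by rewrite subrr mul0r addr0.
  by rewrite mulrC divfK ?subr_eq0// addrC subrK.
have C0 : 0 < `|C| + 1 by rewrite ltr_wpDl.
apply/ccontP => e e0; exists (Num.min r (e / (`|C| + 1))).
  by rewrite lt_min r0 divr_gt0.
move=> w; rewrite lt_min ltr_pdivlMr// => /andP[wr we]; rewrite eqxx.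
have [_|wz] := eqVneq w z; first by rewrite subrr normc0.
have wz0 : 0 < normc (w - z).
  rewrite lt_neqAle normc_ge0 andbT eq_sym.
  by apply: contra_neq wz => /eq0_normc/eqP; rewrite subr_eq0 => /eqP.
have wz' : w - z != 0 by rewrite subr_eq0.
rewrite -(ltr_pM2r wz0) -normcM mulrBl divfK//.
apply: (le_lt_trans (H w wr)).
rewrite expr2 mulrA ltr_pM2r//; apply: le_lt_trans we.
rewrite mulrC ler_wpM2l ?normc_ge0//.
by rewrite (le_trans (ler_norm _))// lerDl.
Qed.

Lemma cdiffZl c f z : cdiff f z -> cdiff (fun w => c * f w) z.
Proof. by apply: cdiffM; exact: cdiff_cst. Qed.

End ComplexDiff.

Section ComplexExp.
Variable R : realType.
Implicit Types (z w s : R[i]) (a b : R).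

Definition cexp z : R[i] :=
  (expR (complex.Re z))%:C * (cos (complex.Im z) +i* sin (complex.Im z)).

Lemma cexpD z w : cexp (z + w) = cexp z * cexp w.
Proof.
case: z w => a b [c d]; rewrite /cexp /= expRD cosD sinD.
by apply/eqP; rewrite eq_complex /=; apply/andP; split; apply/eqP; ring.
Qed.

Lemma cexp0 : cexp 0 = 1.
Proof.
rewrite /cexp /= expR0 cos0 sin0.
by apply/eqP; rewrite eq_complex /= !mul1r !mul0r subr0 addr0 !eqxx.
Qed.

Lemma normc_cexp z : normc (cexp z) = expR (complex.Re z).
Proof.
rewrite /cexp normcM normcC ger0_norm ?expR_ge0// /normc cos2Dsin2.
by rewrite sqrtr1 mulr1.
Qed.

Lemma cpowE (x : R) s : 0 < x -> cpow x s = cexp (s * (ln x)%:C).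
Proof.
move=> x0; case: s => a b; rewrite /cpow /cexp /= !mulr0 subr0 add0r.
by rewrite /powR gt_eqF.
Qed.

Lemma expR_sub1_le a : `|expR a - 1| <= `|a| * expR `|a|.
Proof.
have [a0|a0] := leP 0 a.
  rewrite !ger0_norm// ?subr_ge0 -?expR0 ?ler_expR// expR0.
  have := expR_ge1Dx (- a); rewrite expRN => H.
  have e0 := expR_gt0 a.
  have : expR a * (1 + - a) <= expR a * (expR a)^-1 by rewrite ler_pM2l.
  by rewrite mulfV ?gt_eqF//; lra.
have ha : expR a <= 1 by rewrite -expR0 ler_expR ltW.
rewrite ler0_norm ?subr_le0// ltr0_norm//.
have := expR_ge1Dx a; have := expR_ge1Dx (- a) => h1 h2.
apply: (@le_trans _ _ (- a)); first lra.
by rewrite ler_peMr//; lra.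
Qed.

Lemma expR_sub1D_le a : `|expR a - 1 - a| <= a ^+ 2 * expR `|a|.
Proof.
have h := expR_sub1_le a.
have h1 := expR_ge1Dx a.
rewrite ger0_norm; last lra.
rewrite -[a ^+ 2]real_normK ?num_real// expr2 -mulrA.
apply: (@le_trans _ _ (`|a| * `|expR a - 1|)); last by rewrite ler_wpM2l.
rewrite -normrM; apply: le_trans (ler_norm _).
have := expR_ge1Dx (- a); rewrite expRN => h2.
have e0 := expR_gt0 a.
have : expR a * (1 + - a) <= expR a * (expR a)^-1 by rewrite ler_pM2l.
rewrite mulfV ?gt_eqF//; nra.
Qed.

Lemma MVT_from0 (f df : R -> R) (x : R) :
  (forall y : R, is_derive y (1 : R) f (df y)) ->
  exists2 c, `|c| <= `|x| & f x - f 0 = df c * x.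
Proof.
move=> fdf; have cf : continuous f.
  move=> y; apply/differentiable_continuous/derivable1_diffP.
  by have [] := fdf y.
have [x0|x0] := leP 0 x.
  have [|c] := @MVT_segment R f df 0 x x0 (fun y _ => fdf y).
    exact: continuous_subspaceT.
  by rewrite in_itv/= subr0 => /andP[c0 cx] ->; exists c => //; rewrite !ger0_norm.
have [|c] := @MVT_segment R f df x 0 (ltW x0) (fun y _ => fdf y).
  exact: continuous_subspaceT.
rewrite in_itv/= sub0r => /andP[c0 cx] h; exists c; first by rewrite !ler0_norm//; lra.
by rewrite -opprB h mulrN opprK.
Qed.

Lemma sin_norm_le b : `|sin b| <= `|b|.
Proof.
have [c _] := MVT_from0 b (@is_derive_sin R).
by rewrite sin0 subr0 => ->; rewrite normrM ler_piMl// cos_max.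
Qed.

Lemma cos_sub1_le b : `|cos b - 1| <= b ^+ 2.
Proof.
have [c cb] := MVT_from0 b (@is_derive_cos R).
rewrite cos0 => ->; rewrite normrM normrN -[b ^+ 2]real_normK ?num_real// expr2.
by rewrite ler_wpM2r// (le_trans (sin_norm_le c)).
Qed.

Lemma cos_sub1_le1 b : `|cos b - 1| <= `|b|.
Proof.
have [c cb] := MVT_from0 b (@is_derive_cos R).
by rewrite cos0 => ->; rewrite normrM normrN ler_piMl// sin_max.
Qed.

Lemma sin_sub_le b : `|sin b - b| <= b ^+ 2.
Proof.
have d y : is_derive y (1 : R) (fun x => sin x - x) (cos y - 1).
  by apply: is_deriveB.
have [c cb] := MVT_from0 b d.
rewrite sin0 !subr0 => ->; rewrite normrM -[b ^+ 2]real_normK ?num_real// expr2.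
by rewrite ler_wpM2r// (le_trans (cos_sub1_le1 c)).
Qed.

Lemma cexp_sub1D_le z :
  normc (cexp z - 1 - z) <= 5 * normc z ^+ 2 * expR (normc z).
Proof.
apply: (le_trans (normc_leD _)).
have ha := normc_Re z; have hb := normc_Im z; have hz := normc_ge0 z.
have -> : complex.Re (cexp z - 1 - z) = expR (complex.Re z) * cos (complex.Im z) - 1 - complex.Re z.
  by case: z {ha hb hz} => a b; rewrite /cexp /= mul0r subr0.
have -> : complex.Im (cexp z - 1 - z) = expR (complex.Re z) * sin (complex.Im z) - complex.Im z.
  by case: z {ha hb hz} => a b; rewrite /cexp /= mul0r addr0 oppr0 addr0.
move: (complex.Re z) (complex.Im z) (normc z) ha hb hz => a b N ha hb hz.
have e1 : expR `|a| <= expR N by rewrite ler_expR.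
have e2 : expR a <= expR N by rewrite ler_expR (le_trans (ler_norm _)).
have e3 : 1 <= expR N by rewrite -expR0 ler_expR.
have e0 := expR_gt0 a.
have a2 : a ^+ 2 <= N ^+ 2 by rewrite -[a ^+ 2]real_normK ?num_real// lerXn2r// nnegrE.
have b2 : b ^+ 2 <= N ^+ 2 by rewrite -[b ^+ 2]real_normK ?num_real// lerXn2r// nnegrE.
have N2 : 0 <= N ^+ 2 by rewrite sqr_ge0.
have h1 : `|expR a * cos b - 1 - a| <= 2 * N ^+ 2 * expR N.
  have -> : expR a * cos b - 1 - a = (expR a - 1 - a) + expR a * (cos b - 1) by ring.
  apply: (le_trans (ler_normD _ _)); rewrite normrM (ger0_norm (ltW e0)).
  have -> : 2 * N ^+ 2 * expR N = N ^+ 2 * expR N + expR N * N ^+ 2 by ring.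
  apply: lerD.
    apply: (le_trans (expR_sub1D_le a)).
    by apply: ler_pM; rewrite ?sqr_ge0 ?expR_ge0.
  apply: ler_pM; rewrite ?(ltW e0)//.
  exact: (le_trans (cos_sub1_le b)).
have h2 : `|expR a * sin b - b| <= 2 * N ^+ 2 * expR N.
  have -> : expR a * sin b - b = (expR a - 1) * sin b + (sin b - b) by ring.
  apply: (le_trans (ler_normD _ _)); rewrite normrM.
  have -> : 2 * N ^+ 2 * expR N = N * expR N * N + N ^+ 2 * expR N by ring.
  apply: lerD.
    apply: ler_pM; rewrite ?normr_ge0//; last exact: (le_trans (sin_norm_le b)).
    apply: (le_trans (expR_sub1_le a)).
    by apply: ler_pM; rewrite ?expR_ge0.
  apply: (le_trans (sin_sub_le b)); apply: (le_trans b2).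
  by rewrite ler_peMr.
have : 0 <= N ^+ 2 * expR N by rewrite mulr_ge0// expR_ge0.
by move: h1 h2; nra.
Qed.

Lemma cdiff_cexp (c : R) s : cdiff (fun w => cexp (w * c%:C)) s.
Proof.
apply: (@cdiff_quadratic _ _ _ (cexp (s * c%:C) * c%:C)
  (expR (complex.Re (s * c%:C)) * (5 * c ^+ 2 * expR `|c|)) 1) => // w w1.
have -> : w * c%:C = s * c%:C + (w - s) * c%:C by ring.
rewrite cexpD; set h := w - s in w1 *.
have -> : cexp (s * c%:C) * cexp (h * c%:C) - cexp (s * c%:C) -
   cexp (s * c%:C) * c%:C * h = cexp (s * c%:C) * (cexp (h * c%:C) - 1 - h * c%:C).
  by ring.
rewrite normcM normc_cexp -mulrA ler_wpM2l ?expR_ge0//.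
apply: (le_trans (cexp_sub1D_le _)); rewrite normcM normcC.
have h0 := normc_ge0 h.
have -> : 5 * (normc h * `|c|) ^+ 2 = 5 * c ^+ 2 * normc h ^+ 2.
  by rewrite -[c ^+ 2]real_normK ?num_real//; ring.
rewrite mulrAC ler_wpM2r ?sqr_ge0// ler_wpM2l//.
  by rewrite mulr_ge0// sqr_ge0.
rewrite ler_expR ler_piMl//.
exact: ltW.
Qed.

End ComplexExp.

Section Segments.
Variable R : realType.
Implicit Types (z w s : R[i]) (a b : R) (g h : R -> R[i]) (f : R[i] -> R[i]).
Notation mu := (@lebesgue_measure R).

Definition rcont g (x : R) : Prop := forall e, 0 < e ->
  exists2 r, 0 < r & forall y, `|y - x| < r -> normc (g y - g x) < e.

Lemma rcont_Re g x : rcont g x -> {for x, continuous (fun y => complex.Re (g y))}.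
Proof.
move=> H; apply/cvgrPdist_lt => e e0; have [r r0 rP] := H e e0.
exists r => //= y; rewrite /ball_/= distrC => /rP; apply: le_lt_trans.
rewrite distrC; apply: le_trans (normc_Re _).
by case: (g y) => ? ?; case: (g x) => ? ?.
Qed.

Lemma rcont_Im g x : rcont g x -> {for x, continuous (fun y => complex.Im (g y))}.
Proof.
move=> H; apply/cvgrPdist_lt => e e0; have [r r0 rP] := H e e0.
exists r => //= y; rewrite /ball_/= distrC => /rP; apply: le_lt_trans.
rewrite distrC; apply: le_trans (normc_Im _).
by case: (g y) => ? ?; case: (g x) => ? ?.
Qed.

Lemma rcontD g h x : rcont g x -> rcont h x -> rcont (fun y => g y + h y) x.
Proof.
move=> cg ch e e0; have e2 : 0 < e / 2 by rewrite divr_gt0.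
have [r r0 rP] := cg _ e2; have [t t0 tP] := ch _ e2.
exists (Num.min r t) => [|y]; first by rewrite lt_min r0.
rewrite lt_min => /andP[/rP yr /tP yt]; rewrite opprD addrACA.
by apply: (le_lt_trans (le_normcD _ _)); lra.
Qed.

Lemma rcontN g x : rcont g x -> rcont (fun y => - g y) x.
Proof.
move=> cg e /cg[r r0 rP]; exists r => // y /rP.
by rewrite -opprD -[normc (- _)]normcN opprK.
Qed.

Lemma rcont_cst (c : R[i]) x : rcont (fun=> c) x.
Proof. by move=> e e0; exists 1 => // y _; rewrite subrr normc0. Qed.

Lemma normc_i : normc ('i%C : R[i]) = 1.
Proof. by rewrite /normc expr0n expr1n add0r sqrtr1. Qed.

Lemma ccont_rcont f (u v : R[i]) x :
  ccont f (u + v * x%:C) -> rcont (fun y : R => f (u + v * y%:C)) x.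
Proof.
move=> /ccontP H e /H[r r0 rP].
have v0 : 0 < normc v + 1 by rewrite ltr_wpDl ?normc_ge0.
exists (r / (normc v + 1)) => [|y yx]; first by rewrite divr_gt0.
apply: rP; have -> : u + v * y%:C - (u + v * x%:C) = v * (y - x)%:C.
  by rewrite rmorphB; ring.
rewrite normcM normcC; move: yx; rewrite ltr_pdivlMr//; apply: le_lt_trans.
by rewrite mulrC ler_wpM2l// lerDl.
Qed.

Definition scont a b g : Prop := forall x, a <= x <= b -> rcont g x.

Lemma continuous_integrable a b (f : R -> R) :
  (forall x, a <= x <= b -> {for x, continuous f}) ->
  mu.-integrable `[a, b] (EFin \o f).
Proof.
move=> H; apply: continuous_compact_integrable; first exact: segment_compact.
by apply: continuous_in_subspaceT => x; rewrite inE/= in_itv/= => /H.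
Qed.

Lemma scont_integrable_Re a b g : scont a b g ->
  mu.-integrable `[a, b] (EFin \o (fun y => complex.Re (g y))).
Proof. by move=> H; apply: continuous_integrable => x /H /rcont_Re. Qed.

Lemma scont_integrable_Im a b g : scont a b g ->
  mu.-integrable `[a, b] (EFin \o (fun y => complex.Im (g y))).
Proof. by move=> H; apply: continuous_integrable => x /H /rcont_Im. Qed.

Definition sint a b g : R[i] :=
  (\int[mu]_(x in `[a, b]) complex.Re (g x)) +i*
  (\int[mu]_(x in `[a, b]) complex.Im (g x)).

Lemma eq_sint a b g h : (forall x, a <= x <= b -> g x = h x) ->
  sint a b g = sint a b h.
Proof.
move=> H; rewrite /sint; congr (_ +i* _); apply: eq_Rintegral => x;
  by rewrite inE/= in_itv/= => /H ->.
Qed.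

Lemma sintD a b g h : scont a b g -> scont a b h ->
  sint a b (fun x => g x + h x) = sint a b g + sint a b h.
Proof.
move=> cg ch; rewrite /sint.
have E (x y : R[i]) : (complex.Re (x + y) = complex.Re x + complex.Re y) *
    (complex.Im (x + y) = complex.Im x + complex.Im y).
  by case: x y => ? ? [].
rewrite (@eq_Rintegral _ _ _ mu _ (fun x => complex.Re (g x) + complex.Re (h x))); last first.
  by move=> x _; rewrite E.
rewrite [X in _ +i* X](@eq_Rintegral _ _ _ mu _ (fun x => complex.Im (g x) + complex.Im (h x))); last first.
  by move=> x _; rewrite E.
rewrite !RintegralD//; try exact: scont_integrable_Re; exact: scont_integrable_Im.
Qed.

Lemma sint_cst a b (c : R[i]) : a <= b -> sint a b (fun=> c) = (b - a)%:C * c.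
Proof.
move=> ab; rewrite /sint !Rintegral_cst//= lebesgue_measure_itv/= lte_fin.
rewrite [X in fine X](_ : _ = (b - a)%:E); last first.
  by move: ab; rewrite le_eqVlt => /predU1P[->|->//]; rewrite ltxx subrr.
by case: c => u v; apply/eqP; rewrite eq_complex/=; apply/andP; split; apply/eqP; ring.
Qed.

Lemma sint_split a m b g : a <= m -> m <= b -> scont a b g ->
  sint a b g = sint a m g + sint m b g.
Proof.
move=> am mb cg; rewrite /sint /=.
have sp (f : R -> R) : mu.-integrable `[a, b] (EFin \o f) ->
    \int[mu]_(x in `[a, b]) f x =
    \int[mu]_(x in `[a, m]) f x + \int[mu]_(x in `[m, b]) f x.
  move=> fi; rewrite -(@Rintegral_itv_obnd_cbnd _ m); last first.
    apply: integrableS fi => //; apply: subset_itv; rewrite ?bnd_simp//.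
  have := @Rintegral_itvB _ f (BLeft a) (BRight b) m fi.
  by rewrite !bnd_simp => /(_ am mb) <-; rewrite addrC subrK.
by apply/eqP; rewrite eq_complex/= !sp ?eqxx//; [exact: scont_integrable_Im|exact: scont_integrable_Re].
Qed.

Lemma Rintegral_bound a b (f : R -> R) M : a <= b ->
  mu.-integrable `[a, b] (EFin \o f) ->
  (forall x, a <= x <= b -> `|f x| <= M) ->
  `|\int[mu]_(x in `[a, b]) f x| <= (b - a) * M.
Proof.
move=> ab fi fM; apply: (le_trans (le_normr_Rintegral _ fi)) => //.
have -> : (b - a) * M = \int[mu]_(x in `[a, b]) M.
  rewrite Rintegral_cst//= lebesgue_measure_itv/= lte_fin.
  move: ab; rewrite le_eqVlt => /predU1P[->|->//=]; last by rewrite mulrC.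
  by rewrite ltxx subrr mul0r mulr0.
apply: le_Rintegral => //.
- exact: (integrable_norm fi).
- by apply: continuous_integrable => x _; exact: cvg_cst.
Qed.

Lemma normc_sint a b g M : a <= b -> scont a b g ->
  (forall x, a <= x <= b -> normc (g x) <= M) ->
  normc (sint a b g) <= 2 * (b - a) * M.
Proof.
move=> ab cg gM; apply: (le_trans (normc_leD _)); rewrite /sint /=.
have -> : 2 * (b - a) * M = (b - a) * M + (b - a) * M by ring.
apply: lerD; apply: Rintegral_bound => //.
- exact: scont_integrable_Re.
- by move=> x /gM; apply: le_trans; exact: normc_Re.
- exact: scont_integrable_Im.
- by move=> x /gM; apply: le_trans; exact: normc_Im.
Qed.

Lemma sintN a b g : scont a b g -> sint a b (fun x => - g x) = - sint a b g.
Proof.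
move=> cg; apply/eqP; rewrite -subr_eq0 opprK -sintD//; last first.
  by move=> x /cg /rcontN.
rewrite (@eq_sint _ _ _ (fun=> 0)); last by move=> x _; rewrite addNr.
by rewrite /sint !Rintegral_cst//= !mul0r.
Qed.

End Segments.

(** * Cauchy's formula and unique continuation on squares *)

Section Goursat.
Variable R : realType.
Implicit Types (z w s p : R[i]) (a b c d m : R) (f : R[i] -> R[i]).

Definition rint a b c d f : R[i] :=
  sint a b (fun x => f (x +i* c) - f (x +i* d)) +
  'i * sint c d (fun y => f (b +i* y) - f (a +i* y)).

Definition inrect a b c d z : Prop :=
  a <= complex.Re z <= b /\ c <= complex.Im z <= d.

Definition crect a b c d f : Prop := forall z, inrect a b c d z -> ccont f z.

Lemma rcont_hor f (y x : R) : ccont f (x +i* y) -> rcont (fun x => f (x +i* y)) x.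
Proof.
have E (t : R) : t +i* y = (0 +i* y) + 1 * t%:C.
  by rewrite mul1r; apply/eqP; rewrite eq_complex /= add0r addr0 !eqxx.
move=> cf; rewrite (_ : (fun t => _) = fun t => f ((0 +i* y) + 1 * t%:C)).
  by apply: ccont_rcont; rewrite -E.
by apply/funext => t; rewrite -E.
Qed.

Lemma rcont_ver f (x y : R) : ccont f (x +i* y) -> rcont (fun y => f (x +i* y)) y.
Proof.
have E (t : R) : x +i* t = x%:C + 'i * t%:C.
  by apply/eqP; rewrite eq_complex /=; apply/andP; split; apply/eqP; ring.
move=> cf; rewrite (_ : (fun t => _) = fun t => f (x%:C + 'i * t%:C)).
  by apply: ccont_rcont; rewrite -E.
by apply/funext => t; rewrite -E.
Qed.

Lemma scont_hor f a b c d y : crect a b c d f -> c <= y <= d ->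
  scont a b (fun x => f (x +i* y)).
Proof. by move=> H cyd x xab; apply: rcont_hor; apply: H. Qed.

Lemma scont_ver f a b c d x : crect a b c d f -> a <= x <= b ->
  scont c d (fun y => f (x +i* y)).
Proof. by move=> H cyd y yab; apply: rcont_ver; apply: H. Qed.

Lemma scontB a b (g h : R -> R[i]) : scont a b g -> scont a b h ->
  scont a b (fun x => g x - h x).
Proof. by move=> cg ch x xab; apply: rcontD; [exact: cg|apply: rcontN; exact: ch]. Qed.

Lemma crectS a b c d a' b' c' d' f : a <= a' -> b' <= b -> c <= c' -> d' <= d ->
  crect a b c d f -> crect a' b' c' d' f.
Proof.
move=> aa bb cc dd H z [/andP[h1 h2] /andP[h3 h4]]; apply: H.
by split; apply/andP; split; lra.
Qed.

Lemma rint_splitV a m b c d f : a <= m -> m <= b -> c <= d -> crect a b c d f ->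
  rint a b c d f = rint a m c d f + rint m b c d f.
Proof.
move=> am mb cd cf; rewrite /rint (sint_split am mb); last first.
  by apply: scontB; apply: (scont_hor cf); lra.
have h1 : scont c d (fun y => f (b +i* y) - f (m +i* y)).
  by apply: scontB; apply: (scont_ver cf); lra.
have h2 : scont c d (fun y => f (m +i* y) - f (a +i* y)).
  by apply: scontB; apply: (scont_ver cf); lra.
rewrite (@eq_sint _ c d _ (fun y => (f (b +i* y) - f (m +i* y)) + (f (m +i* y) - f (a +i* y)))).
  by rewrite (sintD h1 h2); ring.
by move=> y _; rewrite addrA subrK.
Qed.

Lemma rint_splitH a b c m d f : a <= b -> c <= m -> m <= d -> crect a b c d f ->
  rint a b c d f = rint a b c m f + rint a b m d f.
Proof.
move=> ab cm md cf; rewrite /rint (sint_split cm md); last first.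
  by apply: scontB; apply: (scont_ver cf); lra.
have h1 : scont a b (fun x => f (x +i* c) - f (x +i* m)).
  by apply: scontB; apply: (scont_hor cf); lra.
have h2 : scont a b (fun x => f (x +i* m) - f (x +i* d)).
  by apply: scontB; apply: (scont_hor cf); lra.
rewrite (@eq_sint _ a b _ (fun x => (f (x +i* c) - f (x +i* m)) + (f (x +i* m) - f (x +i* d)))).
  by rewrite (sintD h1 h2); ring.
by move=> y _; rewrite addrA subrK.
Qed.

Lemma normcB_le (M : R) z w : normc z <= M -> normc w <= M -> normc (z - w) <= 2 * M.
Proof.
by move=> h1 h2; apply: (le_trans (le_normcD _ _)); rewrite normcN; lra.
Qed.

Lemma rint_bound a b c d f (M : R) : a <= b -> c <= d -> crect a b c d f ->
  (forall z, inrect a b c d z -> normc (f z) <= M) ->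
  normc (rint a b c d f) <= 4 * ((b - a) + (d - c)) * M.
Proof.
move=> ab cd cf fM; apply: (le_trans (le_normcD _ _)).
rewrite normcM normc_i mul1r.
have -> : 4 * ((b - a) + (d - c)) * M =
  2 * (b - a) * (2 * M) + 2 * (d - c) * (2 * M) by ring.
apply: lerD; apply: normc_sint => //.
- by apply: scontB; apply: (scont_hor cf); lra.
- by move=> x xab; apply: normcB_le; apply: fM; split=> //=; lra.
- by apply: scontB; apply: (scont_ver cf); lra.
- by move=> x xab; apply: normcB_le; apply: fM; split=> //=; lra.
Qed.

Lemma rintD_linear a b c d f (u v : R[i]) : a <= b -> c <= d -> crect a b c d f ->
  rint a b c d (fun z => u + v * z + f z) = rint a b c d f.
Proof.
move=> ab cd cf; rewrite /rint.
rewrite (@eq_sint _ a b _ (fun x => v * 'i * (c - d)%:C + (f (x +i* c) - f (x +i* d)))); last first.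
  move=> x _; have E (t : R) : x +i* t = x%:C + 'i * t%:C.
    by apply/eqP; rewrite eq_complex /=; apply/andP; split; apply/eqP; ring.
  rewrite [in v * (x +i* c)]E [in v * (x +i* d)]E rmorphB.
  by ring.
rewrite (@eq_sint _ c d _ (fun y => v * (b - a)%:C + (f (b +i* y) - f (a +i* y)))); last first.
  move=> x _; have E (t : R) : t +i* x = t%:C + 'i * x%:C.
    by apply/eqP; rewrite eq_complex /=; apply/andP; split; apply/eqP; ring.
  rewrite [in v * (a +i* x)]E [in v * (b +i* x)]E rmorphB.
  by ring.
have k (g : R[i]) x y : scont x y (fun=> g) by move=> ? _; exact: rcont_cst.
have h1 : scont a b (fun x => f (x +i* c) - f (x +i* d)).
  by apply: scontB; apply: (scont_hor cf); lra.
have h2 : scont c d (fun y => f (b +i* y) - f (a +i* y)).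
  by apply: scontB; apply: (scont_ver cf); lra.
by rewrite (sintD (k _ _ _) h1) (sintD (k _ _ _) h2) !sint_cst// !rmorphB; ring.
Qed.

Lemma rint_local a b c d f p (e : R) : a <= b -> c <= d -> 0 <= e ->
  crect a b c d f -> inrect a b c d p ->
  forall v, (forall z, inrect a b c d z ->
    normc (f z - f p - v * (z - p)) <= e * normc (z - p)) ->
  normc (rint a b c d f) <= 4 * e * ((b - a) + (d - c)) ^+ 2.
Proof.
move=> ab cd e0 cf [pab pcd] v H.
set rho := fun z => f z - f p - v * (z - p).
have -> : rint a b c d f = rint a b c d rho.
  rewrite -(@rintD_linear _ _ _ _ rho (f p - v * p) v)//.
    by congr rint; apply/funext => z; rewrite /rho; ring.
  move=> z zr; apply: ccontD; [apply: ccontD; [exact: cf|exact: ccont_cst]|].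
  apply: ccontN; apply: ccontM; first exact: ccont_cst.
  by apply: ccontD; [exact: ccont_id|exact: ccont_cst].
have -> : 4 * e * ((b - a) + (d - c)) ^+ 2 =
  4 * ((b - a) + (d - c)) * (e * ((b - a) + (d - c))) by ring.
apply: rint_bound => //.
  move=> z zr; apply: ccontD; [apply: ccontD; [exact: cf|exact: ccont_cst]|].
  apply: ccontN; apply: ccontM; first exact: ccont_cst.
  by apply: ccontD; [exact: ccont_id|exact: ccont_cst].
move=> z zr; apply: (le_trans (H z zr)); rewrite ler_wpM2l//.
apply: (le_trans (normc_leD _)); case: zr => zab zcd.
have -> : complex.Re (z - p) = complex.Re z - complex.Re p by case: z {zab zcd} => ? ?; case: (p).
have -> : complex.Im (z - p) = complex.Im z - complex.Im p by case: z {zab zcd} => ? ?; case: (p).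
by apply: lerD; rewrite ler_norml; lra.
Qed.

Lemma rint_quarter a c (w h : R) f : 0 <= w -> 0 <= h -> crect a (a + w) c (c + h) f ->
  rint a (a + w) c (c + h) f =
   (rint a (a + w / 2) c (c + h / 2) f + rint a (a + w / 2) (c + h / 2) (c + h / 2 + h / 2) f) +
   (rint (a + w / 2) (a + w / 2 + w / 2) c (c + h / 2) f +
    rint (a + w / 2) (a + w / 2 + w / 2) (c + h / 2) (c + h / 2 + h / 2) f).
Proof.
move=> w0 h0 cf.
have -> : c + h / 2 + h / 2 = c + h by field.
have -> : a + w / 2 + w / 2 = a + w by field.
have [e1 e2 e3 e4] : [/\ a <= a + w / 2, a + w / 2 <= a + w, c <= c + h / 2 &
    c + h / 2 <= c + h] by split; lra.
have e5 : c <= c + h by lra.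
rewrite (rint_splitV e1 e2 e5 cf); congr (_ + _); apply: rint_splitH => //;
  by apply: crectS cf.
Qed.

Definition sqbad f (e w h : R) (n : nat) (x y : R) : Prop :=
  ~ normc (rint x (x + w / 2 ^+ n) y (y + h / 2 ^+ n) f) <= e / 4 ^+ n.

Lemma sqbad_step f (e w h : R) n x y : 0 <= w -> 0 <= h ->
  crect x (x + w / 2 ^+ n) y (y + h / 2 ^+ n) f ->
  sqbad f e w h n x y ->
  exists q : R * R, [/\ sqbad f e w h n.+1 q.1 q.2,
    x <= q.1 /\ q.1 + w / 2 ^+ n.+1 <= x + w / 2 ^+ n &
    y <= q.2 /\ q.2 + h / 2 ^+ n.+1 <= y + h / 2 ^+ n].
Proof.
move=> w0 h0; have p0 : 0 < (2 : R) ^+ n by rewrite exprn_gt0.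
have W0 : 0 <= w / 2 ^+ n by rewrite divr_ge0// ltW.
have H0 : 0 <= h / 2 ^+ n by rewrite divr_ge0// ltW.
have EW : w / 2 ^+ n.+1 = w / 2 ^+ n / 2 by rewrite exprSr invfM mulrA.
have EH : h / 2 ^+ n.+1 = h / 2 ^+ n / 2 by rewrite exprSr invfM mulrA.
have EE : e / 4 ^+ n = e / 4 ^+ n.+1 + e / 4 ^+ n.+1 + (e / 4 ^+ n.+1 + e / 4 ^+ n.+1).
  have p4 : (4 : R) ^+ n != 0 by rewrite expf_eq0 pnatr_eq0 andbF.
  by rewrite exprS; field.
rewrite /sqbad EW EH; move: (w / _) (h / 2 ^+ n) W0 H0 => {}w {}h {}w0 {}h0 {EW EH p0}.
move=> cf bad; apply: contrapT => nex; apply: bad.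
have Q (u v : R) : (u = x \/ u = x + w / 2) -> (v = y \/ v = y + h / 2) ->
    normc (rint u (u + w / 2) v (v + h / 2) f) <= e / 4 ^+ n.+1.
  move=> hu hv; apply: contrapT => nb; apply: nex; exists (u, v) => /=; split=> //.
    by case: hu => ->; split; lra.
  by case: hv => ->; split; lra.
rewrite rint_quarter// EE; apply: (le_trans (le_normcD _ _)).
apply: lerD; apply: (le_trans (le_normcD _ _)); apply: lerD; apply: Q; by [left|right].
Qed.

Lemma halving_lt (w e : R) : 0 < e -> exists n : nat, w / 2 ^+ n < e.
Proof.
move=> e0; have [w0|w0] := leP w 0.
  by exists 0%N; rewrite expr0 divr1; apply: le_lt_trans e0.
exists (Num.truncn (w / e)).+1; rewrite ltr_pdivrMr ?exprn_gt0// mulrC -ltr_pdivrMr//.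
apply: (lt_le_trans (truncnS_gt (w / e))).
by rewrite -natrX ler_nat ltnW// ltn_expl.
Qed.

Lemma nested_point (X W : nat -> R) :
  (forall n, 0 <= W n) ->
  (forall n, X n <= X n.+1 /\ X n.+1 + W n.+1 <= X n + W n) ->
  exists p : R, forall n, X n <= p <= X n + W n.
Proof.
move=> W0 H.
have hX (m n : nat) : (m <= n)%N -> X m <= X n /\ X n + W n <= X m + W m.
  elim: n => [|n IH]; first by rewrite leqn0 => /eqP ->.
  rewrite leq_eqVlt => /predU1P[-> //|]; rewrite ltnS => /IH [h1 h2].
  by have [h3 h4] := H n; split; lra.
have ub n : ubound (range X) (X n + W n).
  move=> _ [m _ <-]; have [mn|nm] := leqP m n.
    by have [] := hX _ _ mn; have := W0 n; lra.
  by have [] := hX _ _ (ltnW nm); have := W0 m; lra.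
exists (sup (range X)) => n; apply/andP; split.
  by apply: ub_le_sup; [exists (X 0%N + W 0%N); exact: ub|exists n].
by apply: ge_sup; [exists (X 0%N), 0%N|exact: ub].
Qed.

(* Repeated quartering: [sqbad] selects a sub-rectangle over which the integral exceeds e / 4^n, whereas
   differentiability at the limit point makes it o(4^(-n)). *)
Lemma goursat a b c d f : a <= b -> c <= d ->
  (forall z, inrect a b c d z -> cdiff f z) -> rint a b c d f = 0.
Proof.
move=> ab cd df; have cf : crect a b c d f by move=> z /df; exact: cdiff_cont.
set w := b - a; set h := d - c; have w0 : 0 <= w by rewrite subr_ge0.
have h0 : 0 <= h by rewrite subr_ge0.
suff small e : 0 < e -> normc (rint a b c d f) <= e.
  apply: eq0_normc; apply/eqP; rewrite eq_le normc_ge0 andbT.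
  by apply/ler_addgt0Pl => e e0; rewrite addr0; exact: small.
move=> e0; apply: contrapT => bad0.
pose T := {t : nat * (R * R) | [/\ sqbad f e w h t.1 t.2.1 t.2.2,
   a <= t.2.1 /\ t.2.1 + w / 2 ^+ t.1 <= b &
   c <= t.2.2 /\ t.2.2 + h / 2 ^+ t.1 <= d]}.
pose nest (s t : T) := [/\ (sval t).1 = (sval s).1.+1,
   (sval s).2.1 <= (sval t).2.1 /\
   (sval t).2.1 + w / 2 ^+ (sval t).1 <= (sval s).2.1 + w / 2 ^+ (sval s).1 &
   (sval s).2.2 <= (sval t).2.2 /\
   (sval t).2.2 + h / 2 ^+ (sval t).1 <= (sval s).2.2 + h / 2 ^+ (sval s).1].
have t0 : T.
  exists (0%N, (a, c)); rewrite /= !expr0 !divr1 /w /h /sqbad !expr0 !divr1.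
  rewrite (addrC a) subrK (addrC c) subrK.
  by split.
have [F [F0 FS]] : {F : nat -> T | F 0%N = t0 /\ forall n, nest (F n) (F n.+1)}.
  apply: dependent_choice => -[[n [x y]] /= [bad [x1 x2] [y1 y2]]].
  apply: cid.
  have [|q [qb [q1 q2] [q3 q4]]] := sqbad_step w0 h0 _ bad.
    exact: crectS cf.
  by unshelve eexists; [exists (n.+1, q); split=> //=; move: x1 x2 y1 y2 q1 q2 q3 q4; clear; lra|split].
pose X n := (sval (F n)).2.1; pose Y n := (sval (F n)).2.2.
pose N n := (sval (F n)).1.
have Nn n : (n <= N n)%N.
  elim: n => // n IH; by rewrite /N; have [-> _ _] := FS n; rewrite ltnS.
have pw n : 0 <= w / 2 ^+ n by rewrite divr_ge0// exprn_ge0.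
have ph n : 0 <= h / 2 ^+ n by rewrite divr_ge0// exprn_ge0.
have [px pxP] : exists p : R, forall n, X n <= p <= X n + w / 2 ^+ N n.
  by apply: nested_point => [n|n]; [exact: pw|have [] := FS n].
have [py pyP] : exists p : R, forall n, Y n <= p <= Y n + h / 2 ^+ N n.
  by apply: nested_point => [n|n]; [exact: ph|have [] := FS n].
have inF n : [/\ sqbad f e w h (N n) (X n) (Y n),
   a <= X n /\ X n + w / 2 ^+ N n <= b & c <= Y n /\ Y n + h / 2 ^+ N n <= d].
  exact: (svalP (F n)).
set p := px +i* py.
have [q /ccontP cq fq] : cdiff f p.
  apply: df; have [_ [a1 a2] [b1 b2]] := inF 0%N.
  by move: (pxP 0%N) (pyP 0%N) a1 a2 b1 b2; clear; move=> *; split=> /=; lra.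
set K := 4 * (w + h) ^+ 2 + 1.
have K0 : 0 < K by rewrite /K ltr_wpDl// mulr_ge0// sqr_ge0.
have eK : 0 < e / K by rewrite divr_gt0.
have [r r0 rP] := cq _ eK.
have [n nr] := halving_lt (w + h) r0.
have {}nr : w / 2 ^+ N n + h / 2 ^+ N n < r.
  apply: le_lt_trans nr; rewrite -mulrDl; apply: ler_wpM2l; first exact: addr_ge0.
  by rewrite lef_pV2 ?posrE ?exprn_gt0// ler_eXn2l// ltr1n.
have [bad [a1 a2] [b1 b2]] := inF n; apply: bad.
have := pxP n; have := pyP n; move=> pyn pxn.
have wn := pw (N n); have hn := ph (N n).
have cfn : crect (X n) (X n + w / 2 ^+ N n) (Y n) (Y n + h / 2 ^+ N n) f.
  exact: crectS cf.
apply: (le_trans (@rint_local _ _ _ _ _ p (e / K) _ _ (ltW eK) cfn _ (q p) _)).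
- by rewrite lerDl.
- by rewrite lerDl.
- by split.
- move=> z [z1 z2]; rewrite (fq z).
  have -> : f p + (z - p) * q z - f p - q p * (z - p) = (q z - q p) * (z - p) by ring.
  rewrite normcM ler_wpM2r ?normc_ge0// ltW//; apply: rP.
  apply: (le_lt_trans (normc_leD _)); apply: le_lt_trans nr.
  have -> : complex.Re (z - p) = complex.Re z - px by case: z {z1 z2} => ? ?.
  have -> : complex.Im (z - p) = complex.Im z - py by case: z {z1 z2} => ? ?.
  by apply: lerD; rewrite ler_norml; [move: z1 pxn|move: z2 pyn]; clear; lra.
have -> : (X n + w / 2 ^+ N n - X n + (Y n + h / 2 ^+ N n - Y n)) ^+ 2 =
    (w + h) ^+ 2 / 4 ^+ N n.
  rewrite [X n + _]addrC addrK [Y n + _]addrC addrK -mulrDl exprMn exprVn.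
  by rewrite -exprM mulnC exprM (_ : 2 ^+ 2 = 4 :> R)//; ring.
rewrite mulrA ler_pM2r ?invr_gt0 ?exprn_gt0//.
have -> : 4 * (e / K) * (w + h) ^+ 2 = e * ((4 * (w + h) ^+ 2) / K) by ring.
by rewrite ler_piMr// ?ltW// ltr_pdivrMr// mul1r /K ltrDl.
Qed.

End Goursat.

Section Cauchy.
Variable R : realType.
Implicit Types (z w s : R[i]) (a b c d m : R) (f : R[i] -> R[i]).

Lemma sintZ a b (u : R[i]) (g : R -> R[i]) : scont a b g ->
  sint a b (fun x => u * g x) = u * sint a b g.
Proof.
move=> cg; case: u => u v; rewrite /sint.
have iR := scont_integrable_Re cg; have iI := scont_integrable_Im cg.
have Z (k : R) (h : R -> R) : lebesgue_measure.-integrable `[a, b] (EFin \o h) ->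
    lebesgue_measure.-integrable `[a, b] (EFin \o (fun x => k * h x)).
  by move=> ih; have := integrableZl _ k ih; exact.
rewrite (@eq_Rintegral _ _ _ lebesgue_measure _
  (fun x => u * complex.Re (g x) - v * complex.Im (g x))); last first.
  by move=> x _; case: (g x).
rewrite [X in _ +i* X](@eq_Rintegral _ _ _ lebesgue_measure _
  (fun x => u * complex.Im (g x) + v * complex.Re (g x))); last first.
  by move=> x _; case: (g x).
by rewrite RintegralB ?RintegralD ?RintegralZl//; apply: Z.
Qed.

Lemma scontZ a b u (g : R -> R[i]) : scont a b g -> scont a b (fun x => u * g x).
Proof.
move=> cg x /cg H e e0; have u0 : 0 < normc u + 1 by rewrite ltr_wpDl ?normc_ge0.
have [|r r0 rP] := H (e / (normc u + 1)); first by rewrite divr_gt0.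
exists r => // y /rP; rewrite -mulrBr normcM ltr_pdivlMr// => h.
by apply: le_lt_trans h; rewrite mulrC ler_wpM2l ?normc_ge0// lerDl.
Qed.

Lemma scont_bounded a b (g : R -> R[i]) : a <= b -> scont a b g ->
  exists M, forall x, a <= x <= b -> normc (g x) <= M.
Proof.
move=> ab cg.
have H (f : R -> R) : (forall x, a <= x <= b -> {for x, continuous f}) ->
    exists M, forall x, a <= x <= b -> f x <= M.
  move=> cf; have [|x _ xP] := @EVT_max R f a b ab.
    by apply: continuous_in_subspaceT => x; rewrite inE/= in_itv/= => /cf.
  by exists (f x) => t tab; apply: xP; rewrite in_itv.
have [M MP] : exists M, forall x, a <= x <= b -> normc (g x) <= M.
  apply: H => x /cg H; apply/cvgrPdist_lt => e e0; have [r r0 rP] := H e e0.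
  exists r => //= y; rewrite /ball_/= distrC => /rP; apply: le_lt_trans.
  have h1 := le_normcD (g y - g x) (g x); have h2 := le_normcD (g x - g y) (g y).
  rewrite subrK in h1; rewrite subrK -opprB normcN in h2.
  by rewrite ler_norml; apply/andP; split; lra.
by exists M.
Qed.

Definition bcont a b c d f : Prop :=
  [/\ scont a b (fun x => f (x +i* c)), scont a b (fun x => f (x +i* d)),
      scont c d (fun y => f (a +i* y)) & scont c d (fun y => f (b +i* y))].

Definition onbd a b c d z : Prop :=
  inrect a b c d z /\
  [\/ complex.Re z = a, complex.Re z = b, complex.Im z = c | complex.Im z = d].

Lemma bcontP a b c d f : a <= b -> c <= d ->
  (forall z, onbd a b c d z -> ccont f z) -> bcont a b c d f.
Proof.
move=> ab cd H; split=> x xI; [apply: rcont_hor|apply: rcont_hor|apply: rcont_ver|apply: rcont_ver]; apply: H; (split; first by split=> /=; lra).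
- exact: Or43.
- exact: Or44.
- exact: Or41.
- exact: Or42.
Qed.

Lemma rintB_bcont a b c d f g : a <= b -> c <= d -> bcont a b c d f -> bcont a b c d g ->
  rint a b c d (fun z => f z - g z) = rint a b c d f - rint a b c d g.
Proof.
move=> ab cd [f1 f2 f3 f4] [g1 g2 g3 g4]; rewrite /rint.
have N (x y : R) (h : R -> R[i]) : scont x y h -> scont x y (fun t => - h t).
  by move=> ch t /ch; exact: rcontN.
rewrite (@eq_sint _ a b _ (fun x => (f (x +i* c) - f (x +i* d)) + - (g (x +i* c) - g (x +i* d)))); last first.
  by move=> x _; ring.
rewrite (@eq_sint _ c d _ (fun y => (f (b +i* y) - f (a +i* y)) + - (g (b +i* y) - g (a +i* y)))); last first.
  by move=> x _; ring.
rewrite (sintD (scontB f1 f2) (N _ _ _ (scontB g1 g2))) (sintD (scontB f4 f3) (N _ _ _ (scontB g4 g3))).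
by rewrite (sintN (scontB g1 g2)) (sintN (scontB g4 g3)); ring.
Qed.

Lemma rintZ_bcont a b c d u f : bcont a b c d f ->
  rint a b c d (fun z => u * f z) = u * rint a b c d f.
Proof.
move=> [f1 f2 f3 f4]; rewrite /rint.
rewrite (@eq_sint _ a b _ (fun x => u * (f (x +i* c) - f (x +i* d)))); last first.
  by move=> x _; ring.
rewrite (@eq_sint _ c d _ (fun y => u * (f (b +i* y) - f (a +i* y)))); last first.
  by move=> x _; ring.
by rewrite (sintZ _ (scontB f1 f2)) (sintZ _ (scontB f4 f3)); ring.
Qed.

Lemma eq_rint a b c d f g : a <= b -> c <= d ->
  (forall z, onbd a b c d z -> f z = g z) -> rint a b c d f = rint a b c d g.
Proof.
move=> ab cd H; rewrite /rint; congr (_ + _ * _); apply: eq_sint => x xI.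
- rewrite !H//; (split; first by split=> /=; lra); [exact: Or44|exact: Or43].
- rewrite !H//; (split; first by split=> /=; lra); [exact: Or41|exact: Or42].
Qed.

Lemma rint_bound_bcont a b c d f (M : R) : a <= b -> c <= d -> bcont a b c d f ->
  (forall z, onbd a b c d z -> normc (f z) <= M) ->
  normc (rint a b c d f) <= 4 * ((b - a) + (d - c)) * M.
Proof.
move=> ab cd [f1 f2 f3 f4] fM; apply: (le_trans (le_normcD _ _)).
rewrite normcM normc_i mul1r.
have -> : 4 * ((b - a) + (d - c)) * M =
  2 * (b - a) * (2 * M) + 2 * (d - c) * (2 * M) by ring.
apply: lerD; apply: normc_sint => //; try exact: scontB.
  by move=> x xab; apply: normcB_le; apply: fM; (split; first by split=> /=; lra);
    [exact: Or43|exact: Or44].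
by move=> x xab; apply: normcB_le; apply: fM; (split; first by split=> /=; lra);
    [exact: Or42|exact: Or41].
Qed.

Lemma ReB z w : complex.Re (z - w) = complex.Re z - complex.Re w.
Proof. by case: z => ? ?; case: w. Qed.
Lemma ImB z w : complex.Im (z - w) = complex.Im z - complex.Im w.
Proof. by case: z => ? ?; case: w. Qed.

Lemma goursat_punctured a b c d f z0 :
  a < complex.Re z0 < b -> c < complex.Im z0 < d ->
  ccont f z0 -> (forall z, inrect a b c d z -> z != z0 -> cdiff f z) ->
  rint a b c d f = 0.
Proof.
case: z0 => x0 y0 /= /andP[ax xb] /andP[cy yd] cf0 df.
have cf : crect a b c d f.
  move=> z zr; have [->//|zz] := eqVneq z (x0 +i* y0).
  exact/cdiff_cont/df.
apply: eq0_normc; apply/eqP; rewrite eq_le normc_ge0 andbT.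
apply/ler_addgt0Pl => e e0; rewrite addr0.
have /ccontP/(_ 1 ltr01)[r r0 rP] := cf0.
set M := normc (f (x0 +i* y0)) + 1.
have M0 : 0 < M by rewrite ltr_wpDl ?normc_ge0.
set h := Num.min (r / 4) (Num.min (Num.min (x0 - a) (b - x0))
  (Num.min (Num.min (y0 - c) (d - y0)) (e / (16 * M)))).
have h0 : 0 < h.
  by rewrite /h !lt_min !divr_gt0 ?mulr_gt0// !subr_gt0 ax xb cy yd.
have [hr h1 h2] : [/\ h <= r / 4, h <= x0 - a & h <= b - x0].
  by split; rewrite /h ?ge_min ?lexx ?orbT.
have [h3 h4 h5] : [/\ h <= y0 - c, h <= d - y0 & h <= e / (16 * M)].
  by split; rewrite /h ?ge_min ?lexx ?orbT.
move: (h) h0 hr h1 h2 h3 h4 h5 => {}h h0 hr h1 h2 h3 h4 h5.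
have ab : a <= b by exact/ltW/(lt_trans ax).
have cd : c <= d by exact/ltW/(lt_trans cy).
have [l1 l2 l3 l4] : [/\ x0 - h < x0, x0 < x0 + h, y0 - h < y0 & y0 < y0 + h].
  by move: h0; clear; split; lra.
have [l5 l6 l7 l8] : [/\ a <= x0 - h, x0 + h <= b, c <= y0 - h & y0 + h <= d].
  by move: h1 h2 h3 h4; clear; split; lra.
have [m1 m2] : x0 - h <= x0 + h /\ y0 - h <= y0 + h by move: h0; clear; split; lra.
have [m3 m4 m5 m6] : [/\ x0 - h <= b, y0 - h <= d, a <= x0 + h & c <= y0 + h].
  by split; [exact: le_trans l6|exact: le_trans l8|exact: le_trans m1|exact: le_trans m2].
rewrite (@rint_splitV _ a (x0 - h) b c d)//.
rewrite (@rint_splitV _ (x0 - h) (x0 + h) b c d)//; last exact: crectS cf.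
rewrite (@rint_splitH _ (x0 - h) (x0 + h) c (y0 - h) d)//; last exact: crectS cf.
rewrite (@rint_splitH _ (x0 - h) (x0 + h) (y0 - h) (y0 + h) d)//; last exact: crectS cf.
have G a' b' c' d' : a <= a' -> a' <= b' -> b' <= b -> c <= c' -> c' <= d' -> d' <= d ->
    [\/ b' < x0, x0 < a', d' < y0 | y0 < c'] -> rint a' b' c' d' f = 0.
  move=> k1 k2 k3 k4 k5 k6 k; apply: goursat => // z [/andP[z1 z2] /andP[z3 z4]].
  apply: df.
    by split; apply/andP; split; [exact: le_trans z1|exact: le_trans k3|exact: le_trans z3|exact: le_trans k6].
  by apply/eqP => zz; move: z1 z2 z3 z4 k; rewrite zz /=; clear; move=> z1 z2 z3 z4; case; lra.
have E1 : rint a (x0 - h) c d f = 0 by apply: G => //; exact: Or41.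
have E2 : rint (x0 + h) b c d f = 0 by apply: G => //; exact: Or42.
have E3 : rint (x0 - h) (x0 + h) c (y0 - h) f = 0 by apply: G => //; exact: Or43.
have E4 : rint (x0 - h) (x0 + h) (y0 + h) d f = 0 by apply: G => //; exact: Or44.
rewrite E1 E2 E3 E4 !add0r !addr0.
apply: (le_trans (@rint_bound _ _ _ _ _ f M _ _ _ _)).
- exact: m1.
- exact: m2.
- exact: crectS cf.
- move=> z [z1 z2]; rewrite -[f z](subrK (f (x0 +i* y0))).
  apply: (le_trans (le_normcD _ _)); rewrite addrC lerD2l ltW//; apply: rP.
  apply: (le_lt_trans (normc_leD _)); rewrite ReB ImB /=.
  have : `|complex.Re z - x0| <= h by rewrite ler_norml; move: z1; clear; lra.
  have : `|complex.Im z - y0| <= h by rewrite ler_norml; move: z2; clear; lra.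
  by move: hr r0; clear; lra.
- have {}h5 : h * (16 * M) <= e by rewrite -ler_pdivlMr ?mulr_gt0.
  by move: (mulr_gt0 h0 M0) h5; clear; lra.
Qed.

Lemma rint_inv_neq0 a b c d z0 :
  a < complex.Re z0 < b -> c < complex.Im z0 < d ->
  rint a b c d (fun z => (z - z0)^-1) != 0.
Proof.
case: z0 => x0 y0 /= /andP[ax xb] /andP[cy yd].
pose g z : R[i] := (z - (x0 +i* y0))^-1.
have gE x y : g (x +i* y) = ((x - x0) / ((x - x0) ^+ 2 + (y - y0) ^+ 2)) -i*
   ((y - y0) / ((x - x0) ^+ 2 + (y - y0) ^+ 2)) by [].
have ab : a <= b by lra.
have cd : c <= d by lra.
have [g1 g2 g3 g4] : bcont a b c d g.
  apply: bcontP => // z [_ zb]; apply: ccontV; last first.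
    by apply: ccontD; [exact: ccont_id|exact: ccont_cst].
  by rewrite subr_eq0; apply/eqP => zz; move: zb; rewrite zz /=; case; lra.
have R0 (u : R[i]) : complex.Im u != 0 -> u != 0 by apply: contra_neq => ->.
apply: R0.
have -> : complex.Im (rint a b c d g) =
    complex.Im (sint a b (fun x => g (x +i* c) - g (x +i* d))) +
    complex.Re (sint c d (fun y => g (b +i* y) - g (a +i* y))).
  by rewrite /rint; case: (sint a b _) => ? ?; case: (sint c d _) => ? ? /=; ring.
have sq0 (u v : R) : 0 <= u ^+ 2 + v ^+ 2 by rewrite addr_ge0 ?sqr_ge0.
rewrite gt_eqF// ltr_pwDl//.
  set K := (y0 - c) / ((b - a) ^+ 2 + (y0 - c) ^+ 2).
  have K0 : 0 < K by rewrite divr_gt0// ?subr_gt0// ltr_wpDl ?sqr_ge0// exprn_gt0// subr_gt0.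
  apply: (@lt_le_trans _ _ (\int[lebesgue_measure]_(x in `[a, b]) K)).
    rewrite Rintegral_cst//= lebesgue_measure_itv/= lte_fin.
    by rewrite (lt_trans ax xb)/= mulr_gt0// subr_gt0 (lt_trans ax xb).
  apply: le_Rintegral => //.
  - by apply: continuous_integrable => x _; exact: cvg_cst.
  - by apply: scont_integrable_Im; exact: scontB.
  move=> x; rewrite /= in_itv/= => /andP[xa xb'].
  rewrite opprK ler_wpDr//.
    by rewrite divr_ge0//; lra.
  rewrite -mulNr opprB /K ler_pM2l ?subr_gt0// lef_pV2 ?posrE.
  - have -> : (c - y0) ^+ 2 = (y0 - c) ^+ 2 by ring.
    by rewrite lerD2r -[leLHS]real_normK ?num_real// lerXn2r ?nnegrE//; [lra|rewrite ler_norml; lra].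
  - by rewrite ltr_wpDl ?sqr_ge0// exprn_gt0// subr_gt0.
  - rewrite ltr_wpDl ?sqr_ge0//; have -> : (c - y0) ^+ 2 = (y0 - c) ^+ 2 by ring.
    by rewrite exprn_gt0// subr_gt0.
apply: Rintegral_ge0 => y _; rewrite ReB !gE /= -mulNr.
by rewrite addr_ge0// mulr_ge0// ?invr_ge0//; lra.
Qed.

Lemma cauchy_formula a b c d f z0 :
  a < complex.Re z0 < b -> c < complex.Im z0 < d ->
  (forall z, inrect a b c d z -> cdiff f z) ->
  f z0 * rint a b c d (fun z => (z - z0)^-1) =
  rint a b c d (fun z => (z - z0)^-1 * f z).
Proof.
move=> xz yz df.
have ab : a <= b by lra.
have cd : c <= d by lra.
have [q cq fq] : cdiff f z0 by apply: df; split; lra.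
have qE z : z != z0 -> q z = (z - z0)^-1 * f z - f z0 * (z - z0)^-1.
  move=> zz; have nz : z - z0 != 0 by rewrite subr_eq0.
  by rewrite [in f z]fq; field.
have bz z : onbd a b c d z -> z != z0.
  by move=> [_ zb]; apply/eqP => zz; move: zb; rewrite zz /=; case; lra.
have dV z : z != z0 -> cdiff (fun z => (z - z0)^-1) z.
  move=> zz; apply: cdiffV; first by rewrite subr_eq0.
  by apply: cdiffB; [exact: cdiff_id|exact: cdiff_cst].
have cV : bcont a b c d (fun z => (z - z0)^-1).
  by apply: bcontP => // z /bz /dV /cdiff_cont.
have : rint a b c d q = 0.
  apply: (@goursat_punctured _ _ _ _ _ z0) => // z zr zz.
  have r0 : 0 < normc (z - z0).
    rewrite lt_neqAle normc_ge0 andbT eq_sym; apply: contra_neq zz.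
    by move=> /eq0_normc/eqP; rewrite subr_eq0 => /eqP.
  apply: (@cdiff_near _ (fun z => (z - z0)^-1 * f z - f z0 * (z - z0)^-1) _ _ (normc (z - z0))) => //.
    move=> w wr; rewrite qE//; apply: contraTN wr => /eqP ->.
    by rewrite -normcN opprB ltxx.
  apply: cdiffB; apply: cdiffM; [exact: dV|exact: df|exact: cdiff_cst|exact: dV].
rewrite (@eq_rint _ _ _ _ q (fun z => (z - z0)^-1 * f z - f z0 * (z - z0)^-1))//; last first.
  by move=> z /bz; exact: qE.
rewrite rintB_bcont//.
- by rewrite rintZ_bcont// => /eqP; rewrite subr_eq0 => /eqP ->.
- apply: bcontP => // z zb; apply: ccontM.
    by have /bz /dV /cdiff_cont := zb.
  by apply: cdiff_cont; apply: df; case: zb.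
- apply: bcontP => // z zb; apply: ccontM; first exact: ccont_cst.
  by have /bz /dV /cdiff_cont := zb.
Qed.

End Cauchy.

Section Continuation.
Variable R : realType.
Implicit Types (z w s : R[i]) (f : R[i] -> R[i]).

Lemma pow_unbounded (x y K : R) : 1 < x -> (forall n : nat, y * x ^+ n <= K) -> y <= 0.
Proof.
move=> x1 H; rewrite leNgt; apply/negP => y0.
have B (n : nat) : 1 + n%:R * (x - 1) <= x ^+ n.
  elim: n => [|n IH]; first by rewrite expr0; lra.
  rewrite exprS; have h : 0 <= n%:R :> R by rewrite ler0n.
  have : x * (1 + n%:R * (x - 1)) <= x * x ^+ n by rewrite ler_pM2l//; lra.
  rewrite -natr1 => h2; have : 0 <= n%:R * (x - 1) ^+ 2 by rewrite mulr_ge0// sqr_ge0.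
  by lra.
set n := (Num.truncn (K / (y * (x - 1)))).+1.
have yx : 0 < y * (x - 1) by rewrite mulr_gt0// subr_gt0.
have := truncnS_gt (K / (y * (x - 1))); rewrite -/n ltr_pdivrMr// => h.
have := H n; have : y * (1 + n%:R * (x - 1)) <= y * x ^+ n by rewrite ler_pM2l.
by lra.
Qed.

(* Cauchy's formula for f(w) (r / (w - s0))^n, which is bounded on the boundary of the square
   uniformly in n but grows like (r / p)^n at s0 - p. *)
Lemma square_continuation f s0 (r rho p : R) : 0 < rho -> 0 < p -> p < r ->
  (forall z, `|complex.Re z - complex.Re s0| <= r ->
     `|complex.Im z - complex.Im s0| <= r -> cdiff f z) ->
  (forall z, normc (z - s0) < rho -> f z = 0) -> f (s0 - p%:C) = 0.
Proof.
move=> rho0 p0 pr df f0; set z0 := s0 - p%:C.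
set a := complex.Re s0 - r; set b := complex.Re s0 + r.
set c := complex.Im s0 - r; set d := complex.Im s0 + r.
have Rz : complex.Re z0 = complex.Re s0 - p by rewrite ReB.
have Iz : complex.Im z0 = complex.Im s0 by rewrite ImB subr0.
have rz : a < complex.Re z0 < b by rewrite Rz /a /b; lra.
have iz : c < complex.Im z0 < d by rewrite Iz /c /d; lra.
have ab : a <= b by lra.
have cd : c <= d by lra.
have dfr z : inrect a b c d z -> cdiff f z.
  by move=> [z1 z2]; apply: df; rewrite ler_norml; rewrite /a /b /c /d in z1 z2; lra.
pose h (n : nat) w := f w * (r%:C / (w - s0)) ^+ n.
have dh n z : inrect a b c d z -> cdiff (h n) z.
  move=> zr; have [->|zs] := eqVneq z s0.
    apply: (@cdiff_near _ (fun=> 0) _ _ rho) => //; last exact: cdiff_cst.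
    by move=> w /f0; rewrite /h => ->; rewrite mul0r.
  apply: cdiffM; first exact: dfr.
  apply: cdiffX; apply: cdiffZl; apply: cdiffV; first by rewrite subr_eq0.
  by apply: cdiffB; [exact: cdiff_id|exact: cdiff_cst].
have [M MP] : exists M, forall z, onbd a b c d z -> normc (f z) <= M.
  have [f1 f2 f3 f4] : bcont a b c d f.
    by apply: bcontP => // z [/dfr /cdiff_cont].
  have [M1 P1] := scont_bounded ab f1; have [M2 P2] := scont_bounded ab f2.
  have [M3 P3] := scont_bounded cd f3; have [M4 P4] := scont_bounded cd f4.
  exists (`|M1| + `|M2| + `|M3| + `|M4|) => -[x y] [[/= hx hy]].
  have n1 := ler_norm M1; have n2 := ler_norm M2; have n3 := ler_norm M3; have n4 := ler_norm M4.
  have [q1 q2 q3 q4] := And4 (normr_ge0 M1) (normr_ge0 M2) (normr_ge0 M3) (normr_ge0 M4).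
  case=> e; rewrite e.
  - by have := P3 y hy; move: n1 n2 n3 n4 q1 q2 q3 q4; clear; lra.
  - by have := P4 y hy; move: n1 n2 n3 n4 q1 q2 q3 q4; clear; lra.
  - by have := P1 x hx; move: n1 n2 n3 n4 q1 q2 q3 q4; clear; lra.
  - by have := P2 x hx; move: n1 n2 n3 n4 q1 q2 q3 q4; clear; lra.
have far z : onbd a b c d z -> r <= normc (z - s0) /\ r - p <= normc (z - z0).
  move=> [_ hz]; have N1 := normc_Re (z - s0); have N2 := normc_Im (z - s0).
  have N3 := normc_Re (z - z0); have N4 := normc_Im (z - z0).
  rewrite ReB ?Rz in N1; rewrite ImB ?Iz in N2; rewrite ReB Rz in N3; rewrite ImB Iz in N4.
  rewrite /a /b /c /d in hz; move: p0 pr hz N1 N2 N3 N4; rewrite !ler_norml; clear.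
  move=> p0 pr hz /andP[? ?] /andP[? ?] /andP[? ?] /andP[? ?].
  by case: hz => hz; split; lra.
have r0 : 0 < r by lra.
set L := rint a b c d (fun z => (z - z0)^-1).
have L0 : L != 0 by exact: rint_inv_neq0.
have L1 : 0 < normc L.
  by rewrite lt_neqAle normc_ge0 andbT eq_sym; apply: contra_neq L0 => /eq0_normc.
apply: eq0_normc; apply/eqP; rewrite eq_le normc_ge0 andbT.
rewrite -(pmulr_lle0 _ L1).
apply: (@pow_unbounded (r / p) _ (4 * ((b - a) + (d - c)) * ((r - p)^-1 * `|M|))).
  by rewrite ltr_pdivlMr// mul1r.
move=> n; have := cauchy_formula rz iz (dh n).
have -> : h n z0 = f z0 * (- (r / p)%:C) ^+ n.
  rewrite /h /z0; congr (_ * _ ^+ n); rewrite addrAC subrr add0r invrN mulrN.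
  by rewrite rmorphM fmorphV.
move=> /(congr1 (@normc R)); rewrite -/L !normcM => E.
have NX (u : R[i]) k : normc (u ^+ k) = normc u ^+ k.
  by elim: k => [|k IH]; rewrite ?expr0 ?normc1// !exprS normcM IH.
rewrite NX normcN normcC ger0_norm ?divr_ge0// ?ltW// in E.
rewrite mulrAC E; apply: rint_bound_bcont => //.
  apply: bcontP => // z zb; apply: ccontM; last first.
    by apply: cdiff_cont; apply: dh; case: zb.
  have [_ zf] := far _ zb; apply: ccontV.
    by apply/eqP => zz; move: zf; rewrite zz normc0 leNgt subr_gt0 pr.
  by apply: ccontD; [exact: ccont_id|exact: ccont_cst].
move=> z zb; have [h1 h2] := far _ zb.
rewrite normcM normcV /h normcM NX normcM normcC normcV (ger0_norm (ltW r0)).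
apply: ler_pM; rewrite ?invr_ge0 ?mulr_ge0 ?exprn_ge0 ?divr_ge0 ?normc_ge0 ?(ltW r0)//.
  by rewrite lef_pV2 ?posrE ?subr_gt0// (lt_le_trans _ h2)// subr_gt0.
rewrite -[leRHS]mulr1; apply: ler_pM; rewrite ?exprn_ge0 ?divr_ge0 ?normc_ge0 ?(ltW r0)//.
  by rewrite (le_trans (MP _ zb))// ler_norm.
by rewrite exprn_ile1// ?divr_ge0 ?normc_ge0 ?(ltW r0)// ler_pdivrMr ?mul1r// (lt_le_trans r0 h1).
Qed.

End Continuation.

(** * Divisor functions *)

Lemma size_divisorsM (a b : nat) : (0 < a)%N -> (0 < b)%N ->
  (size (divisors (a * b)) <= size (divisors a) * size (divisors b))%N.
Proof.
move=> a0 b0; rewrite -(size_allpairs muln); apply: uniq_leq_size.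
  exact: divisors_uniq.
move=> e; rewrite -dvdn_divisors ?muln_gt0 ?a0// => eab.
have e0 : (0 < e)%N by apply: dvdn_gt0 eab; rewrite muln_gt0 a0.
apply/allpairsP; exists (gcdn e a, e %/ gcdn e a)%N => /=.
have g0 : (0 < gcdn e a)%N by rewrite gcdn_gt0 e0.
split; first by rewrite -dvdn_divisors// dvdn_gcdr.
  rewrite -dvdn_divisors// -(@Gauss_dvdr _ (a %/ gcdn e a)).
    rewrite -(@dvdn_pmul2r (gcdn e a))// divnK ?dvdn_gcdl//.
    by rewrite mulnAC divnK// dvdn_gcdr.
  rewrite /coprime -(eqn_pmul2r g0) mul1n muln_gcdl !divnK ?dvdn_gcdl ?dvdn_gcdr//.
by rewrite mulnC divnK// dvdn_gcdl.
Qed.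

Lemma size_divisors_prime_exp (p e : nat) : prime p ->
  (size (divisors (p ^ e)) <= e.+1)%N.
Proof.
move=> pp; rewrite -(size_iota 0 e.+1) -(size_map (expn p) (iota 0 e.+1)).
apply: uniq_leq_size; first exact: divisors_uniq.
move=> d; rewrite -dvdn_divisors ?expn_gt0 ?prime_gt0//.
move=> /dvdn_pfactor -/(_ pp)[m me ->]; apply: map_f.
by rewrite mem_iota add0n ltnS.
Qed.

Lemma divisor_fun_le (k n : nat) : (0 < n)%N ->
  (divisor_fun k n <= size (divisors n) ^ k)%N.
Proof.
move=> n0; pose D := [pred i : 'I_n.+1 | (i %| n)%N].
apply: (@leq_trans (#|D| ^ k)); last first.
  case: (k) => [|k']; first by rewrite !expn0.
  rewrite leq_exp2r//.
  rewrite cardE -(size_map val); apply: uniq_leq_size.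
    by rewrite map_inj_uniq ?enum_uniq//; exact: val_inj.
  by move=> _ /mapP[i + ->]; rewrite mem_enum inE -dvdn_divisors.
have -> : (#|D| ^ k)%N = #|(ffun_on D : pred {ffun 'I_k -> 'I_n.+1})| by rewrite card_ffun_on card_ord.
rewrite /divisor_fun; apply: fintype.subset_leq_card; apply/fintype.subsetP.
move=> t; rewrite inE => /eqP tn; apply/ffun_onP => i; rewrite inE.
by rewrite -[X in (_ %| X)%N]tn (bigD1 i)//= dvdn_mulr.
Qed.

Section DivisorBound.
Variable R : realType.

Lemma powR_natM (e : R) (m n : nat) : (0 < m)%N -> (0 < n)%N ->
  (m * n)%:R `^ e = m%:R `^ e * n%:R `^ e.
Proof. by move=> m0 n0; rewrite natrM powRM. Qed.

Let rough (j n : nat) := forall p : nat, prime p -> (p %| n)%N -> (j <= p)%N.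

Lemma divisors_rough (e : R) (j n : nat) : 0 < e -> 2 <= j%:R `^ e -> (0 < n)%N ->
  rough j n -> (size (divisors n))%:R <= n%:R `^ e.
Proof.
move=> e0 je; elim/ltn_ind: n => n IH n0 rn.
have [n1|n1] := leqP n 1.
  have -> : n = 1%N by apply/eqP; rewrite eqn_leq n1.
  by rewrite powR1.
have pp := pdiv_prime n1; have pn := pdiv_dvd n.
set p := pdiv n in pp pn.
have p0 := prime_gt0 pp.
have m0 : (0 < n %/ p)%N by rewrite divn_gt0// dvdn_leq.
have nE : n = (p * (n %/ p))%N by rewrite mulnC divnK.
rewrite nE powR_natM//.
apply: (@le_trans _ _ (size (divisors p) * size (divisors (n %/ p)))%:R).
  by rewrite ler_nat size_divisorsM.
rewrite natrM; apply: ler_pM; rewrite ?ler0n//.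
  apply: (@le_trans _ _ 2).
    by rewrite ler_nat; have := size_divisors_prime_exp 1 pp; rewrite expn1.
  apply: (le_trans je); apply: ge0_ler_powR; rewrite ?nnegrE ?ler0n ?(ltW e0)// ler_nat.
  exact: rn.
apply: IH => //; first by rewrite ltn_Pdiv// prime_gt1.
by move=> r pr rdv; apply: rn => //; rewrite nE dvdn_mull.
Qed.

Lemma divisors_rough_step (e : R) (j : nat) (C : R) : 0 < e -> (2 <= j)%N -> 0 <= C ->
  (forall n, (0 < n)%N -> rough j.+1 n -> (size (divisors n))%:R <= C * n%:R `^ e) ->
  forall n, (0 < n)%N -> rough j n ->
    (size (divisors n))%:R <= ((1 + (e * ln 2)^-1) * C) * n%:R `^ e.
Proof.
move=> e0 j2 C0 H n n0 rn.
have l2 : 0 < ln (2 : R) by rewrite ln_gt0// ltr1n.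
have el : 0 < e * ln 2 by rewrite mulr_gt0.
have K1 : 1 <= 1 + (e * ln 2)^-1 by rewrite lerDl invr_ge0 ltW.
have [pj|npj] := boolP (prime j); last first.
  apply: (@le_trans _ _ (C * n%:R `^ e)).
    apply: H => // p pp pn; rewrite ltn_neqAle rn// andbT.
    by apply: contraNneq npj => ->.
  by rewrite ler_wpM2r ?powR_ge0// ler_peMl.
have [m jm nE] := pfactor_coprime pj n0.
set a := logn j n in nE.
have m0 : (0 < m)%N by move: n0; rewrite nE muln_gt0 => /andP[].
have ja0 : (0 < j ^ a)%N by rewrite expn_gt0 prime_gt0.
rewrite nE powR_natM//.
apply: (@le_trans _ _ (size (divisors m) * size (divisors (j ^ a)))%:R).
  by rewrite ler_nat size_divisorsM.
rewrite natrM.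
have -> : (1 + (e * ln 2)^-1) * C * (m%:R `^ e * (j ^ a)%:R `^ e) =
  (C * m%:R `^ e) * ((1 + (e * ln 2)^-1) * (j ^ a)%:R `^ e) by ring.
apply: ler_pM; rewrite ?ler0n//.
  apply: H => // p pp pm; rewrite ltn_neqAle rn//; last by rewrite nE dvdn_mulr.
  rewrite andbT; apply/eqP => jp; move: jm; rewrite prime_coprime// jp pm//.
apply: (@le_trans _ _ a.+1%:R); first by rewrite ler_nat size_divisors_prime_exp.
apply: (@le_trans _ _ ((1 + (e * ln 2)^-1) * (2 ^ a)%:R `^ e)); last first.
  rewrite ler_wpM2l//; first by rewrite (le_trans _ K1).
  apply: ge0_ler_powR; rewrite ?nnegrE ?ler0n ?(ltW e0)// ler_nat.
  by case: (a) => // a'; rewrite leq_exp2r.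
have -> : (2 ^ a)%:R `^ e = expR (a%:R * (e * ln 2)) :> R.
  rewrite /powR pnatr_eq0 expn_eq0/= natrX lnXn// -mulr_natl.
  by congr expR; ring.
have h := expR_ge1Dx (a%:R * (e * ln (2 : R))).
have a0 : 0 <= a%:R :> R by rewrite ler0n.
apply: (@le_trans _ _ ((1 + (e * ln 2)^-1) * (1 + a%:R * (e * ln 2)))); last first.
  by rewrite ler_wpM2l//; rewrite (le_trans _ K1).
have -> : (1 + (e * ln 2)^-1) * (1 + a%:R * (e * ln 2)) =
   1 + a%:R + ((e * ln 2)^-1 + a%:R * (e * ln 2)).
  by field; rewrite !gt_eqF.
by rewrite -natr1 addrC lerDl addr_ge0 ?mulr_ge0 ?invr_ge0// ltW.
Qed.

(* Primes p with p^e >= 2 contribute at most a factor n^e; the finitely many smaller ones are removed one at a time. *)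
Lemma divisors_bound (e : R) : 0 < e ->
  exists2 C : R, 0 <= C & forall n : nat, (0 < n)%N -> (size (divisors n))%:R <= C * n%:R `^ e.
Proof.
move=> e0.
suff H (i : nat) (C : R) : 0 <= C ->
    (forall n, (0 < n)%N -> rough i.+2 n -> (size (divisors n))%:R <= C * n%:R `^ e) ->
    exists2 C : R, 0 <= C & forall n : nat, (0 < n)%N -> (size (divisors n))%:R <= C * n%:R `^ e.
  set x : R := 2 `^ e^-1.
  have xj : x <= (Num.truncn x).+2%:R.
    by apply: (le_trans (ltW (truncnS_gt x))); rewrite ler_nat.
  apply: (H (Num.truncn x) 1) => // n n0 rn; rewrite mul1r.
  apply: divisors_rough rn => //.
  have -> : 2 = x `^ e by rewrite /x -powRrM mulVf ?gt_eqF// powRr1.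
  by apply: ge0_ler_powR; rewrite ?nnegrE ?powR_ge0 ?ler0n ?(ltW e0).
elim: i C => [|i IH] C C0 HC.
  by exists C => // n n0; apply: HC => // p /prime_gt1.
have l2 : 0 < ln (2 : R) by rewrite ln_gt0// ltr1n.
apply: (IH ((1 + (e * ln 2)^-1) * C)).
  by rewrite mulr_ge0// addr_ge0// invr_ge0 mulr_ge0// ltW.
exact: divisors_rough_step.
Qed.

Lemma divisor_fun_bound (k : nat) (e : R) : 0 < e ->
  exists2 C : R, 0 < C & forall n : nat, (0 < n)%N -> (divisor_fun k n)%:R <= C * n%:R `^ e.
Proof.
move=> e0; have ek : 0 < e / k.+1%:R by rewrite divr_gt0.
have [C C0 H] := divisors_bound ek; exists (C ^+ k + 1).
  by rewrite ltr_wpDl// exprn_ge0.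
move=> n n0; apply: (@le_trans _ _ ((size (divisors n))%:R ^+ k)).
  by rewrite -natrX ler_nat divisor_fun_le.
apply: (@le_trans _ _ ((C * n%:R `^ (e / k.+1%:R)) ^+ k)).
  by rewrite lerXn2r ?nnegrE ?ler0n ?mulr_ge0 ?powR_ge0// H.
rewrite exprMn; apply: ler_pM; rewrite ?exprn_ge0 ?powR_ge0//.
  by rewrite lerDl.
rewrite -powR_mulrn ?powR_ge0// -powRrM; apply: ler_powR; first by rewrite ler1n.
by rewrite -mulrA ler_piMr ?(ltW e0)// ler_pdivrMl// mulr1 ler_nat.
Qed.

End DivisorBound.

Section Grouping.

(* The coefficients of the k-th power of the Dirichlet polynomial sum_(n <= N) n^(-s). *)
Definition cprod (k N m : nat) : nat :=
  #|[pred t : {ffun 'I_k -> 'I_N} | (\prod_(i < k) (t i).+1)%N == m]|.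

Lemma prod_ge_factor (k : nat) (F : 'I_k -> nat) (i : 'I_k) :
  (0 < \prod_(j < k) F j)%N -> (F i <= \prod_(j < k) F j)%N.
Proof. by move=> h; apply: dvdn_leq => //; rewrite (bigD1 i)//= dvdn_mulr. Qed.

Lemma cprod_le (k N m : nat) : (cprod k N m <= divisor_fun k m)%N.
Proof.
pose F (t : {ffun 'I_k -> 'I_N}) : {ffun 'I_k -> 'I_m.+1} := [ffun i => inord (t i).+1].
set A := [pred t : {ffun 'I_k -> 'I_N} | (\prod_(i < k) (t i).+1)%N == m].
have tm t : t \in A -> forall i, ((t i).+1 < m.+1)%N.
  rewrite inE => /eqP tm i; rewrite ltnS -[X in (_ <= X)%N]tm.
  apply: (@prod_ge_factor k (fun i => (t i).+1)).
  by rewrite prodn_gt0.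
have Finj : {in A &, injective F}.
  move=> t u tA uA /ffunP E; apply/ffunP => i; have := E i; rewrite !ffunE.
  move=> /(congr1 val); rewrite /= !inordK ?tm// => -[]; exact: val_inj.
rewrite /cprod -/A -(card_in_image Finj) /divisor_fun.
apply: fintype.subset_leq_card; apply/fintype.subsetP => _ /mapP[t + ->].
rewrite mem_enum => tA.
rewrite inE; have := tA; rewrite inE => /eqP tE; rewrite -[X in _ == X]tE; apply/eqP.
by apply: eq_bigr => i _; rewrite ffunE inordK// tm.
Qed.

Lemma cprod_eq (k N m : nat) : (0 < m)%N -> (m <= N)%N -> cprod k N m = divisor_fun k m.
Proof.
move=> m0 mN; apply/eqP; rewrite eqn_leq cprod_le/= /divisor_fun.
case: N mN => [|N mN]; first by move: m0; case: m.
pose F (t : {ffun 'I_k -> 'I_m.+1}) : {ffun 'I_k -> 'I_N.+1} := [ffun i => inord (t i).-1].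
set A := [pred t : {ffun 'I_k -> 'I_m.+1} | (\prod_(i < k) t i)%N == m].
have tm t : t \in A -> forall i, (0 < t i)%N.
  rewrite inE => /eqP tm i; rewrite lt0n; apply/eqP => ti; move: m0.
  by rewrite -[X in (0 < X)%N]tm (bigD1 i)//= ti mul0n.
have tN (t : {ffun 'I_k -> 'I_m.+1}) i : ((t i).-1 < N.+1)%N.
  rewrite ltnS; have := ltn_ord (t i); rewrite ltnS => h.
  by rewrite -[N]/(N.+1.-1) -!subn1 leq_sub2r// (leq_trans h).
have tN' (t : {ffun 'I_k -> 'I_m.+1}) i : (0 < t i)%N -> ((t i).-1 < N.+1)%N by [].
have Finj : {in A &, injective F}.
  move=> t u tA uA /ffunP E; apply/ffunP => i; have := E i; rewrite !ffunE.
  move=> /(congr1 val); rewrite /= !inordK// => h; apply: val_inj => /=.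
  by rewrite -(prednK (tm _ tA i)) -(prednK (tm _ uA i)) h.
rewrite -(card_in_image Finj) /cprod.
apply: fintype.subset_leq_card; apply/fintype.subsetP => _ /mapP[t + ->].
rewrite mem_enum => tA.
rewrite inE; have := tA; rewrite inE => /eqP tE; rewrite -[X in _ == X]tE; apply/eqP.
by apply: eq_bigr => i _; rewrite ffunE inordK// prednK// tm.
Qed.

Lemma pow_sum_group (K : comNzRingType) (a : nat -> K) (k N : nat) :
  a 1%N = 1 -> (forall m n, (0 < m)%N -> (0 < n)%N -> a (m * n)%N = a m * a n) ->
  (\sum_(i < N) a i.+1) ^+ k = \sum_(m < (N ^ k).+1) (cprod k N m)%:R * a m.
Proof.
move=> a1 aM.
have -> : (\sum_(i < N) a i.+1) ^+ k = \prod_(i < k) \sum_(j < N) a j.+1.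
  by rewrite prodr_const card_ord.
rewrite bigA_distr_bigA /=.
have aP (t : {ffun 'I_k -> 'I_N}) : \prod_(i < k) a (t i).+1 = a (\prod_(i < k) (t i).+1)%N.
  have [_ //] : (0 < \prod_(i < k) (t i).+1)%N /\ \prod_(i < k) a (t i).+1 = a (\prod_(i < k) (t i).+1)%N.
  apply: (big_rec2 (fun x y => (0 < x)%N /\ y = a x)) => // i x y _ [x0 ->].
  by rewrite muln_gt0 x0 aM.
have tk (t : {ffun 'I_k -> 'I_N}) : (\prod_(i < k) (t i).+1 < (N ^ k).+1)%N.
  rewrite ltnS -[k in X in (_ <= X)%N]card_ord -prod_nat_const.
  by apply: leq_prod => i _; exact: ltn_ord.
rewrite (partition_big (fun t : {ffun 'I_k -> 'I_N} => inord (\prod_(i < k) (t i).+1) : 'I_(N ^ k).+1) predT)//=.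
apply: eq_bigr => m _.
rewrite (eq_bigl (fun t : {ffun 'I_k -> 'I_N} => t \in [pred t : {ffun 'I_k -> 'I_N} | (\prod_(i < k) (t i).+1)%N == m])); last first.
  by move=> t; rewrite !inE -val_eqE /= inordK.
rewrite (eq_bigr (fun=> a m)); last first.
  by move=> t; rewrite !inE aP => /eqP ->.
by rewrite sumr_const mulr_natl.
Qed.

End Grouping.

Section PSeries.
Variable R : realType.

Lemma powR_telescope (dl : R) (m : nat) : 0 < dl -> (0 < m)%N ->
  m.+1%:R `^ (-1 - dl) <= dl^-1 * (m%:R `^ (- dl) - m.+1%:R `^ (- dl)) :> R.
Proof.
move=> d0 m0; set x : R := m.+1%:R.
have x1 : 1 < x by rewrite /x ltr1n ltnS.
have x0 : 0 < x by lra.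
have mx : m%:R = x * (1 - x^-1).
  by rewrite mulrBr mulr1 mulfV ?gt_eqF// /x -natr1 addrK.
have y0 : 0 < 1 - x^-1 by rewrite subr_gt0 invf_lt1.
rewrite mx powRM ?(ltW x0) ?(ltW y0)//.
have -> : x `^ (-1 - dl) = x `^ (- dl) * x^-1.
  by rewrite addrC powRD ?powR_inv1 ?(ltW x0)//; apply/implyP => _; rewrite gt_eqF.
have -> : dl^-1 * (x `^ (- dl) * (1 - x^-1) `^ (- dl) - x `^ (- dl)) =
  x `^ (- dl) * (dl^-1 * ((1 - x^-1) `^ (- dl) - 1)) by ring.
rewrite ler_wpM2l ?powR_ge0// ler_pdivlMl// lerBrDl.
rewrite /powR gt_eqF//; apply: le_trans (expR_ge1Dx _); rewrite lerD2l.
rewrite mulNr -mulrN ler_wpM2l ?(ltW d0)// lerNr.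
apply: (@le_ln1Dx R (- x^-1)); move: y0; move: (x^-1) => u; lra.
Qed.

Lemma sum_powR_tail (dl : R) (N M : nat) : 0 < dl -> (0 < N)%N ->
  \sum_(N.+1 <= m < M.+1) m%:R `^ (-1 - dl) <= dl^-1 * N%:R `^ (- dl) :> R.
Proof.
move=> d0 N0; have [MN|NM] := leqP M N.
  by rewrite big_geq ?ltnS// mulr_ge0 ?powR_ge0// invr_ge0 ltW.
apply: (@le_trans _ _ (dl^-1 * (N%:R `^ (- dl) - M%:R `^ (- dl)))); last first.
  by rewrite ler_wpM2l ?invr_ge0 ?(ltW d0)// lerBlDr lerDl powR_ge0.
have := ltnW NM; move: M {NM} => M /subnK <-; move: (M - N)%N => j.
elim: j => [|j IH]; first by rewrite add0n big_geq// subrr mulr0.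
rewrite addSn big_nat_recr/= ?ltnS ?leq_addl//.
have jN : (0 < j + N)%N by rewrite addn_gt0 N0 orbT.
apply: (le_trans (lerD IH (powR_telescope d0 jN))).
by rewrite -mulrDr addrA subrK.
Qed.

End PSeries.

Section DirichletPower.
Variable R : realType.

Lemma powR_neg_small (dl e : R) : 0 < dl -> 0 < e ->
  exists N0 : nat, forall x : R, N0%:R <= x -> x `^ (- dl) < e.
Proof.
move=> d0 e0; have v0 : 0 < e^-1 by rewrite invr_gt0.
exists (Num.truncn (e^-1 `^ dl^-1)).+1 => x Nx.
have {}Nx : e^-1 `^ dl^-1 < x by apply: lt_le_trans Nx; exact: truncnS_gt.
have x0 : 0 < x by apply: le_lt_trans Nx; exact: powR_ge0.
rewrite powRN -[e]invrK ltf_pV2 ?posrE ?powR_gt0//.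
have -> : e^-1 = (e^-1 `^ dl^-1) `^ dl.
  by rewrite -powRrM mulVf ?gt_eqF// powRr1// ltW.
by apply: gt0_ltr_powR; rewrite ?nnegrE ?powR_ge0// ltW.
Qed.

Lemma normc_cexp_neg_ln (s : R[i]) (x : R) : 0 < x ->
  normc (cexp (- s * (ln x)%:C)) = x `^ (- complex.Re s).
Proof.
move=> x0; rewrite normc_cexp /powR gt_eqF//; congr expR.
by case: s => a b /=; rewrite mulr0 subr0.
Qed.

Lemma normc_sum (I : Type) (r : seq I) (P : pred I) (F : I -> R[i]) :
  normc (\sum_(i <- r | P i) F i) <= \sum_(i <- r | P i) normc (F i).
Proof.
apply: (big_rec2 (fun x y => normc x <= y)) => [|i y x _ h]; first by rewrite normc0.
by apply: (le_trans (le_normcD _ _)); rewrite lerD2l.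
Qed.

Lemma normc_nat (n : nat) : normc (n%:R : R[i]) = n%:R.
Proof. by rewrite normcMn normc1. Qed.

Lemma dirichlet_pow (zeta : R[i] -> R[i]) (k : nat) (s : R[i]) (e : R) :
  is_riemann_zeta zeta -> (0 < k)%N -> 1 < complex.Re s -> 0 < e ->
  exists N0 : nat, forall N, (N0 <= N)%N ->
    normc (\sum_(1 <= n < N.+1) (divisor_fun k n)%:R * cexp (- s * (ln n%:R)%:C)
           - zeta s ^+ k) < e.
Proof.
move=> [zs _] k0 s1 e0; pose a (n : nat) : R[i] := cexp (- s * (ln n%:R)%:C).
have a1 : a 1%N = 1 by rewrite /a ln1 mulr0 cexp0.
have aM m n : (0 < m)%N -> (0 < n)%N -> a (m * n)%N = a m * a n.
  by move=> m0 n0; rewrite /a -cexpD natrM lnM ?posrE ?ltr0n// rmorphD mulrDr.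
have e2 : 0 < e / 2 by rewrite divr_gt0.
have /ccontP/(_ _ e2)[r r0 rP] : ccont (fun w : R[i] => w ^+ k) (zeta s).
  by apply/cdiff_cont/cdiffX; exact: cdiff_id.
have [N1 N1P] : exists N1 : nat, forall N, (N1 <= N)%N ->
    normc (\sum_(i < N) a i.+1 - zeta s) < r.
  have /(@cvgrPdist_lt _ R[i]^o)/(_ r%:C) := zs s s1; rewrite ltcR => /(_ r0).
  move=> [N1 _ N1P]; exists N1 => N NN1; have := N1P N NN1.
  rewrite /= normcE ltcR -normcN opprB seriesEord /=.
  by under eq_bigr => i _ do rewrite cpowE ?ltr0n//.
pose dl := (complex.Re s - 1) / 2.
have d0 : 0 < dl by rewrite divr_gt0// subr_gt0.
have [C C0 CP] := divisor_fun_bound k d0.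
have [N2 N2P] : exists N0 : nat, forall x : R, N0%:R <= x -> x `^ (- dl) < e / 2 / (C * dl^-1).
  by apply: powR_neg_small => //; rewrite divr_gt0// mulr_gt0// invr_gt0.
exists (maxn 1 (maxn N1 N2)) => N; rewrite !geq_max => /and3P[N0 h1 h2].
have -> : \sum_(1 <= n < N.+1) (divisor_fun k n)%:R * cexp (- s * (ln n%:R)%:C) - zeta s ^+ k
  = ((\sum_(i < N) a i.+1) ^+ k - zeta s ^+ k) -
    \sum_(N.+1 <= m < (N ^ k).+1) (cprod k N m)%:R * a m.
  rewrite (pow_sum_group k N a1 aM) -(big_mkord xpredT (fun m => (cprod k N m)%:R * a m)).
  have Nk : (N.+1 <= (N ^ k).+1)%N by rewrite ltnS -{1}[N]expn1 leq_pexp2l.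
  rewrite [X in _ = X - _ - _](@big_cat_nat _ _ _ N.+1)//=.
  rewrite [in RHS]big_ltn// (_ : cprod k N 0 = 0%N) ?mul0r ?add0r; last first.
    apply/eqP/pred0P => t; apply/negbTE; rewrite inE -lt0n prodn_gt0//.
  rewrite (@eq_big_nat _ _ _ 1 N.+1 _ (fun n => (cprod k N n)%:R * a n)); last first.
    by move=> n /andP[n0 nN]; rewrite cprod_eq.
  by ring.
apply: (le_lt_trans (le_normcD _ _)); rewrite normcN.
have h3 : normc ((\sum_(i < N) a i.+1) ^+ k - zeta s ^+ k) < e / 2 by apply: rP; exact: N1P.
have h4 : normc (\sum_(N.+1 <= m < (N ^ k).+1) (cprod k N m)%:R * a m) < e / 2.
  apply: (le_lt_trans (normc_sum _ _ _)).
  apply: (@le_lt_trans _ _ (C * (dl^-1 * N%:R `^ (- dl)))); last first.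
    have := N2P N%:R; rewrite ler_nat => /(_ h2).
    by rewrite ltr_pdivlMr ?mulr_gt0 ?invr_gt0//; lra.
  apply: (@le_trans _ _ (C * \sum_(N.+1 <= m < (N ^ k).+1) m%:R `^ (-1 - dl))); last first.
    by rewrite ler_wpM2l ?(ltW C0)// sum_powR_tail.
  rewrite mulr_sumr; apply: ler_sum_nat => m /andP[Nm _].
  have m0 : (0 < m)%N by exact: leq_ltn_trans Nm.
  rewrite normcM normc_nat /a normc_cexp_neg_ln ?ltr0n//.
  apply: (@le_trans _ _ (C * m%:R `^ dl * m%:R `^ (- complex.Re s))).
    rewrite ler_wpM2r ?powR_ge0//; apply: le_trans (CP m m0).
    by rewrite ler_nat cprod_le.
  rewrite -mulrA ler_wpM2l ?(ltW C0)// -powRD; last first.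
    by apply/implyP => _; rewrite pnatr_eq0 -lt0n.
  by rewrite (_ : dl + - complex.Re s = -1 - dl)// /dl; field.
by rewrite [e]splitr ltrD.
Qed.

End DirichletPower.

(** * Growth of Delta *)

Section DeltaBounds.
Variable R : realType.
Notation mu := (@lebesgue_measure R).

Lemma ln_le_powR (e x : R) : 0 < e -> 1 <= x -> ln x <= e^-1 * x `^ e.
Proof.
move=> e0 x1; have x0 : 0 < x by lra.
rewrite ler_pdivlMl// /powR gt_eqF//.
by have := expR_ge1Dx (e * ln x); lra.
Qed.

Lemma powR_ge1 (e x : R) : 0 <= e -> 1 <= x -> 1 <= x `^ e.
Proof. by move=> e0 x1; rewrite -(powRr0 x) ler_powR. Qed.

Lemma powRD_pos (x a b : R) : 0 < x -> x `^ (a + b) = x `^ a * x `^ b.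
Proof. by move=> x0; rewrite powRD//; apply/implyP => _; rewrite gt_eqF. Qed.

Lemma poly_ln_bound (Q : {poly R}) (e : R) : 0 < e ->
  exists2 C, 0 < C & forall x, 1 <= x -> `|Q.[ln x]| <= C * x `^ e.
Proof.
elim/poly_ind: Q e => [|Q c IH] e e0.
  by exists 1 => // x x1; rewrite horner0 normr0 mul1r powR_ge0.
have e2 : 0 < e / 2 by rewrite divr_gt0.
have [C C0 H] := IH _ e2; exists (C * (e / 2)^-1 + `|c|).
  by rewrite ltr_wpDr// mulr_gt0// invr_gt0.
move=> x x1; rewrite !hornerE; have x0 : 0 < x by lra.
apply: (le_trans (ler_normD _ _)); rewrite mulrDl; apply: lerD.
  rewrite normrM (ger0_norm (ln_ge0 x1)) [e in x `^ e](splitr e) powRD_pos//.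
  have -> : C * (e / 2)^-1 * (x `^ (e / 2) * x `^ (e / 2)) =
     C * x `^ (e / 2) * ((e / 2)^-1 * x `^ (e / 2)) by ring.
  apply: ler_pM; rewrite ?normr_ge0 ?ln_ge0//; first exact: H.
  exact: ln_le_powR.
by rewrite ler_peMr// powR_ge1// ltW.
Qed.

Definition sumd (k : nat) (x : R) : R :=
  \sum_(1 <= n < (Num.truncn x).+1) (divisor_fun k n)%:R.

Lemma sumd_ge0 k x : 0 <= sumd k x.
Proof. by apply: sumr_ge0. Qed.

Lemma le_sumd k : {homo sumd k : x y / x <= y}.
Proof.
move=> x y xy; rewrite /sumd.
rewrite [leRHS](@big_cat_nat _ _ _ (Num.truncn x).+1)//=; last by rewrite ltnS le_truncn.
by rewrite lerDl sumr_ge0.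
Qed.

Lemma truncn_le_ge0 (x : R) : 0 <= x -> (Num.truncn x)%:R <= x.
Proof. by move=> x0; rewrite truncn_le. Qed.

Lemma sumd_bound (k : nat) (e : R) : 0 < e ->
  exists2 C, 0 < C & forall x, 1 <= x -> sumd k x <= C * x `^ (1 + e).
Proof.
move=> e0; have [C C0 H] := divisor_fun_bound k e0; exists C => // x x1.
have x0 : 0 < x by lra.
apply: (@le_trans _ _ (\sum_(1 <= n < (Num.truncn x).+1) C * x `^ e)).
  apply: ler_sum_nat => n /andP[n0 nx]; apply: (le_trans (H n n0)).
  rewrite ler_wpM2l ?(ltW C0)//; apply: ge0_ler_powR; rewrite ?nnegrE ?(ltW e0) ?(ltW x0)//.
  by apply: le_trans (truncn_le_ge0 (ltW x0)); rewrite ler_nat.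
rewrite sumr_const_nat subn1 /= -mulr_natl powRD_pos// powRr1 ?(ltW x0)//.
have -> : C * (x * x `^ e) = x * (C * x `^ e) by ring.
by rewrite ler_wpM2r ?truncn_le_ge0 ?(ltW x0)// mulr_ge0 ?powR_ge0// ltW.
Qed.

Lemma measurable_Delta (k : nat) (P : {poly R}) : measurable_fun setT (Delta k P).
Proof.
apply: measurable_funB.
  by apply: nondecreasing_measurable => //; exact: le_sumd.
apply: measurable_funM; first exact: measurable_id.
apply: (@measurableT_comp _ _ _ _ _ _ (horner P)); last exact: measurable_ln.
apply: continuous_measurable_fun => x.
by apply/differentiable_continuous/derivable1_diffP/derivable_horner.
Qed.

Lemma Delta_bound (k : nat) (P : {poly R}) (e : R) : 0 < e ->
  exists2 C, 0 < C & forall x, 1 <= x -> `|Delta k P x| <= C * x `^ (1 + e).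
Proof.
move=> e0; have [C C0 H] := sumd_bound k e0; have [D D0 K] := poly_ln_bound P e0.
exists (C + D); first exact: addr_gt0.
move=> x x1; have x0 : 0 < x by lra.
rewrite /Delta -/(sumd k x); apply: (le_trans (ler_normB _ _)); rewrite mulrDl.
apply: lerD; first by rewrite ger0_norm ?sumd_ge0// H.
rewrite normrM (gtr0_norm x0) powRD_pos// powRr1 ?(ltW x0)//.
by rewrite mulrCA ler_pM2l// K.
Qed.

Lemma ereal_le_cvg (u : (\bar R)^nat) (l M : \bar R) :
  u n @[n --> \oo] --> l -> (forall n, (u n <= M)%E) -> (l <= M)%E.
Proof.
move=> ul uM; rewrite -(cvg_lim _ ul)//; apply: lime_le; first by apply/cvg_ex; exists l.
by apply: nearW.
Qed.

Lemma bigcup_dyadic (X : R) : 0 < X ->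
  \bigcup_n [set` `[X, X * 2 ^+ n[] = [set` `[X, +oo[].
Proof.
move=> X0; apply/seteqP; split=> x /=.
  by move=> [n _]; rewrite /= !in_itv/= => /andP[-> _].
rewrite in_itv/= andbT => Xx; have [n] := halving_lt x X0.
rewrite ltr_pdivrMr ?exprn_gt0// => h; exists n => //=.
by rewrite in_itv/= Xx.
Qed.

Lemma dyadic_bound (b a : R) : 0 <= b -> b < a ->
  exists2 K, 0 < K & forall (phi : R -> R) (C X : R),
    (forall x, 0 <= phi x) -> measurable_fun setT phi -> 0 < X -> 0 <= C ->
    (forall Z, X <= Z -> (\int[mu]_(x in `[X, Z]) (phi x)%:E <= (C * Z `^ b)%:E)%E) ->
    (\int[mu]_(x in `[X, +oo[) (phi x * x `^ (- a))%:E <= (K * C * X `^ (b - a))%:E)%E.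
Proof.
move=> b0 ba; set q : R := 2 `^ (b - a).
have q0 : 0 < q by rewrite powR_gt0.
have q1 : q < 1.
  have -> : 1 = 2 `^ 0 :> R by rewrite powRr0.
  by rewrite /q /powR pnatr_eq0/= ltr_expR ltr_pM2r ?subr_lt0// ln_gt0// ltr1n.
exists (2 `^ b / (1 - q)); first by rewrite divr_gt0 ?powR_gt0// subr_gt0.
move=> phi C X phi0 mphi X0 C0 H.
set f := fun x => phi x * x `^ (- a).
have f0 x : 0 <= f x by rewrite mulr_ge0// powR_ge0.
have mf : measurable_fun setT f.
  by apply: measurable_funM => //; exact: measurable_powR.
have mfE D : measurable_fun D (EFin \o f).
  by apply/measurable_EFinP; exact: measurable_funS mf.
have p2 n : 0 < (2 : R) ^+ n by rewrite exprn_gt0.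
have p2' n : 1 <= (2 : R) ^+ n by rewrite exprn_ege1// ler1n.
have step n : (\int[mu]_(x in `[X, (X * 2 ^+ n)%R[) (f x)%:E <=
   (C * 2 `^ b * X `^ (b - a) * ((1 - q ^+ n) / (1 - q)))%:E)%E.
  elim: n => [|n IH].
    by rewrite expr0 mulr1 set_itvco0 integral_set0 expr0 subrr mul0r mulr0.
  set Y := X * 2 ^+ n; have Y0 : 0 < Y by rewrite mulr_gt0.
  have XY : X <= Y by rewrite ler_peMr// ltW.
  have YE : X * 2 ^+ n.+1 = 2 * Y by rewrite /Y exprS; ring.
  rewrite YE; have YY : Y <= 2 * Y by lra.
  rewrite (@itv_bndbnd_setU _ _ (BLeft X) (BLeft Y) (BLeft (2 * Y))) ?bnd_simp//.
  rewrite ge0_integral_setU//=; last 3 first.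
    exact: mfE.
    by move=> x _; rewrite lee_fin.
    apply/disj_set2P; rewrite -subset0 => x [] /=; rewrite !in_itv/=.
    by move=> /andP[_ xY] /andP[]; rewrite leNgt xY.
  have -> : C * 2 `^ b * X `^ (b - a) * ((1 - q ^+ n.+1) / (1 - q)) =
     C * 2 `^ b * X `^ (b - a) * ((1 - q ^+ n) / (1 - q)) +
     C * 2 `^ b * X `^ (b - a) * q ^+ n.
    by rewrite exprS; field; rewrite subr_eq0 gt_eqF.
  rewrite EFinD; apply: leeD => //.
  apply: (@le_trans _ _ (\int[mu]_(x in `[X, (2 * Y)%R]) ((Y `^ (- a))%:E * (phi x)%:E))%E).
    apply: (@le_trans _ _ (\int[mu]_(x in `[Y, (2 * Y)%R[) ((Y `^ (- a))%:E * (phi x)%:E))%E).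
      apply: ge0_le_integral => //=.
      - by move=> x _; rewrite lee_fin.
      - exact: mfE.
      - apply/measurable_EFinP; apply: measurable_funM => //.
        exact: measurable_funS mphi.
      move=> x; rewrite /= in_itv/= => /andP[Yx _]; rewrite -EFinM lee_fin /f mulrC.
      rewrite ler_wpM2r// !powRN lef_pV2 ?posrE ?powR_gt0//; last by lra.
      by apply: ge0_ler_powR; rewrite ?nnegrE; lra.
    apply: ge0_subset_integral => //=.
    - apply/measurable_EFinP; apply: measurable_funM => //.
      exact: measurable_funS mphi.
    - by move=> x _; rewrite -EFinM lee_fin mulr_ge0 ?powR_ge0.
    - by apply: subset_itv; rewrite ?bnd_simp.
  rewrite ge0_integralZl//=; last 3 first.
    by apply/measurable_EFinP; exact: measurable_funS mphi.
    by move=> x _; rewrite lee_fin.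
    by rewrite lee_fin powR_ge0.
  apply: (@le_trans _ _ ((Y `^ (- a))%:E * (C * (2 * Y) `^ b)%:E)%E).
    by apply: lee_wpmul2l; [rewrite lee_fin powR_ge0|apply: H; lra].
  rewrite -EFinM lee_fin powRM ?(ltW Y0)//.
  have -> : Y `^ (- a) * (C * (2 `^ b * Y `^ b)) = C * 2 `^ b * Y `^ (b - a).
    by rewrite powRD_pos//; ring.
  rewrite -[leRHS]mulrA ler_wpM2l ?mulr_ge0 ?powR_ge0// /Y powRM ?(ltW X0)//.
  rewrite (_ : (2 ^+ n) `^ (b - a) = q ^+ n)//.
  by rewrite -powR_mulrn// -powRrM mulrC powRrM powR_mulrn ?powR_ge0.
have h0 : 0 <= C * 2 `^ b * X `^ (b - a) by rewrite !mulr_ge0 ?powR_ge0.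
have step' n : (\int[mu]_(x in `[X, (X * 2 ^+ n)%R[) (f x)%:E <= (2 `^ b / (1 - q) * C * X `^ (b - a))%:E)%E.
  apply: (le_trans (step n)); rewrite lee_fin.
  have -> : 2 `^ b / (1 - q) * C * X `^ (b - a) = C * 2 `^ b * X `^ (b - a) * (1 - q)^-1 by ring.
  rewrite ler_wpM2l// ler_piMl ?invr_ge0 ?subr_ge0 ?(ltW q1)//.
  by rewrite lerBlDr lerDl exprn_ge0// ltW.
apply: (@ereal_le_cvg _ _ _ _ step').
rewrite -(bigcup_dyadic X0); apply: ge0_nondecreasing_set_cvg_integral => //.
- move=> m n mn; apply/subsetPset; apply: subset_itv; rewrite ?bnd_simp//.
  by rewrite ler_pM2l// ler_weXn2l// ler1n.
- by move=> n; exact: mfE.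
- by move=> n x _; rewrite lee_fin.
Qed.

End DeltaBounds.

Section ComplexIntegral.
Variable R : realType.
Notation mu := (@lebesgue_measure R).
Implicit Types (g h : R -> R[i]) (D : set R).

Lemma ReD (z w : R[i]) : complex.Re (z + w) = complex.Re z + complex.Re w.
Proof. by case: z => ? ?; case: w. Qed.
Lemma ImD (z w : R[i]) : complex.Im (z + w) = complex.Im z + complex.Im w.
Proof. by case: z => ? ?; case: w. Qed.
Lemma ReM (z w : R[i]) : complex.Re (z * w) = complex.Re z * complex.Re w - complex.Im z * complex.Im w.
Proof. by case: z => ? ?; case: w. Qed.
Lemma ImM (z w : R[i]) : complex.Im (z * w) = complex.Re z * complex.Im w + complex.Im z * complex.Re w.
Proof. by case: z => ? ?; case: w => ? ? /=; rewrite addrC. Qed.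

Variant rmeas g : Prop := RMeas of
  measurable_fun setT (fun x => complex.Re (g x)) &
  measurable_fun setT (fun x => complex.Im (g x)).

Lemma rmeasM g h : rmeas g -> rmeas h -> rmeas (fun x => g x * h x).
Proof.
move=> [g1 g2] [h1 h2]; split.
  under eq_fun do rewrite ReM.
  by apply: measurable_funB; apply: measurable_funM.
under eq_fun do rewrite ImM.
by apply: measurable_funD; apply: measurable_funM.
Qed.

Lemma rmeasD g h : rmeas g -> rmeas h -> rmeas (fun x => g x + h x).
Proof.
move=> [g1 g2] [h1 h2]; split.
  by under eq_fun do rewrite ReD; exact: measurable_funD.
by under eq_fun do rewrite ImD; exact: measurable_funD.
Qed.

Lemma rmeas_cst (c : R[i]) : rmeas (fun=> c).
Proof. by split; exact: measurable_cst. Qed.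

Lemma rmeas_real (f : R -> R) : measurable_fun setT f -> rmeas (fun x => (f x)%:C).
Proof. by move=> mf; split => //=; exact: measurable_cst. Qed.

Lemma measurable_cos : measurable_fun setT (@cos R).
Proof. by apply: continuous_measurable_fun; exact: continuous_cos. Qed.
Lemma measurable_sin : measurable_fun setT (@sin R).
Proof. by apply: continuous_measurable_fun; exact: continuous_sin. Qed.

Lemma rmeas_cexp g : rmeas g -> rmeas (fun x => cexp (g x)).
Proof.
move=> [g1 g2]; apply: rmeasM.
  by apply: rmeas_real; apply: measurableT_comp => //; exact: measurable_expR.
by split => /=; (apply: (measurableT_comp _ g2); [exact: measurable_cos || exact: measurable_sin]).
Qed.

Lemma rmeas_cexp_ln (u : R[i]) : rmeas (fun x : R => cexp (u * (ln x)%:C)).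
Proof.
apply: rmeas_cexp; apply: rmeasM; first exact: rmeas_cst.
by apply: rmeas_real; exact: measurable_ln.
Qed.

Variant cintegrable D g : Prop := CIntegrable of
  mu.-integrable D (EFin \o (fun x => complex.Re (g x))) &
  mu.-integrable D (EFin \o (fun x => complex.Im (g x))).

Lemma integrable_le D (f h : R -> R) : measurable D -> measurable_fun setT f ->
  (forall x, D x -> `|f x| <= h x) -> mu.-integrable D (EFin \o h) ->
  mu.-integrable D (EFin \o f).
Proof.
move=> mD mf fh ih; apply: (@le_integrable _ _ _ mu D mD _ _ _ _ ih).
  by apply/measurable_EFinP; exact: measurable_funS mf.
move=> x Dx /=; rewrite lee_fin.
by apply: (le_trans (fh x Dx)); exact: ler_norm.
Qed.

Lemma cintegrable_le D g (h : R -> R) : measurable D -> rmeas g ->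
  (forall x, D x -> normc (g x) <= h x) -> mu.-integrable D (EFin \o h) ->
  cintegrable D g.
Proof.
move=> mD [g1 g2] gh ih; split; apply: (integrable_le mD _ _ ih) => // x /gh.
  by apply: le_trans; exact: normc_Re.
by apply: le_trans; exact: normc_Im.
Qed.

Definition cint D g : R[i] :=
  (\int[mu]_(x in D) complex.Re (g x)) +i* (\int[mu]_(x in D) complex.Im (g x)).

Lemma eq_cint D g h : {in D, g =1 h} -> cint D g = cint D h.
Proof.
by move=> gh; rewrite /cint; congr (_ +i* _); apply: eq_Rintegral => x /gh ->.
Qed.

Lemma cintegrableD D g h : measurable D -> cintegrable D g -> cintegrable D h ->
  cintegrable D (fun x => g x + h x).
Proof.
move=> mD [g1 g2] [h1 h2]; split.
  rewrite (_ : _ \o _ = (EFin \o (fun x => complex.Re (g x))) \+ (EFin \o (fun x => complex.Re (h x)))); last first.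
    by apply/funext => x /=; rewrite ReD EFinD.
  exact: integrableD.
rewrite (_ : _ \o _ = (EFin \o (fun x => complex.Im (g x))) \+ (EFin \o (fun x => complex.Im (h x)))); last first.
  by apply/funext => x /=; rewrite ImD EFinD.
exact: integrableD.
Qed.

Lemma cintD D g h : measurable D -> cintegrable D g -> cintegrable D h ->
  cint D (fun x => g x + h x) = cint D g + cint D h.
Proof.
move=> mD [g1 g2] [h1 h2]; rewrite /cint.
rewrite (@eq_Rintegral _ _ _ mu _ (fun x => complex.Re (g x) + complex.Re (h x))); last first.
  by move=> x _; rewrite ReD.
rewrite [X in _ +i* X](@eq_Rintegral _ _ _ mu _ (fun x => complex.Im (g x) + complex.Im (h x))); last first.
  by move=> x _; rewrite ImD.
by rewrite !RintegralD.
Qed.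

Lemma cintegrableZ D (u : R[i]) g : measurable D -> cintegrable D g ->
  cintegrable D (fun x => u * g x).
Proof.
move=> mD [g1 g2].
have Z (k : R) (f : R -> R) : mu.-integrable D (EFin \o f) ->
    mu.-integrable D (EFin \o (fun x => k * f x)).
  by move=> ih; exact: (@integrableZl _ _ _ mu D mD k _ ih).
split.
  rewrite (_ : _ \o _ = ((EFin \o (fun x => (complex.Re u * complex.Re (g x))%R)) \- (EFin \o (fun x => (complex.Im u * complex.Im (g x))%R)))%E); last first.
    by apply/funext => x /=; rewrite ReM EFinB.
  by apply: integrableB => //; exact: Z.
rewrite (_ : _ \o _ = (EFin \o (fun x => complex.Re u * complex.Im (g x))) \+ (EFin \o (fun x => complex.Im u * complex.Re (g x)))); last first.
  by apply/funext => x /=; rewrite ImM EFinD.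
by apply: integrableD => //; exact: Z.
Qed.

Lemma cintZ D (u : R[i]) g : measurable D -> cintegrable D g ->
  cint D (fun x => u * g x) = u * cint D g.
Proof.
move=> mD [g1 g2]; rewrite /cint.
have Z (k : R) (f : R -> R) : mu.-integrable D (EFin \o f) ->
    mu.-integrable D (EFin \o (fun x => k * f x)).
  by move=> ih; exact: (@integrableZl _ _ _ mu D mD k _ ih).
rewrite (@eq_Rintegral _ _ _ mu _ (fun x => complex.Re u * complex.Re (g x) - complex.Im u * complex.Im (g x))); last first.
  by move=> x _; rewrite ReM.
rewrite [X in _ +i* X](@eq_Rintegral _ _ _ mu _ (fun x => complex.Re u * complex.Im (g x) + complex.Im u * complex.Re (g x))); last first.
  by move=> x _; rewrite ImM.
rewrite RintegralB ?RintegralD ?RintegralZl//; try exact: Z.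
by case: (u) => a b /=; congr (_ +i* _); rewrite addrC.
Qed.

Lemma normc_cint D g (h : R -> R) : measurable D -> rmeas g ->
  (forall x, D x -> normc (g x) <= h x) -> mu.-integrable D (EFin \o h) ->
  normc (cint D g) <= 2 * \int[mu]_(x in D) h x.
Proof.
move=> mD mg gh ih; have [g1 g2] := cintegrable_le mD mg gh ih.
apply: (le_trans (normc_leD _)); rewrite /cint /= mulr_natl mulr2n.
apply: lerD.
  apply: (le_trans (@le_normr_Rintegral _ _ _ mu D _ mD g1)).
  apply: le_Rintegral => //; first exact: (@integrable_norm _ _ _ mu).
  by move=> x /gh; apply: le_trans; exact: normc_Re.
apply: (le_trans (@le_normr_Rintegral _ _ _ mu D _ mD g2)).
apply: le_Rintegral => //; first exact: (@integrable_norm _ _ _ mu).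
by move=> x /gh; apply: le_trans; exact: normc_Im.
Qed.

Variant rder g (d : R[i]) (x : R) : Prop := RDer of
  is_derive x (1 : R) (fun y => complex.Re (g y)) (complex.Re d) &
  is_derive x (1 : R) (fun y => complex.Im (g y)) (complex.Im d).

Lemma rder_eq g d d' x : rder g d x -> d = d' -> rder g d' x.
Proof. by move=> H <-. Qed.

Lemma rderD g h d e x : rder g d x -> rder h e x -> rder (fun y => g y + h y) (d + e) x.
Proof.
move=> [g1 g2] [h1 h2]; split.
  by under eq_fun do rewrite ReD; rewrite ReD; exact: is_deriveD.
by under eq_fun do rewrite ImD; rewrite ImD; exact: is_deriveD.
Qed.

Lemma rderM g h d e x : rder g d x -> rder h e x ->
  rder (fun y => g y * h y) (d * h x + g x * e) x.
Proof.
move=> [g1 g2] [h1 h2]; split.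
  under eq_fun do rewrite ReM.
  apply: is_derive_eq (is_deriveB (is_deriveM g1 h1) (is_deriveM g2 h2)) _.
  by rewrite ReD !ReM /GRing.scale /=; ring.
under eq_fun do rewrite ImM.
apply: is_derive_eq (is_deriveD (is_deriveM g1 h2) (is_deriveM g2 h1)) _.
by rewrite ImD !ImM /GRing.scale /=; ring.
Qed.

Lemma rder_cst c x : rder (fun=> c) 0 x.
Proof. by split; exact: is_derive_cst. Qed.

Lemma rderZ (u : R[i]) g d x : rder g d x -> rder (fun y => u * g y) (u * d) x.
Proof.
move=> gd; apply: rder_eq; first by apply: rderM; [exact: rder_cst|exact: gd].
by rewrite mul0r add0r.
Qed.

Lemma rder_sum (I : Type) (r : seq I) (G : I -> R -> R[i]) (d : I -> R[i]) x :
  (forall i, rder (G i) (d i) x) ->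
  rder (fun y => \sum_(i <- r) G i y) (\sum_(i <- r) d i) x.
Proof.
move=> H; elim: r => [|i r IH].
  by rewrite big_nil; under [X in rder X]funext do rewrite big_nil; exact: rder_cst.
rewrite big_cons; under [X in rder X]funext do rewrite big_cons.
exact: rderD.
Qed.

Lemma rder_real (f : R -> R) d x : is_derive x (1 : R) f d -> rder (fun y => (f y)%:C) d%:C x.
Proof. by move=> fd; split => //=; exact: is_derive_cst. Qed.

Lemma is_derive_ln_comp (f : R -> R) d x : 0 < x -> is_derive (ln x) (1 : R) f d ->
  is_derive x (1 : R) (fun y => f (ln y)) (d * x^-1).
Proof.
move=> x0 fd; have dl := is_derive1_ln x0.
exact: (@is_derive1_comp _ f (@ln R) x _ _ fd dl).
Qed.

Lemma rder_cexp_ln (u : R[i]) x : 0 < x ->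
  rder (fun y : R => cexp (u * (ln y)%:C)) (u * (x^-1)%:C * cexp (u * (ln x)%:C)) x.
Proof.
move=> x0; case: u => a b.
have lin c (v : R) : is_derive v (1 : R) (fun y : R => c * y) c.
  by apply: is_derive_eq (is_deriveZ c (is_derive_id v (1 : R))) _; rewrite /GRing.scale /= mulr1.
have da : is_derive (ln x) (1 : R) (fun v => expR (a * v)) (expR (a * ln x) * a).
  exact: (@is_derive1_comp _ (@expR R) (fun v => a * v)).
have dc : is_derive (ln x) (1 : R) (fun v => cos (b * v)) (- sin (b * ln x) * b).
  exact: (@is_derive1_comp _ (@cos R) (fun v => b * v)).
have ds : is_derive (ln x) (1 : R) (fun v => sin (b * v)) (cos (b * ln x) * b).
  exact: (@is_derive1_comp _ (@sin R) (fun v => b * v)).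
have E : (fun y : R => cexp ((a +i* b) * (ln y)%:C)) =
    fun y => (expR (a * ln y))%:C * (cos (b * ln y) +i* sin (b * ln y)).
  by apply/funext => y; rewrite /cexp /= !mulr0 subr0 add0r.
have r1 := rder_real (is_derive_ln_comp x0 da).
have r2 : rder (fun y : R => cos (b * ln y) +i* sin (b * ln y))
    ((- sin (b * ln x) * b * x^-1) +i* (cos (b * ln x) * b * x^-1)) x.
  by split; [exact: (is_derive_ln_comp x0 dc)|exact: (is_derive_ln_comp x0 ds)].
rewrite E; apply: rder_eq (rderM r1 r2) _.
rewrite /cexp /= !mulr0 subr0 add0r; apply/eqP; rewrite eq_complex /=.
by apply/andP; split; apply/eqP; ring.
Qed.

Lemma FTC_derive (f F : R -> R) (a b : R) : a <= b ->
  (forall x, a <= x <= b -> is_derive x (1 : R) F (f x)) ->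
  (forall x, a <= x <= b -> {for x, continuous f}) ->
  \int[mu]_(x in `[a, b]) f x = F b - F a.
Proof.
rewrite le_eqVlt => /predU1P[-> _ _|ab dF cf].
  by rewrite set_itv1 Rintegral_set1 subrr.
have cF x : a <= x <= b -> F @ x --> F x.
  by move=> /dF [d _]; exact/differentiable_continuous/derivable1_diffP.
rewrite /Rintegral (@continuous_FTC2 _ f F)//=.
- by apply: continuous_in_subspaceT => x; rewrite inE/= in_itv/= => /cf.
- split.
  + by move=> x; rewrite in_itv/= => /andP[ax xb]; have [] := dF x _; rewrite // !ltW.
  + by apply: cvg_at_right_filter; apply: cF; rewrite lexx ltW.
  + by apply: cvg_at_left_filter; apply: cF; rewrite lexx ltW.
- move=> x; rewrite in_itv/= => /andP[ax xb]; have [] := dF x _; first by rewrite !ltW.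
  by move=> _ <-; rewrite derive1E.
Qed.

Lemma sint_FTC (a b : R) g (G : R -> R[i]) : a <= b ->
  (forall x, a <= x <= b -> rder G (g x) x) -> scont a b g ->
  sint a b g = G b - G a.
Proof.
move=> ab dG cg; rewrite /sint.
have -> : \int[mu]_(x in `[a, b]) complex.Re (g x) = complex.Re (G b) - complex.Re (G a).
  by apply: (@FTC_derive _ (fun x => complex.Re (G x))) => // x; [case/dG|move=> /cg /rcont_Re].
have -> : \int[mu]_(x in `[a, b]) complex.Im (g x) = complex.Im (G b) - complex.Im (G a).
  by apply: (@FTC_derive _ (fun x => complex.Im (G x))) => // x; [case/dG|move=> /cg /rcont_Im].
by case: (G b) => ? ?; case: (G a).
Qed.

Lemma rder_rcont g d x : rder g d x -> rcont g x.
Proof.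
have C (f : R -> R) e : is_derive x (1 : R) f e -> forall ep, 0 < ep ->
    exists2 r, 0 < r & forall y, `|y - x| < r -> `|f y - f x| < ep.
  move=> [df _] ep ep0.
  have cf : {for x, continuous f} by exact/differentiable_continuous/derivable1_diffP.
  have /cvgrPdist_lt/(_ _ ep0) := cf.
  by move=> [r /= r0 rP]; exists r => // y; rewrite distrC => /rP; rewrite distrC.
move=> [/C g1 /C g2] e e0; have e2 : 0 < e / 2 by rewrite divr_gt0.
have [r r0 rP] := g1 _ e2; have [t t0 tP] := g2 _ e2.
exists (Num.min r t) => [|y]; first by rewrite lt_min r0.
rewrite lt_min => /andP[/rP h1 /tP h2]; apply: (le_lt_trans (normc_leD _)).
by rewrite ReB ImB; lra.
Qed.

End ComplexIntegral.

Section Mellin.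
Variable R : realType.
Notation mu := (@lebesgue_measure R).

Lemma ge0_integrable (D : set R) (f : R -> R) (M : R) : measurable D ->
  measurable_fun setT f -> (forall x, D x -> 0 <= f x) ->
  (\int[mu]_(x in D) (f x)%:E <= M%:E)%E ->
  mu.-integrable D (EFin \o f) /\ \int[mu]_(x in D) f x <= M.
Proof.
move=> mD mf f0 fM; have h0 : (0 <= \int[mu]_(x in D) (f x)%:E)%E.
  by apply: integral_ge0 => x Dx; rewrite lee_fin f0.
have fi : (\int[mu]_(x in D) (f x)%:E < +oo)%E by apply: le_lt_trans fM _; rewrite ltry.
split; last first.
  by rewrite -lee_fin /Rintegral fineK// ge0_fin_numE.
apply/integrableP; split; first by apply/measurable_EFinP; exact: measurable_funS mf.
rewrite (@eq_integral _ _ _ mu _ (fun x => (f x)%:E))//.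
by move=> x /set_mem Dx /=; rewrite ger0_norm// f0.
Qed.

Lemma measurable_powRx (a : R) : measurable_fun setT (fun x : R => x `^ a).
Proof. exact: measurable_powR. Qed.

Lemma cdiff_mellin (phi : R -> R) (b X : R) : 1 <= X -> measurable_fun setT phi ->
  (forall a, b < a -> mu.-integrable `[X, +oo[ (EFin \o (fun x => `|phi x| * x `^ (- a)))) ->
  forall s, b < complex.Re s ->
  cdiff (fun s => cint `[X, +oo[ (fun x => (phi x)%:C * cexp (- s * (ln x)%:C))) s.
Proof.
move=> X1 mphi H s bs; set D := [set` `[X, +oo[].
have mD : measurable D by exact: measurable_itv.
have D1 x : D x -> 1 <= x by rewrite /D /= in_itv/= andbT; apply: le_trans.
have mg w : rmeas (fun x => (phi x)%:C * cexp (- w * (ln x)%:C)).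
  by apply: rmeasM; [exact: rmeas_real|exact: rmeas_cexp_ln].
have nrm w x : D x -> normc ((phi x)%:C * cexp (- w * (ln x)%:C)) = `|phi x| * x `^ (- complex.Re w).
  by move=> /D1 x1; rewrite normcM normcC normc_cexp_neg_ln//; lra.
pose eta := (complex.Re s - b) / 6; have eta0 : 0 < eta by rewrite divr_gt0// subr_gt0.
have lnE (x : R) : D x -> ln x ^+ 2 <= eta^-1 ^+ 2 * x `^ (2 * eta).
  move=> /D1 x1; rewrite [2 * eta]mulrC powRrM powR_mulrn ?powR_ge0// -exprMn lerXn2r// ?nnegrE.
  - exact: ln_ge0.
  - by rewrite mulr_ge0 ?powR_ge0// invr_ge0 ltW.
  - exact: ln_le_powR.
pose a1 := complex.Re s - 4 * eta.
have ba1 : b < a1.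
  by rewrite /a1 /eta; lra.
have ia1 := H a1 ba1.
have iz w : b < complex.Re w -> cintegrable D (fun x => (phi x)%:C * cexp (- w * (ln x)%:C)).
  by move=> bw; apply: (cintegrable_le mD _ _ (H _ bw)) => // x Dx; rewrite nrm.
have KI (K : R) : mu.-integrable D (EFin \o (fun x => K * (`|phi x| * x `^ (- a1)))).
  exact: (@integrableZl _ _ _ mu D mD K _ ia1).
have idl : cintegrable D (fun x => (- ln x)%:C * ((phi x)%:C * cexp (- s * (ln x)%:C))).
  apply: (cintegrable_le mD _ _ (KI (eta^-1 * 1))).
    by apply: rmeasM => //; apply: rmeas_real; apply: measurableT_comp => //; exact: measurable_ln.
  move=> x Dx; have x1 := D1 x Dx; have x0 : 0 < x by lra.
  rewrite normcM nrm// normcC normrN ger0_norm ?ln_ge0//.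
  rewrite mulr1 mulrCA [leRHS]mulrCA ler_wpM2l//.
  apply: (@le_trans _ _ (eta^-1 * x `^ eta * x `^ (- complex.Re s))).
    by rewrite ler_wpM2r ?powR_ge0// ln_le_powR.
  rewrite -mulrA -powRD_pos// ler_wpM2l ?invr_ge0 ?(ltW eta0)// ler_powR//.
  by rewrite /a1; lra.
pose d := cint D (fun x => (- ln x)%:C * ((phi x)%:C * cexp (- s * (ln x)%:C))).
pose M := 2 * \int[mu]_(x in D) (5 * eta^-1 ^+ 2 * (`|phi x| * x `^ (- a1))).
apply: (@cdiff_quadratic _ _ _ d M eta) => // w weta.
set h := w - s in weta *.
have h0 := normc_ge0 h.
have bw : b < complex.Re w.
  have := normc_Re h; rewrite /h ReB ler_norml => /andP[h1 _]; rewrite -/h in h1.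
  by rewrite /eta in weta; lra.
have -> : cint D (fun x => (phi x)%:C * cexp (- w * (ln x)%:C)) -
   cint D (fun x => (phi x)%:C * cexp (- s * (ln x)%:C)) - d * h =
   cint D (fun x => ((phi x)%:C * cexp (- w * (ln x)%:C) +
     (-1) * ((phi x)%:C * cexp (- s * (ln x)%:C))) +
     (- h) * ((- ln x)%:C * ((phi x)%:C * cexp (- s * (ln x)%:C)))).
  have j1 := iz _ bw; have j2 := cintegrableZ (-1) mD (iz _ bs).
  have j3 := cintegrableZ (- h) mD idl.
  rewrite (cintD mD (cintegrableD mD j1 j2) j3) (cintD mD j1 j2).
  by rewrite (cintZ _ mD (iz _ bs)) (cintZ _ mD idl) /d; ring.
have E x : D x -> (phi x)%:C * cexp (- w * (ln x)%:C) +
     (-1) * ((phi x)%:C * cexp (- s * (ln x)%:C)) +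
     (- h) * ((- ln x)%:C * ((phi x)%:C * cexp (- s * (ln x)%:C))) =
   ((phi x)%:C * cexp (- s * (ln x)%:C)) *
     (cexp (- h * (ln x)%:C) - 1 - (- h * (ln x)%:C)).
  move=> _; have -> : - w * (ln x)%:C = - s * (ln x)%:C + - h * (ln x)%:C by rewrite /h; ring.
  by rewrite cexpD rmorphN; ring.
apply: (@le_trans _ _ (2 * \int[mu]_(x in D) (normc h ^+ 2 * (5 * eta^-1 ^+ 2 * (`|phi x| * x `^ (- a1)))))); last first.
  rewrite (@RintegralZl _ _ _ mu D)//.
  by rewrite /M [normc h ^+ 2 * _]mulrC mulrA.
apply: normc_cint => //.
- apply: rmeasD; first apply: rmeasD => //.
    by apply: rmeasM => //; exact: rmeas_cst.
  apply: rmeasM; first exact: rmeas_cst.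
  by apply: rmeasM => //; apply: rmeas_real; apply: measurableT_comp => //; exact: measurable_ln.
- move=> x Dx; have x1 := D1 x Dx; have x0 : 0 < x by lra.
  rewrite E// normcM nrm//.
  apply: (@le_trans _ _ (`|phi x| * x `^ (- complex.Re s) * (5 * normc (- h * (ln x)%:C) ^+ 2 * expR (normc (- h * (ln x)%:C))))).
    by rewrite ler_wpM2l ?mulr_ge0 ?powR_ge0// cexp_sub1D_le.
  rewrite normcM normcN normcC (ger0_norm (ln_ge0 x1)).
  have -> : `|phi x| * x `^ (- complex.Re s) * (5 * (normc h * ln x) ^+ 2 * expR (normc h * ln x)) =
    (5 * normc h ^+ 2 * `|phi x|) * (ln x ^+ 2 * x `^ (- complex.Re s) * expR (normc h * ln x)) by ring.
  have -> : normc h ^+ 2 * (5 * eta^-1 ^+ 2 * (`|phi x| * x `^ (- a1))) =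
    (5 * normc h ^+ 2 * `|phi x|) * (eta^-1 ^+ 2 * x `^ (- a1)) by ring.
  rewrite ler_wpM2l//; first by rewrite !mulr_ge0// sqr_ge0.
  have -> : x `^ (- a1) = x `^ (2 * eta) * x `^ (- complex.Re s) * x `^ (2 * eta).
    by rewrite -!powRD_pos//; congr powR; rewrite /a1; ring.
  rewrite [leRHS](_ : _ = eta^-1 ^+ 2 * x `^ (2 * eta) * x `^ (- complex.Re s) * x `^ (2 * eta)); last by ring.
  apply: ler_pM.
  - by apply: mulr_ge0; [exact: sqr_ge0|exact: powR_ge0].
  - exact: expR_ge0.
  - by rewrite ler_wpM2r ?powR_ge0// lnE.
  - by rewrite /powR gt_eqF// ler_expR ler_wpM2r ?ln_ge0//; lra.
- by have := @integrableZl _ _ _ mu D mD (normc h ^+ 2) _ (KI (5 * eta^-1 ^+ 2)); exact.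
Qed.

End Mellin.

(** * The approximate formula for powers of zeta *)

Section ApproximateFormula.
Variable R : realType.
Notation mu := (@lebesgue_measure R).
Variables (k : nat) (P : {poly R}).

(* r_s(u) = sum_j P^(j)(u) s / (s - 1)^(j + 1) solves (s - 1) r_s - r_s' = s P, so that
   - x^(1 - s) r_s(ln x) is an antiderivative of s P(ln x) x^(- s). *)
Definition rpol (s : R[i]) (u : R) : R[i] :=
  \sum_(j < size P) (P^`(j).[u])%:C * (s / (s - 1) ^+ j.+1).

Definition dirpoly (X : R) (s : R[i]) : R[i] :=
  \sum_(1 <= n < (Num.truncn X).+1) (divisor_fun k n)%:R * cexp (- s * (ln n%:R)%:C).

Definition dtail (X : R) (s : R[i]) : R[i] :=
  cint `[X, +oo[ (fun x => (Delta k P x / x)%:C * cexp (- s * (ln x)%:C)).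

(* Partial summation from X on; the value does not depend on X and equals zeta(s)^k. *)
Definition zapprox (X : R) (s : R[i]) : R[i] :=
  dirpoly X s + (cexp ((1 - s) * (ln X)%:C) * rpol s (ln X)
   - (sumd k X)%:C * cexp (- s * (ln X)%:C)) + s * dtail X s.

Definition tail_bounded (b x0 : R) : Prop := forall a, b < a ->
  exists2 K, 0 < K & forall X, x0 <= X ->
    (\int[mu]_(x in `[X, +oo[) (`|Delta k P x / x| * x `^ (- a))%:E <= (K * X `^ (b - a))%:E)%E.

Lemma measurable_DeltaV : measurable_fun setT (fun x => Delta k P x / x).
Proof.
apply: measurable_funM; first exact: measurable_Delta.
have -> : (@GRing.inv R : R -> R) = (fun x : R => if 0 <= x then x `^ (-1) else - ((- x) `^ (-1))).
  apply/funext => x; case: ifPn => [x0|]; first by rewrite powR_inv1.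
  by rewrite -ltNge => x0; rewrite powR_inv1 ?oppr_ge0 1?ltW// invrN opprK.
apply: measurable_fun_ifT => //.
- exact: measurable_fun_ler.
- apply: measurableT_comp => //.
  by apply: (@measurableT_comp _ _ _ _ _ _ (fun x : R => x `^ (-1))) => //; exact: measurable_powR.
Qed.

Lemma deriv_rpol s (x : R) : 0 < x -> s != 1 ->
  rder (fun x => cexp ((1 - s) * (ln x)%:C) * rpol s (ln x))
    (- s * ((P.[ln x])%:C * cexp (- s * (ln x)%:C))) x.
Proof.
move=> x0 s1; have s10 : s - 1 != 0 by rewrite subr_eq0.
have r1 := rder_cexp_ln (1 - s) x0.
have r2 : rder (fun x => rpol s (ln x))
    (\sum_(j < size P) (P^`(j.+1).[ln x] * x^-1)%:C * (s / (s - 1) ^+ j.+1)) x.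
  rewrite /rpol; apply: (@rder_sum _ _ _ (fun (j : 'I_(size P)) (y : R) => (P^`(j).[ln y])%:C * (s / (s - 1) ^+ j.+1))) => j.
  have d := rder_real (is_derive_ln_comp x0 (is_derive_poly P^`(j) (ln x))).
  apply: rder_eq (rderM d (rder_cst (s / (s - 1) ^+ j.+1) x)) _.
  by rewrite mulr0 addr0 derivnS.
apply: rder_eq (rderM r1 r2) _.
have -> : cexp ((1 - s) * (ln x)%:C) = x%:C * cexp (- s * (ln x)%:C).
  rewrite mulrDl mul1r cexpD; congr (_ * _).
  by rewrite /cexp /= lnK ?posrE// cos0 sin0 mulr1.
set E := cexp _; have xC : x%:C != 0 :> R[i] by rewrite -[0]/(0%:C) (inj_eq (@complexI R)) gt_eqF.
have -> : \sum_(j < size P) (P^`(j.+1).[ln x] / x)%:C * (s / (s - 1) ^+ j.+1) =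
   x%:C^-1 * \sum_(j < size P) (P^`(j.+1).[ln x])%:C * (s / (s - 1) ^+ j.+1).
  rewrite mulr_sumr; apply: eq_bigr => j _; rewrite rmorphM fmorphV; ring.
rewrite fmorphV.
have T : \sum_(j < size P) (P^`(j.+1).[ln x])%:C * (s / (s - 1) ^+ j.+1) -
   (s - 1) * rpol s (ln x) = - s * (P.[ln x])%:C.
  rewrite /rpol mulr_sumr -sumrB.
  rewrite (eq_bigr (fun j : 'I_(size P) => (P^`(j.+1).[ln x])%:C * (s / (s - 1) ^+ j.+1) - (P^`(j).[ln x])%:C * (s / (s - 1) ^+ j))); last first.
    by move=> j _; congr (_ - _); rewrite exprS; field; rewrite s10 expf_neq0.
  rewrite -(big_mkord xpredT (fun j => (P^`(j.+1).[ln x])%:C * (s / (s - 1) ^+ j.+1) - (P^`(j).[ln x])%:C * (s / (s - 1) ^+ j))).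
  rewrite (telescope_sumr (fun j => (P^`(j).[ln x])%:C * (s / (s - 1) ^+ j)))//.
  by rewrite derivn_poly0// horner0 mul0r expr0 divr1 derivn0 sub0r mulNr mulrC.
have -> : (1 - s) * x%:C^-1 * (x%:C * E) * rpol s (ln x) +
  x%:C * E * (x%:C^-1 * \sum_(j < size P) (P^`(j.+1).[ln x])%:C * (s / (s - 1) ^+ j.+1)) =
  E * (\sum_(j < size P) (P^`(j.+1).[ln x])%:C * (s / (s - 1) ^+ j.+1) -
   (s - 1) * rpol s (ln x)) by field.
by rewrite T; ring.
Qed.

Variables (b x0 : R).
Hypotheses (x01 : 1 <= x0) (tb : tail_bounded b x0).

Lemma tail_integrable a X : b < a -> x0 <= X ->
  mu.-integrable `[X, +oo[ (EFin \o (fun x => `|Delta k P x / x| * x `^ (- a))).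
Proof.
move=> ba xX; have [K K0 H] := tb ba; apply: (ge0_integrable _ _ _ (H X xX)).1 => //.
- apply: measurable_funM; last exact: measurable_powR.
  by apply: measurableT_comp => //; exact: measurable_DeltaV.
- by move=> x _; rewrite mulr_ge0// powR_ge0.
Qed.

Lemma rmeas_tail s : rmeas (fun x => (Delta k P x / x)%:C * cexp (- s * (ln x)%:C)).
Proof.
by apply: rmeasM; [apply: rmeas_real; exact: measurable_DeltaV|exact: rmeas_cexp_ln].
Qed.

Lemma normc_tail X s x : x0 <= X -> [set` `[X, +oo[] x ->
  normc ((Delta k P x / x)%:C * cexp (- s * (ln x)%:C)) <= `|Delta k P x / x| * x `^ (- complex.Re s).
Proof.
move=> xX Dx; have Xx : X <= x by move: Dx; rewrite /= in_itv/= andbT.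
have xp : 0 < x by move: x01 xX Xx; lra.
by rewrite normcM normcC normc_cexp_neg_ln.
Qed.

Lemma cintegrable_tail X s : b < complex.Re s -> x0 <= X ->
  cintegrable `[X, +oo[ (fun x => (Delta k P x / x)%:C * cexp (- s * (ln x)%:C)).
Proof.
move=> bs xX; apply: (cintegrable_le _ (rmeas_tail s) _ (tail_integrable bs xX)) => //.
by move=> x; exact: normc_tail.
Qed.

Lemma normc_dtail_le s : b < complex.Re s -> exists2 K, 0 < K &
  forall X, x0 <= X -> normc (dtail X s) <= K * X `^ (b - complex.Re s).
Proof.
move=> bs; have [K K0 H] := tb bs; exists (2 * K) => [|X xX]; first by rewrite mulr_gt0.
have mD : measurable ([set` `[X, +oo[] : set R) by exact: measurable_itv.
have h := normc_cint mD (rmeas_tail s) (fun x => @normc_tail X s x xX) (tail_integrable bs xX).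
apply: (le_trans h).
rewrite -mulrA ler_wpM2l//.
apply: (ge0_integrable _ _ _ (H X xX)).2 => //.
- apply: measurable_funM; last exact: measurable_powR.
  by apply: measurableT_comp => //; exact: measurable_DeltaV.
- by move=> x _; rewrite mulr_ge0// powR_ge0.
Qed.

Lemma cint_split_y (u v : R) (g : R -> R[i]) : u <= v -> cintegrable `[u, +oo[ g ->
  cint `[u, +oo[ g = cint `[u, v] g + cint `[v, +oo[ g.
Proof.
move=> uv [g1 g2].
have sp (f : R -> R) : mu.-integrable `[u, +oo[ (EFin \o f) ->
    \int[mu]_(x in `[u, +oo[) f x =
    \int[mu]_(x in `[u, v]) f x + \int[mu]_(x in `[v, +oo[) f x.
  move=> fi; rewrite -(@Rintegral_itv_obnd_cbnd _ v); last first.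
    by apply: integrableS fi => //; apply: subset_itv; rewrite ?bnd_simp.
  have := @Rintegral_itvB _ f (BLeft u) (BInfty _ false) v fi.
  by rewrite !bnd_simp => /(_ uv isT) <-; rewrite addrC subrK.
by rewrite /cint !sp//.
Qed.

Lemma zapprox_step (N : nat) (u : R) s : s != 1 -> b < complex.Re s -> x0 <= u ->
  N%:R <= u < N.+1%:R -> zapprox u s = zapprox N.+1%:R s.
Proof.
move=> s1 bs xu /andP[Nu uN]; set v : R := N.+1%:R.
have uv : u <= v by exact: ltW.
have u0 : 0 < u by move: x01; lra.
have tu : Num.truncn u = N by apply: truncn_def; rewrite Nu.
have tv : Num.truncn v = N.+1 by rewrite /v natrK.
pose S : R := sumd k u.
pose g x : R[i] := S%:C * cexp (- (1 + s) * (ln x)%:C) - (P.[ln x])%:C * cexp (- s * (ln x)%:C).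
pose B x : R[i] := cexp ((1 - s) * (ln x)%:C) * rpol s (ln x) - S%:C * cexp (- s * (ln x)%:C).
have gE x : u <= x < v -> (Delta k P x / x)%:C * cexp (- s * (ln x)%:C) = g x.
  move=> /andP[ux xv]; have xp : 0 < x by lra.
  have tx : Num.truncn x = N by apply: truncn_def; rewrite (le_trans Nu ux).
  have -> : Delta k P x = S - x * P.[ln x] by rewrite /S /sumd /Delta tx tu.
  rewrite /g mulrBl [x * _]mulrC mulfK ?gt_eqF// rmorphB mulrBl; congr (_ - _).
  rewrite opprD mulrDl cexpD mulN1r rmorphM mulrA; congr (_ * _ * _).
  rewrite /cexp /= oppr0 cos0 sin0 expRN lnK ?posrE//.
  by rewrite mulr1.
have dg x : 0 < x -> exists d, rder g d x.
  move=> xp; eexists; rewrite /g.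
  apply: rderD; first by apply: rderZ; exact: rder_cexp_ln.
  under [X in rder X]funext do rewrite -mulN1r.
  apply: rderZ; apply: rderM; last exact: rder_cexp_ln.
  by apply: rder_real; exact: is_derive_ln_comp (is_derive_poly P (ln x)).
have dB x : 0 < x -> rder B (s * g x) x.
  move=> xp; rewrite /B; have r1 := deriv_rpol xp s1.
  have r2 := rderZ (- S%:C) (rder_cexp_ln (- s) xp).
  have E : (fun y : R => cexp ((1 - s) * (ln y)%:C) * rpol s (ln y) - S%:C * cexp (- s * (ln y)%:C)) =
    fun y => cexp ((1 - s) * (ln y)%:C) * rpol s (ln y) + - S%:C * cexp (- s * (ln y)%:C).
    by apply/funext => y; ring.
  rewrite E; apply: rder_eq (rderD r1 r2) _.
  rewrite /g opprD mulrDl cexpD.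
  have -> : cexp (-1 * (ln x)%:C) = (x^-1)%:C.
    rewrite mulN1r /cexp /= oppr0 cos0 sin0 expRN lnK ?posrE//.
    by rewrite mulr1.
  by ring.
have cg : scont u v g.
  by move=> x /andP[ux xv]; have [|d] := dg x; [lra|exact: rder_rcont].
have IE : cint `[u, v] (fun x => (Delta k P x / x)%:C * cexp (- s * (ln x)%:C)) = sint u v g.
  have [i1 i2] := cintegrable_tail bs xu.
  have gi1 := scont_integrable_Re cg; have gi2 := scont_integrable_Im cg.
  have so : [set` `[u, v[] `<=` [set` `[u, +oo[] by apply: subset_itv; rewrite ?bnd_simp.
  have so2 : [set` `[u, v[] `<=` [set` `[u, v]] by apply: subset_itv; rewrite ?bnd_simp.
  rewrite /cint /sint; congr (_ +i* _).
    rewrite -Rintegral_itv_bndo_bndc; last exact: integrableS i1.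
    rewrite -Rintegral_itv_bndo_bndc; last exact: integrableS gi1.
    by apply: eq_Rintegral => x /set_mem xI; rewrite gE//; move: xI; rewrite /= in_itv.
  rewrite -Rintegral_itv_bndo_bndc; last exact: integrableS i2.
  rewrite -Rintegral_itv_bndo_bndc; last exact: integrableS gi2.
  by apply: eq_Rintegral => x /set_mem xI; rewrite gE//; move: xI; rewrite /= in_itv.
have F : s * sint u v g = B v - B u.
  rewrite -sintZ//; apply: sint_FTC => //; last exact: scontZ.
  by move=> x /andP[ux _]; apply: dB; lra.
have Su : sumd k v = S + (divisor_fun k N.+1)%:R.
  by rewrite /S /sumd tu tv big_nat_recr.
rewrite /zapprox {1}/dtail (cint_split_y uv (cintegrable_tail bs xu)) IE mulrDr F.
rewrite /dirpoly tv tu [in RHS]big_nat_recr//= Su -/S.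
rewrite -/(dtail v s) /B rmorphD rmorph_nat -/v.
by ring.
Qed.

Lemma zapprox_nat (X : R) s : s != 1 -> b < complex.Re s -> x0 <= X ->
  exists N0 : nat, forall N : nat, (N0 <= N)%N -> zapprox X s = zapprox N%:R s /\ x0 <= N%:R.
Proof.
move=> s1 bs xX; exists (Num.truncn X).+1 => N.
elim: N => // N IH; rewrite leq_eqVlt => /predU1P[[<-]|]; last first.
  rewrite ltnS => /IH [-> xN]; split.
    by apply: zapprox_step => //; rewrite lexx ltr_nat ltnSn.
  by apply: (le_trans xN); rewrite ler_nat.
have X0 : 0 <= X by move: x01; lra.
have tX := truncn_le_ge0 X0; have Xt := truncnS_gt X.
split; first by apply: zapprox_step => //; rewrite tX.
by apply: (le_trans xX); exact: ltW.
Qed.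

End ApproximateFormula.

Section ZetaFormula.
Variable R : realType.
Notation mu := (@lebesgue_measure R).

Lemma derivs_ln_bound (P : {poly R}) (n : nat) (e : R) : 0 < e ->
  exists2 C, 0 < C & forall x, 1 <= x -> \sum_(j < n) `|P^`(j).[ln x]| <= C * x `^ e.
Proof.
move=> e0; elim: n => [|n [C C0 H]].
  by exists 1 => // x x1; rewrite big_ord0 mul1r powR_ge0.
have [D D0 K] := poly_ln_bound P^`(n) e0; exists (C + D); first exact: addr_gt0.
by move=> x x1; rewrite big_ord_recr/= mulrDl lerD ?H ?K.
Qed.

Lemma rpol_bound (P : {poly R}) (s : R[i]) (e : R) : 0 < e ->
  exists2 C, 0 < C & forall x, 1 <= x -> normc (rpol P s (ln x)) <= C * x `^ e.
Proof.
move=> e0; have [C C0 H] := derivs_ln_bound P (size P) e0.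
pose A := \sum_(j < size P) normc (s / (s - 1) ^+ j.+1).
have A0 : 0 <= A by apply: sumr_ge0 => j _; exact: normc_ge0.
exists (C * (A + 1)) => [|x x1]; first by rewrite mulr_gt0// ltr_wpDl.
apply: (le_trans (normc_sum _ _ _)).
apply: (@le_trans _ _ (\sum_(j < size P) `|P^`(j).[ln x]| * (A + 1))); last first.
  by rewrite -mulr_suml mulrAC ler_wpM2r ?H// addr_ge0.
apply: ler_sum => j _; rewrite normcM normcC ler_wpM2l//.
rewrite /A (bigD1 j)//= -addrA lerDl addr_ge0//.
by apply: sumr_ge0 => i _; exact: normc_ge0.
Qed.

Lemma normc_cexp_lnM (u : R[i]) (x : R) : 0 < x ->
  normc (cexp (u * (ln x)%:C)) = x `^ (complex.Re u).
Proof.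
move=> x0; rewrite normc_cexp /powR gt_eqF//; congr expR.
by case: u => a b /=; rewrite mulr0 subr0.
Qed.

Lemma zapprox_zeta (zeta : R[i] -> R[i]) (k : nat) (P : {poly R}) (b x0 X : R) (s : R[i]) :
  is_riemann_zeta zeta -> (0 < k)%N -> 1 <= x0 -> tail_bounded k P b x0 -> b < 1 ->
  x0 <= X -> 1 < complex.Re s -> zapprox k P X s = zeta s ^+ k.
Proof.
move=> Hz k0 x01 tb b1 xX s1.
have bs : b < complex.Re s by apply: lt_trans s1.
have sn1 : s != 1 by apply/eqP => E; move: s1; rewrite E /= ltxx.
pose dl := (complex.Re s - 1) / 2; have d0 : 0 < dl by rewrite divr_gt0// subr_gt0.
have [N1 N1P] := zapprox_nat x01 tb sn1 bs xX.
have [C1 C10 H1] := rpol_bound P s d0.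
have [C2 C20 H2] := sumd_bound k d0.
have [C3 C30 H3] := normc_dtail_le x01 tb bs.
pose K := C1 + C2 + normc s * C3.
have K0 : 0 < K by rewrite /K ltr_wpDr ?mulr_ge0 ?normc_ge0 ?ltW// addr_gt0.
apply/eqP; rewrite -subr_eq0; apply/eqP/eq0_normc/eqP.
rewrite eq_le normc_ge0 andbT; apply/ler_addgt0Pl => e e0; rewrite addr0.
have e2 : 0 < e / 2 by rewrite divr_gt0.
have [N2 N2P] := dirichlet_pow Hz k0 s1 e2.
have [N3 N3P] : exists N0 : nat, forall x : R, N0%:R <= x -> x `^ (- dl) < e / 2 / K.
  by apply: powR_neg_small => //; rewrite divr_gt0.
pose N := maxn N1 (maxn N2 N3).
have [-> xN] := N1P N (leq_maxl _ _).
have h2 := N2P N (leq_trans (leq_maxl _ _) (leq_maxr N1 _)).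
have h3 : N%:R `^ (- dl) < e / 2 / K.
  by apply: N3P; rewrite ler_nat (leq_trans (leq_maxr N2 N3) (leq_maxr N1 _)).
set x : R := N%:R in xN h3 *; have x1 : 1 <= x by lra.
have xp : 0 < x by lra.
have E : zapprox k P x s - zeta s ^+ k = (dirpoly k x s - zeta s ^+ k) +
   cexp ((1 - s) * (ln x)%:C) * rpol P s (ln x)
   - (sumd k x)%:C * cexp (- s * (ln x)%:C) + s * dtail k P x s.
  by rewrite /zapprox; ring.
have T1 : normc (dirpoly k x s - zeta s ^+ k) < e / 2.
  by rewrite /dirpoly /x natrK.
have T2 : normc (cexp ((1 - s) * (ln x)%:C) * rpol P s (ln x)) <= C1 * x `^ (- dl).
  rewrite normcM normc_cexp_lnM//.
  apply: (@le_trans _ _ (x `^ (complex.Re (1 - s)) * (C1 * x `^ dl))).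
    by rewrite ler_wpM2l ?powR_ge0// H1.
  rewrite mulrCA -powRD_pos// ler_wpM2l ?(ltW C10)// ler_powR//.
  by rewrite ReB /= /dl; lra.
have T3 : normc ((sumd k x)%:C * cexp (- s * (ln x)%:C)) <= C2 * x `^ (- dl).
  rewrite normcM normc_cexp_lnM// normcC ger0_norm ?sumd_ge0//.
  apply: (@le_trans _ _ (C2 * x `^ (1 + dl) * x `^ (complex.Re (- s)))).
    by rewrite ler_wpM2r ?powR_ge0// H2.
  rewrite -mulrA -powRD_pos// ler_wpM2l ?(ltW C20)// ler_powR//.
  rewrite -[- s]sub0r ReB /= /dl; lra.
have T4 : normc (s * dtail k P x s) <= normc s * C3 * x `^ (- dl).
  rewrite normcM -mulrA ler_wpM2l ?normc_ge0//; apply: (le_trans (H3 x xN)).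
  by rewrite ler_wpM2l ?(ltW C30)// ler_powR// /dl; lra.
rewrite E; apply: (le_trans (le_normcD _ _)).
have := le_normcD (dirpoly k x s - zeta s ^+ k + cexp ((1 - s) * (ln x)%:C) * rpol P s (ln x))
  (- ((sumd k x)%:C * cexp (- s * (ln x)%:C))).
have := le_normcD (dirpoly k x s - zeta s ^+ k) (cexp ((1 - s) * (ln x)%:C) * rpol P s (ln x)).
rewrite normcN; move: h3; rewrite ltr_pdivlMr// /K => h3.
by move: T1 T2 T3 T4 h3; lra.
Qed.

Lemma cdiff_cexp_neg (c : R) (s : R[i]) : cdiff (fun w => cexp (- w * c%:C)) s.
Proof.
have := cdiff_cexp (- c) s.
by under eq_fun do rewrite rmorphN mulrN -mulNr.
Qed.

Lemma cdiff_zapprox (k : nat) (P : {poly R}) (b x0 X : R) (s : R[i]) :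
  1 <= x0 -> tail_bounded k P b x0 -> x0 <= X -> b < complex.Re s -> s != 1 ->
  cdiff (zapprox k P X) s.
Proof.
move=> x01 tb xX bs s1.
have dV : cdiff (fun w => (w - 1)^-1) s.
  apply: cdiffV; first by rewrite subr_eq0.
  by apply: cdiffB; [exact: cdiff_id|exact: cdiff_cst].
apply: cdiffD; last first.
  apply: cdiffM; first exact: cdiff_id.
  apply: cdiff_mellin bs; first by lra.
    exact: measurable_DeltaV.
  by move=> a ba; exact: (tail_integrable tb ba xX).
apply: cdiffD.
  by apply: cdiff_sum => n _; apply: cdiffZl; exact: cdiff_cexp_neg.
apply: cdiffB; last by apply: cdiffZl; exact: cdiff_cexp_neg.
apply: cdiffM.
  rewrite (_ : (fun w => _) = fun w : R[i] => cexp (ln X)%:C * cexp (- w * (ln X)%:C)).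
    by apply: cdiffZl; exact: cdiff_cexp_neg.
  by apply/funext => w; rewrite -cexpD mulrDl mul1r.
apply: cdiff_sum => j _; apply: cdiffZl; apply: cdiffM; first exact: cdiff_id.
rewrite (_ : (fun w => _) = fun w : R[i] => (w - 1)^-1 ^+ j.+1); last first.
  by apply/funext => w; rewrite exprVn.
exact: cdiffX.
Qed.

Lemma zeta_formula (zeta : R[i] -> R[i]) (k : nat) (P : {poly R}) (b x0 X sg t : R) :
  is_riemann_zeta zeta -> (0 < k)%N -> 1 <= x0 -> tail_bounded k P b x0 -> 0 <= b ->
  x0 <= X -> b < sg -> sg < 1 -> 1 <= t ->
  zeta (sg +i* t) ^+ k = zapprox k P X (sg +i* t).
Proof.
move=> Hz k0 x01 tb b0 xX bs s1 t1.
have sg0 : 0 < sg by lra.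
pose dl := sg / 2; pose m := (sg + Num.max b dl) / 2.
have [m1 m2 m3] : [/\ b < m, dl < m & m < sg].
  rewrite /m; have h1 : b <= Num.max b dl by rewrite le_max lexx.
  have h2 : dl <= Num.max b dl by rewrite le_max lexx orbT.
  have h3 : Num.max b dl < sg by rewrite gt_max bs /= /dl; lra.
  by rewrite /dl in h2 *; split; lra.
have d0 : 0 < dl by rewrite /dl; lra.
pose s0 : R[i] := (1 + dl) +i* t; pose p := 1 + dl - sg; pose r := 1 + dl - m.
have -> : sg +i* t = s0 - p%:C.
  by apply/eqP; rewrite eq_complex /= /p oppr0 addr0 eqxx andbT; apply/eqP; ring.
apply/eqP; rewrite -subr_eq0; apply/eqP.
apply: (@square_continuation _ (fun s => zeta s ^+ k - zapprox k P X s) s0 r dl p) => //.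
- by rewrite /p; lra.
- by rewrite /p /r; lra.
- move=> z; rewrite /= !ler_norml /r => /andP[z1 z2] /andP[z3 z4].
  have z1n : z != 1 by apply/eqP => E; move: z3; rewrite E /=; lra.
  apply: cdiffB.
    apply: cdiffX; have [_ hol] := Hz.
    by have /nbhs_singleton := hol z z1n; exact: derivable_cdiff.
  by apply: (cdiff_zapprox x01 tb xX) => //; lra.
- move=> z zs; have := normc_Re (z - s0); rewrite ReB /= ler_norml => /andP[z1 z2].
  rewrite (zapprox_zeta Hz k0 x01 tb _ xX); [by rewrite subrr|lra|lra].
Qed.

End ZetaFormula.

Section FubiniBox.
Variable R : realType.
Notation mu := (@lebesgue_measure R).
Variables (D1 D2 : set R).
Hypotheses (mD1 : measurable D1) (mD2 : measurable D2).

Let Fr (F : R * R -> R) : R * R -> R := fun z => F z * \1_D1 z.1 * \1_D2 z.2.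

Let mFr F : measurable_fun setT F -> measurable_fun setT (Fr F).
Proof.
move=> mF; apply: measurable_funM; first apply: measurable_funM => //.
  by apply: (measurableT_comp _ measurable_fst); exact: measurable_indic.
by apply: (measurableT_comp _ measurable_snd); exact: measurable_indic.
Qed.

Let FrE12 F x : (\int[mu]_y (Fr F (x, y))%:E = ((fun x => \int[mu]_(y in D2) (F (x, y))%:E) \_ D1) x)%E.
Proof.
rewrite patchE; case: ifPn => [xD|xD].
  rewrite [in RHS]integral_mkcond; apply: eq_integral => y _.
  by rewrite epatch_indic /= /Fr /= indicE xD mulr1 EFinM.
rewrite -[RHS](@integral0 _ _ _ mu setT); apply: eq_integral => y _.
by rewrite /Fr /= !indicE (negbTE xD) mulr0 mul0r.
Qed.

Let FrE21 F y : (\int[mu]_x (Fr F (x, y))%:E = ((fun y => \int[mu]_(x in D1) (F (x, y))%:E) \_ D2) y)%E.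
Proof.
rewrite patchE; case: ifPn => [xD|xD].
  rewrite [in RHS]integral_mkcond; apply: eq_integral => x _.
  by rewrite epatch_indic /= /Fr /= !indicE xD mulr1 EFinM.
rewrite -[RHS](@integral0 _ _ _ mu setT); apply: eq_integral => x _.
by rewrite /Fr /= !indicE (negbTE xD) mulr0.
Qed.

Lemma tonelli_box (F : R * R -> R) : measurable_fun setT F -> (forall z, 0 <= F z) ->
  (\int[mu]_(x in D1) \int[mu]_(y in D2) (F (x, y))%:E =
   \int[mu]_(y in D2) \int[mu]_(x in D1) (F (x, y))%:E)%E.
Proof.
move=> mF F0; rewrite [LHS]integral_mkcond [RHS]integral_mkcond.
transitivity (\int[mu]_x \int[mu]_y (Fr F (x, y))%:E)%E.
  by apply: eq_integral => x _; rewrite FrE12.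
transitivity (\int[mu]_y \int[mu]_x (Fr F (x, y))%:E)%E; last first.
  by apply: eq_integral => x _; rewrite FrE21.
apply: (@fubini_tonelli _ _ _ _ _ mu mu (fun z => (Fr F z)%:E)).
  by apply/measurable_EFinP; exact: mFr.
by move=> z; rewrite lee_fin /Fr !mulr_ge0// indicE.
Qed.

Lemma fubini_box (F : R * R -> R) (M : R) (f : R -> R) : measurable_fun setT F ->
  (mu D1 < +oo)%E -> mu.-integrable D2 (EFin \o f) ->
  (forall x y, D1 x -> D2 y -> `|F (x, y)| <= M * `|f y|) ->
  (\int[mu]_(x in D1) \int[mu]_(y in D2) F (x, y))%R =
  (\int[mu]_(y in D2) \int[mu]_(x in D1) F (x, y))%R.
Proof.
move=> mF D1oo fi FM.
have [M0|M0] := leP 0 M; last first.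
  have F0 x y : D1 x -> D2 y -> F (x, y) = 0.
    move=> Dx Dy; apply/eqP; rewrite -normr_eq0 eq_le normr_ge0 andbT.
    by apply: (le_trans (FM x y Dx Dy)); rewrite mulr_le0_ge0// ltW.
  rewrite (@eq_Rintegral _ _ _ mu _ (fun=> 0)); last first.
    move=> x /set_mem Dx; rewrite (@eq_Rintegral _ _ _ mu _ (fun=> 0)) ?Rintegral_cst ?mul0r//.
    by move=> y /set_mem; exact: F0.
  rewrite [RHS](@eq_Rintegral _ _ _ mu _ (fun=> 0)) ?Rintegral_cst ?mul0r//.
  move=> y /set_mem Dy; rewrite (@eq_Rintegral _ _ _ mu _ (fun=> 0)) ?Rintegral_cst ?mul0r//.
  by move=> x /set_mem Dx; exact: F0.
have mFx x D : measurable_fun D (fun y => (F (x, y))%:E).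
  apply/measurable_EFinP; apply: (@measurable_funS _ _ _ _ setT) => //.
  by apply: (measurableT_comp mF); exact: pair1_measurable.
have mFy y D : measurable_fun D (fun x => (F (x, y))%:E).
  apply/measurable_EFinP; apply: (@measurable_funS _ _ _ _ setT) => //.
  by apply: (measurableT_comp mF); exact: pair2_measurable.
have fin1 x : D1 x -> (\int[mu]_(y in D2) (F (x, y))%:E)%E \is a fin_num.
  move=> Dx; apply: integrable_fin_num => //.
  apply: (@le_integrable _ _ _ mu D2 mD2 _ _ _ _ (@integrableZl _ _ _ mu D2 mD2 M _ (@integrable_norm _ _ _ mu D2 _ fi))) => //.
    exact: mFx.
  by move=> y Dy /=; rewrite lee_fin [leRHS]normrM (ger0_norm M0) normr_id FM.
have fin2 y : D2 y -> (\int[mu]_(x in D1) (F (x, y))%:E)%E \is a fin_num.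
  move=> Dy; apply: integrable_fin_num => //.
  apply: (@le_integrable _ _ _ mu D1 mD1 _ (fun=> (M * `|f y|)%:E)) => //.
    exact: mFy.
    by move=> x Dx /=; rewrite lee_fin (le_trans (FM x y Dx Dy))// ler_norm.
  apply/integrableP; split; first exact: measurable_cst.
  by rewrite integral_cst//= lte_mul_pinfty.
rewrite /Rintegral; congr fine.
rewrite (@eq_integral _ _ _ mu _ (fun x => \int[mu]_(y in D2) (F (x, y))%:E)%E); last first.
  by move=> x /set_mem Dx; rewrite fineK ?fin1.
rewrite [RHS](@eq_integral _ _ _ mu _ (fun y => \int[mu]_(x in D1) (F (x, y))%:E)%E); last first.
  by move=> y /set_mem Dy; rewrite fineK ?fin2.
rewrite [LHS]integral_mkcond [RHS]integral_mkcond.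
transitivity (\int[mu]_x \int[mu]_y (Fr F (x, y))%:E)%E.
  by apply: eq_integral => x _; rewrite FrE12.
transitivity (\int[mu]_y \int[mu]_x (Fr F (x, y))%:E)%E; last first.
  by apply: eq_integral => x _; rewrite FrE21.
have mFE : measurable_fun setT (fun z => (Fr F z)%:E) by apply/measurable_EFinP; exact: mFr.
apply: (@Fubini _ _ _ _ _ mu mu (fun z => (Fr F z)%:E)).
apply/integrable12ltyP => //=.
pose G (z : R * R) := M * `|F z|.
have absE x y : `|Fr F (x, y)| = Fr (fun z => `|F z|) (x, y).
  by rewrite /Fr /= !normrM !indicE !normr_nat.
apply: (@le_lt_trans _ _ (\int[mu]_(x in D1) (M * \int[mu]_(y in D2) `|f y|)%:E)%E); last first.
  by rewrite integral_cst// lte_mul_pinfty// lee_fin mulr_ge0// Rintegral_ge0.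
rewrite [leRHS]integral_mkcond; apply: ge0_le_integral => //.
- by move=> x _; apply: integral_ge0.
- have := @measurable_fun_fubini_tonelli_F _ _ _ _ _ mu (fun z => `|(Fr F z)%:E|%E).
  by apply => //; exact: measurableT_comp.
- by apply/(measurable_restrictT _ _).1 => //; exact: measurable_cst.
move=> x _; rewrite (_ : (\int[mu]_y `|Fr F (x, y)|%:E)%E =
    (\int[mu]_y (Fr (fun z => `|F z|) (x, y))%:E)%E); last first.
  by apply: eq_integral => y _; rewrite absE.
rewrite FrE12 !patchE.
case: ifPn => // /set_mem Dx.
have fin3 : (\int[mu]_(y in D2) (M * `|f y|)%:E)%E = (M * \int[mu]_(y in D2) `|f y|)%:E.
  rewrite -(@RintegralZl _ _ _ mu D2)//; last exact: (@integrable_norm _ _ _ mu D2 _ fi).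
  by rewrite fineK// integrable_fin_num//; exact: (@integrableZl _ _ _ mu D2 mD2 M _ (@integrable_norm _ _ _ mu D2 _ fi)).
rewrite -fin3; apply: ge0_le_integral => //=.
- by apply/measurable_EFinP; apply: measurableT_comp => //; apply/measurable_EFinP; exact: mFx.
- apply/measurable_EFinP; apply: measurable_funM => //; apply: measurableT_comp => //.
  by apply/measurable_EFinP; have /integrableP[] := fi.
- by move=> y Dy; rewrite lee_fin FM.
Qed.

End FubiniBox.

(** * A Bessel inequality on the half-line *)

Section Fejer.
Variable R : realType.
Notation mu := (@lebesgue_measure R).

Definition fejer (T t : R) : R := 1 - t / (2 * T).

Definition fejer_hat (T w : R) : R := \int[mu]_(t in `[0%R, (2 * T)%R]) (fejer T t * cos (t * w)).

(* Majorant of the Fourier transform of the Fejer weight on [0, 2T]; its integral over w is 3 pi, whence the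
   constant in [bessel]. *)
Definition kappa (T w : R) : R := 3 * T * (1 + (T * w) ^+ 2) `^ (-1).

Lemma is_derive_lin (c x : R) : is_derive x (1 : R) (fun y : R => c * y) c.
Proof.
by apply: is_derive_eq (is_deriveZ c (is_derive_id x (1 : R))) _; rewrite /GRing.scale /= mulr1.
Qed.

Lemma is_derive_linr (c x : R) : is_derive x (1 : R) (fun y : R => y * c) c.
Proof. by under eq_fun do rewrite mulrC; exact: is_derive_lin. Qed.

Lemma is_derive_sinM (w x : R) : is_derive x (1 : R) (fun t => sin (t * w)) (cos (x * w) * w).
Proof. exact: (@is_derive1_comp _ (@sin R) (fun v => v * w) _ _ _ _ (is_derive_linr w x)). Qed.

Lemma is_derive_cosM (w x : R) : is_derive x (1 : R) (fun t => cos (t * w)) (- sin (x * w) * w).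
Proof. exact: (@is_derive1_comp _ (@cos R) (fun v => v * w) _ _ _ _ (is_derive_linr w x)). Qed.

Lemma is_derive_continuous (f : R -> R) (x d : R) : is_derive x (1 : R) f d -> {for x, continuous f}.
Proof. by move=> [df _]; exact/differentiable_continuous/derivable1_diffP. Qed.

Lemma is_derive_fejer (T x : R) : is_derive x (1 : R) (fejer T) (- (2 * T)^-1).
Proof.
apply: is_derive_eq (is_deriveB (is_derive_cst (1 : R) x (1 : R)) (is_derive_linr (2 * T)^-1 x)) _.
by rewrite sub0r.
Qed.

Lemma continuous_fejer (T : R) : continuous (fejer T).
Proof. by move=> x; exact: is_derive_continuous (is_derive_fejer T x). Qed.

Lemma continuous_cosM (w : R) : continuous (fun t : R => cos (t * w)).
Proof. by move=> x; exact: is_derive_continuous (is_derive_cosM w x). Qed.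

Lemma continuous_sinM (w : R) : continuous (fun t : R => sin (t * w)).
Proof. by move=> x; exact: is_derive_continuous (is_derive_sinM w x). Qed.

Lemma fejer_bound (T t : R) : 0 < T -> 0 <= t <= 2 * T -> 0 <= fejer T t <= 1.
Proof.
move=> T0 /andP[t0 tT]; have T2 : 0 < 2 * T by lra.
rewrite /fejer subr_ge0 ler_pdivrMr// mul1r tT /= gerBl.
by rewrite divr_ge0// ltW.
Qed.

Lemma fejer_hat_le (T w : R) : 0 < T -> `|fejer_hat T w| <= kappa T w.
Proof.
move=> T0; have T2 : 0 < 2 * T by lra.
have cF : continuous (fun t : R => fejer T t * cos (t * w)).
  by move=> x; apply: continuousM; [exact: continuous_fejer|exact: continuous_cosM].
have h1 : `|fejer_hat T w| <= 2 * T.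
  have := @Rintegral_bound R 0 (2 * T) (fun t => fejer T t * cos (t * w)) 1 (ltW T2).
  rewrite subr0 mulr1; apply; first by apply: continuous_integrable => x _; exact: cF.
  move=> x /(fejer_bound T0) /andP[f0 f1]; rewrite normrM (ger0_norm f0).
  by rewrite mulr_ile1// cos_max.
have h2 : (T * w) ^+ 2 * `|fejer_hat T w| <= T.
  have [->|w0] := eqVneq w 0; first by rewrite mulr0 expr0n mul0r ltW.
  pose A t := fejer T t * sin (t * w) / w - cos (t * w) / (2 * T * w ^+ 2).
  have dA x : is_derive x (1 : R) A (fejer T x * cos (x * w)).
    have d1 := is_deriveM (is_derive_fejer T x) (is_derive_sinM w x).
    have d2 := is_deriveM d1 (is_derive_cst (w^-1) x (1 : R)).
    have d3 := is_deriveM (is_derive_cosM w x) (is_derive_cst (2 * T * w ^+ 2)^-1 x (1 : R)).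
    apply: is_derive_eq (is_deriveB d2 d3) _.
    by rewrite /GRing.scale /=; field; rewrite w0 gt_eqF.
  have -> : fejer_hat T w = (1 - cos (2 * T * w)) / (2 * T * w ^+ 2).
    have F := @FTC_derive R _ A 0 (2 * T) (ltW T2) (fun x _ => dA x) (fun x _ => cF x).
    rewrite /fejer_hat F.
    rewrite /A mul0r sin0 cos0 {1}/fejer divff ?gt_eqF//.
    by field; rewrite w0 gt_eqF.
  have w2 : 0 < w ^+ 2 by rewrite exprn_even_gt0.
  have [c1 c2] : cos (2 * T * w) <= 1 /\ -1 <= cos (2 * T * w) by split; [exact: cos_le1|exact: cos_geN1].
  have g0 : 0 <= (1 - cos (2 * T * w)) / (2 * T * w ^+ 2).
    by apply: divr_ge0; [rewrite subr_ge0|exact: (ltW (mulr_gt0 T2 w2))].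
  rewrite (ger0_norm g0).
  have -> : (T * w) ^+ 2 * ((1 - cos (2 * T * w)) / (2 * T * w ^+ 2)) = T * ((1 - cos (2 * T * w)) / 2).
    by field; rewrite w0 gt_eqF.
  by rewrite ler_piMr ?(ltW T0)//; lra.
have p0 : 0 < 1 + (T * w) ^+ 2 by rewrite ltr_wpDr// sqr_ge0.
rewrite /kappa powR_inv1 ?(ltW p0)// ler_pdivlMr//.
by lra.
Qed.

Lemma kappaN (T w : R) : kappa T (- w) = kappa T w.
Proof. by rewrite /kappa mulrN sqrrN. Qed.

Lemma kappa_ge0 (T w : R) : 0 <= T -> 0 <= kappa T w.
Proof. by move=> T0; rewrite /kappa !mulr_ge0// powR_ge0. Qed.

Lemma kappa_le (T w : R) : 0 <= T -> kappa T w <= 3 * T.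
Proof.
move=> T0; have p0 : 1 <= 1 + (T * w) ^+ 2 by rewrite lerDl sqr_ge0.
rewrite /kappa ler_piMr ?mulr_ge0// powR_inv1 ?invf_le1//; last by lra.
by lra.
Qed.

Lemma measurable_kappa (T : R) : measurable_fun setT (kappa T).
Proof.
apply: measurable_funM => //.
apply: (@measurableT_comp _ _ _ _ _ _ (fun x : R => x `^ (-1))); first exact: measurable_powR.
by apply: measurable_funD => //; apply: measurable_funX; apply: measurable_funM.
Qed.

Lemma kappa_integral (T X u : R) : 0 < T -> 0 < X ->
  (\int[mu]_(y in `[X, +oo[) (kappa T (u - ln y) * y `^ (-1))%:E <= (3 * pi)%:E)%E.
Proof.
move=> T0 X0.
have mk : measurable_fun setT (fun y : R => kappa T (u - ln y) * y `^ (-1)).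
  apply: measurable_funM; last exact: measurable_powR.
  apply: measurableT_comp; first exact: measurable_kappa.
  by apply: measurable_funB => //; exact: measurable_ln.
pose g y : R := 3 * T * (1 + (T * (u - ln y)) ^+ 2)^-1 * y^-1.
pose A y : R := - 3 * atan (T * (u - ln y)).
have dl (y : R) : 0 < y -> is_derive y (1 : R) (fun y => T * (u - ln y)) (- T * y^-1).
  move=> y0; have d1 := is_deriveB (is_derive_cst u y (1 : R)) (is_derive1_ln y0).
  apply: is_derive_eq (is_deriveM (is_derive_cst T y (1 : R)) d1) _.
  by rewrite /GRing.scale /=; ring.
have dA (y : R) : 0 < y -> is_derive y (1 : R) A (g y).
  move=> y0; have d2 := @is_derive1_comp _ (@atan R) (fun y => T * (u - ln y)) y _ _ (is_derive1_atan _) (dl y y0).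
  apply: is_derive_eq (is_deriveM (is_derive_cst (- 3 : R) y (1 : R)) d2) _.
  by rewrite /GRing.scale /= /g; ring.
have cg (y : R) : 0 < y -> {for y, continuous g}.
  move=> y0; apply: continuousM; last by apply: cvgV; [rewrite gt_eqF|exact: cvg_id].
  apply: continuousM; first exact: cst_continuous.
  apply: cvgV; first by rewrite gt_eqF// ltr_wpDr// sqr_ge0.
  apply: cvgD; first exact: cvg_cst.
  have := is_derive_continuous (dl y y0) => h.
  by rewrite expr2; apply: cvgM.
have step n : (\int[mu]_(y in `[X, (X * 2 ^+ n)%R[) (kappa T (u - ln y) * y `^ (-1))%:E <= (3 * pi)%:E)%E.
  have XX : X <= X * 2 ^+ n by rewrite ler_peMr ?(ltW X0)// exprn_ege1// ler1n.
  apply: (@le_trans _ _ (\int[mu]_(y in `[X, (X * 2 ^+ n)%R]) (g y)%:E)%E).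
    apply: (@le_trans _ _ (\int[mu]_(y in `[X, (X * 2 ^+ n)%R]) (kappa T (u - ln y) * y `^ (-1))%:E)%E).
      apply: ge0_subset_integral => //=.
      - by apply/measurable_EFinP; exact: measurable_funS mk.
      - by move=> y _; rewrite lee_fin mulr_ge0 ?powR_ge0// kappa_ge0// ltW.
      - by apply: subset_itv; rewrite ?bnd_simp.
    rewrite le_eqVlt; apply/orP; left; apply/eqP; apply: eq_integral => y; rewrite inE/= in_itv/= => /andP[Xy _].
    have y0 : 0 < y by lra.
    rewrite /kappa /g !powR_inv1// ?(ltW y0)//.
    by rewrite addr_ge0// sqr_ge0.
  have gi : mu.-integrable `[X, (X * 2 ^+ n)%R] (EFin \o g).
    by apply: continuous_integrable => y /andP[Xy _]; apply: cg; lra.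
  have F : \int[mu]_(y in `[X, (X * 2 ^+ n)%R]) g y = A (X * 2 ^+ n) - A X.
    by apply: (@FTC_derive _ g A _ _ XX) => y /andP[Xy _]; [apply: dA|apply: cg];
      exact: lt_le_trans X0 Xy.
  rewrite -[leLHS]fineK; last exact: integrable_fin_num gi.
  rewrite lee_fin; move: F; rewrite /Rintegral => ->.
  have := atan_ltpi2 (T * (u - ln X)); have := atan_gtNpi2 (T * (u - ln (X * 2 ^+ n))).
  by rewrite /A; lra.
apply: (@ereal_le_cvg R (fun n => (\int[mu]_(y in `[X, (X * 2 ^+ n)%R[) (kappa T (u - ln y) * y `^ (-1))%:E)%E) _ _ _ step).
rewrite -(bigcup_dyadic X0); apply: ge0_nondecreasing_set_cvg_integral => //.
- move=> m n mn; apply/subsetPset; apply: subset_itv; rewrite ?bnd_simp//.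
  by rewrite ler_pM2l// ler_weXn2l// ler1n.
- by move=> n; apply/measurable_EFinP; exact: measurable_funS mk.
- by move=> n x _; rewrite lee_fin mulr_ge0 ?powR_ge0// kappa_ge0// ltW.
Qed.

End Fejer.

Section Bessel.
Variable R : realType.
Notation mu := (@lebesgue_measure R).

Lemma lebesgue_itvcc_lty (a b : R) : (mu `[a, b] < +oo)%E.
Proof. by rewrite lebesgue_measure_itv; case: ifPn => // _; rewrite ltry. Qed.

Lemma mfun_comp (d : measure_display) (U : measurableType d) (h : R -> R) (g : U -> R) :
  measurable_fun setT h -> measurable_fun setT g -> measurable_fun setT (fun x => h (g x)).
Proof. by move=> mh mg; exact: (measurableT_comp mh mg). Qed.

Lemma continuous_sqr (g : R -> R) : continuous g -> continuous (fun t => g t ^+ 2).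
Proof.
move=> cg t; rewrite (_ : (fun t => g t ^+ 2) = g \* g); last by apply/funext => u /=; rewrite expr2.
by apply: continuousM; exact: cg.
Qed.

Lemma measurable_integral_param (D : set R) (H : R * R -> R) : measurable D ->
  measurable_fun setT H -> measurable_fun setT (fun x => \int[mu]_(y in D) (H (x, y))%:E)%E.
Proof.
move=> mD mH.
have pos (F : R * R -> R) : measurable_fun setT F -> (forall z, 0 <= F z) ->
    measurable_fun setT (fun x => \int[mu]_(y in D) (F (x, y))%:E)%E.
  move=> mF F0; pose F' (z : R * R) := (F z * \1_D z.2)%:E.
  have mF' : measurable_fun setT F'.
    apply/measurable_EFinP; apply: measurable_funM => //.
    by apply: (measurableT_comp _ measurable_snd); exact: measurable_indic.
  have F'0 z : (0 <= F' z)%E by rewrite lee_fin mulr_ge0.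
  have := @measurable_fun_fubini_tonelli_F _ _ _ _ _ mu F' mF' F'0.
  rewrite (_ : fubini_F _ _ = fun x => \int[mu]_(y in D) (F (x, y))%:E)%E//.
  apply/funext => x; rewrite /fubini_F [RHS]integral_mkcond; apply: eq_integral => y _.
  by rewrite epatch_indic /= /F' EFinM.
have E x : (\int[mu]_(y in D) (H (x, y))%:E =
   \int[mu]_(y in D) (Num.max (H (x, y)) 0)%:E - \int[mu]_(y in D) (Num.max (- H (x, y)) 0)%:E)%E.
  rewrite integralE; congr (_ - _)%E; apply: eq_integral => y _.
    by rewrite funeposE EFin_max.
  by rewrite funenegE EFin_max EFinN.
rewrite (_ : (fun x => _) = fun x => (\int[mu]_(y in D) (Num.max (H (x, y)) 0)%:E -
   \int[mu]_(y in D) (Num.max (- H (x, y)) 0)%:E)%E); last by apply/funext => x; rewrite E.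
apply: emeasurable_funB.
  apply: (pos (fun z => Num.max (H z) 0)); last by move=> z; rewrite le_max lexx orbT.
  exact: measurable_maxr.
apply: (pos (fun z => Num.max (- H z) 0)); last by move=> z; rewrite le_max lexx orbT.
by apply: measurable_maxr => //; exact: measurableT_comp.
Qed.

Lemma measurable_fejer_hat (T : R) : measurable_fun setT (fejer_hat T).
Proof.
apply: (measurableT_comp (@fine_measurable R setT measurableT)).
apply: (@measurable_integral_param _ (fun z => fejer T z.2 * cos (z.2 * z.1))); first exact: measurable_itv.
apply: measurable_funM.
  apply: (@mfun_comp _ _ (fejer T)); last exact: measurable_snd.
  by apply: continuous_measurable_fun; exact: continuous_fejer.
apply: (@mfun_comp _ _ (@cos R) _ (@measurable_cos R)).
by apply: measurable_funM; [exact: measurable_snd|exact: measurable_fst].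
Qed.

(* Insert the Fejer weight, expand the square, integrate over t first, and use
   2 |f(x) f(y)| <= f(x)^2 x / y + f(y)^2 y / x (Schur's test with respect to dx / x). *)
Lemma bessel (X T Q : R) (f : R -> R) : 1 <= X -> 0 < T -> measurable_fun setT f ->
  mu.-integrable `[X, +oo[ (EFin \o f) ->
  (\int[mu]_(x in `[X, +oo[) (f x ^+ 2 * x `^ 1)%:E <= Q%:E)%E ->
  let c t := \int[mu]_(x in `[X, +oo[) (f x * cos (t * ln x)) in
  let s t := \int[mu]_(x in `[X, +oo[) (f x * sin (t * ln x)) in
  continuous c -> continuous s ->
  \int[mu]_(t in `[0%R, T]) (c t ^+ 2 + s t ^+ 2) <= 6 * pi * Q.
Proof.
move=> X1 T0 mf fi fQ c s cc cs.
set D := [set` `[X, +oo[] in fi fQ c s cc cs *.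
set J := [set` `[(0 : R), 2 * T]].
have mD : measurable (D : set R) by exact: measurable_itv.
have mJ : measurable (J : set R) by exact: measurable_itv.
have Joo : (mu J < +oo)%E by exact: lebesgue_itvcc_lty.
have T2 : 0 < 2 * T by lra.
have fni : mu.-integrable D (EFin \o (fun x => `|f x|)) by exact: (@integrable_norm _ _ _ mu D _ fi).
pose A := \int[mu]_(x in D) `|f x|.
have mc w : measurable_fun setT (fun x : R => cos (w * ln x)).
  by apply: (@mfun_comp _ _ (@cos R) _ (@measurable_cos R)); apply: measurable_funM.
have ms w : measurable_fun setT (fun x : R => sin (w * ln x)).
  by apply: (@mfun_comp _ _ (@sin R) _ (@measurable_sin R)); apply: measurable_funM.
have ifc w : mu.-integrable D (EFin \o (fun x => f x * cos (w * ln x))).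
  apply: (integrable_le mD _ _ fni); first exact: measurable_funM.
  by move=> x _; rewrite normrM ler_piMr// cos_max.
have ifs w : mu.-integrable D (EFin \o (fun x => f x * sin (w * ln x))).
  apply: (integrable_le mD _ _ fni); first exact: measurable_funM.
  by move=> x _; rewrite normrM ler_piMr// sin_max.
have cA t : `|c t| <= A.
  apply: (le_trans (@le_normr_Rintegral _ _ _ mu D _ mD (ifc t))).
  apply: le_Rintegral => //; first exact: (@integrable_norm _ _ _ mu).
  by move=> x _; rewrite normrM ler_piMr// cos_max.
have sA t : `|s t| <= A.
  apply: (le_trans (@le_normr_Rintegral _ _ _ mu D _ mD (ifs t))).
  apply: le_Rintegral => //; first exact: (@integrable_norm _ _ _ mu).
  by move=> x _; rewrite normrM ler_piMr// sin_max.
have A0 : 0 <= A by apply: le_trans (cA 0).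
pose W := fejer T.
have cW : continuous W by exact: continuous_fejer.
have cq : continuous (fun t => c t ^+ 2 + s t ^+ 2).
  by move=> t; apply: cvgD; apply: continuous_sqr.
pose N := \int[mu]_(t in J) (W t * (c t ^+ 2 + s t ^+ 2)).
have iN : mu.-integrable J (EFin \o (fun t => W t * (c t ^+ 2 + s t ^+ 2))).
  by apply: continuous_integrable => t _; apply: continuousM; [exact: cW|exact: cq].
have step0 : \int[mu]_(t in `[0%R, T]) (c t ^+ 2 + s t ^+ 2) <= 2 * N.
  have sub : [set` `[(0 : R), T]] `<=` J by apply: subset_itv; rewrite ?bnd_simp//; lra.
  apply: (@le_trans _ _ (\int[mu]_(t in `[0%R, T]) (2 * (W t * (c t ^+ 2 + s t ^+ 2))))).
    apply: le_Rintegral => //.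
    - by apply: continuous_integrable => t _; exact: cq.
    - apply: continuous_integrable => t _; apply: continuousM; first exact: cst_continuous.
      by apply: continuousM; [exact: cW|exact: cq].
    - move=> t; rewrite /= in_itv/= => /andP[t0 tT].
      have q0 : 0 <= c t ^+ 2 + s t ^+ 2 by rewrite addr_ge0 ?sqr_ge0.
      have W2 : 1 <= 2 * W t.
        have : t / (2 * T) <= 1 / 2 by rewrite ler_pdivrMr//; lra.
        by rewrite /W /fejer; lra.
      by rewrite mulrA ler_peMl.
  rewrite RintegralZl//; last by exact: (@integrableS _ _ _ mu _ _ _ mJ _ sub iN).
  rewrite ler_pM2l// /N /Rintegral fine_le//.
  - by apply: integrable_fin_num => //; exact: (@integrableS _ _ _ mu _ _ _ mJ _ sub iN).
  - exact: integrable_fin_num.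
  apply: ge0_subset_integral => //.
  - by have /integrableP[] := iN.
  - move=> t; rewrite /J /= in_itv/= => /(fejer_bound T0)/andP[W0 _].
    by rewrite lee_fin mulr_ge0// addr_ge0 ?sqr_ge0.
have mcT : measurable_fun setT c by exact: continuous_measurable_fun.
have msT : measurable_fun setT s by exact: continuous_measurable_fun.
have mWT : measurable_fun setT W by exact: continuous_measurable_fun.
have mfst (g : R -> R) : measurable_fun setT g -> measurable_fun setT (fun z : R * R => g z.1).
  by move=> mg; exact: (measurableT_comp mg measurable_fst).
have msnd (g : R -> R) : measurable_fun setT g -> measurable_fun setT (fun z : R * R => g z.2).
  by move=> mg; exact: (measurableT_comp mg measurable_snd).
have mln := @measurable_ln R.
have mcos2 : measurable_fun setT (fun z : R * R => cos (z.1 * ln z.2)).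
  apply: (@mfun_comp _ _ (@cos R) _ (@measurable_cos R)); apply: measurable_funM; first exact: measurable_fst.
  exact: msnd.
have msin2 : measurable_fun setT (fun z : R * R => sin (z.1 * ln z.2)).
  apply: (@mfun_comp _ _ (@sin R) _ (@measurable_sin R)); apply: measurable_funM; first exact: measurable_fst.
  exact: msnd.
pose q x t := cos (t * ln x) * c t + sin (t * ln x) * s t.
have step1 : N = \int[mu]_(x in D) (f x * \int[mu]_(t in J) (W t * q x t)).
  transitivity (\int[mu]_(t in J) \int[mu]_(x in D) (W t * (f x * q x t))).
    apply: eq_Rintegral => t _.
    have e1 : \int[mu]_(x in D) (f x * q x t) = c t ^+ 2 + s t ^+ 2.
      rewrite (@eq_Rintegral _ _ _ mu _ (fun x => f x * cos (t * ln x) * c t + f x * sin (t * ln x) * s t)); last first.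
        by move=> x _; rewrite /q mulrDr !mulrA.
      rewrite (@RintegralD _ _ _ mu D _ _ mD); last 2 first.
        by have := @integrableZr _ _ _ mu D mD (c t) _ (ifc t).
        by have := @integrableZr _ _ _ mu D mD (s t) _ (ifs t).
      by rewrite (@RintegralZr _ _ _ mu D)// (@RintegralZr _ _ _ mu D)// -!expr2.
    rewrite -e1 (@RintegralZl _ _ _ mu D)//.
    apply: (integrable_le mD _ _ (@integrableZl _ _ _ mu D mD (2 * A) _ fni)).
      apply: measurable_funM => //; apply: measurable_funD; apply: measurable_funM => //.
    move=> x _ /=; rewrite normrM mulrC ler_wpM2r//.
    apply: (le_trans (ler_normD _ _)); rewrite !normrM.
    have h1 : `|cos (t * ln x)| * `|c t| <= A.
      by apply: le_trans (cA t); rewrite ler_piMl// cos_max.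
    have h2 : `|sin (t * ln x)| * `|s t| <= A.
      by apply: le_trans (sA t); rewrite ler_piMl// sin_max.
    by lra.
  rewrite (@fubini_box R J D mJ mD (fun z => W z.1 * (f z.2 * q z.2 z.1)) (2 * A) f)//.
  - apply: eq_Rintegral => x _ /=; rewrite -(@RintegralZl _ _ _ mu J)//.
      by apply: eq_Rintegral => t _; ring.
    apply: continuous_integrable => t _; apply: continuousM; first exact: cW.
    apply: continuousD; apply: continuousM.
    + exact: continuous_cosM.
    + exact: cc.
    + exact: continuous_sinM.
    + exact: cs.
  - apply: measurable_funM; first exact: mfst.
    apply: measurable_funM; first exact: msnd.
    by apply: measurable_funD; apply: measurable_funM => //; exact: mfst.
  - move=> t x; rewrite /J /= in_itv/= => /(fejer_bound T0)/andP[W0 W1] _.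
    rewrite !normrM (ger0_norm W0) [`|f x| * _]mulrC mulrA ler_wpM2r//.
    rewrite -[leRHS]mul1r; apply: ler_pM => //.
    apply: (le_trans (ler_normD _ _)); rewrite !normrM.
    have h1 : `|cos (t * ln x)| * `|c t| <= A.
      by apply: le_trans (cA t); rewrite ler_piMl// cos_max.
    have h2 : `|sin (t * ln x)| * `|s t| <= A.
      by apply: le_trans (sA t); rewrite ler_piMl// sin_max.
    by lra.
have step2 x : \int[mu]_(t in J) (W t * q x t) = \int[mu]_(y in D) (f y * fejer_hat T (ln x - ln y)).
  transitivity (\int[mu]_(t in J) \int[mu]_(y in D) (W t * (f y * cos (t * (ln x - ln y))))).
    apply: eq_Rintegral => t _.
    have e1 : \int[mu]_(y in D) (f y * cos (t * (ln x - ln y))) = q x t.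
      rewrite (@eq_Rintegral _ _ _ mu _ (fun y => cos (t * ln x) * (f y * cos (t * ln y)) + sin (t * ln x) * (f y * sin (t * ln y)))); last first.
        by move=> y _; rewrite mulrBr cosB; ring.
      rewrite (@RintegralD _ _ _ mu D _ _ mD); last 2 first.
        by have := @integrableZl _ _ _ mu D mD (cos (t * ln x)) _ (ifc t).
        by have := @integrableZl _ _ _ mu D mD (sin (t * ln x)) _ (ifs t).
      by rewrite (@RintegralZl _ _ _ mu D)// (@RintegralZl _ _ _ mu D).
    rewrite -e1 (@RintegralZl _ _ _ mu D)//.
    apply: (integrable_le mD _ _ fni).
      apply: measurable_funM => //; apply: (@mfun_comp _ _ (@cos R) _ (@measurable_cos R)).
      by apply: measurable_funM => //; apply: measurable_funB.
    by move=> y _; rewrite normrM ler_piMr// cos_max.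
  rewrite (@fubini_box R J D mJ mD (fun z => W z.1 * (f z.2 * cos (z.1 * (ln x - ln z.2)))) 1 f _ Joo fi).
  - apply: eq_Rintegral => y _ /=; rewrite /fejer_hat -(@RintegralZl _ _ _ mu J)//.
      by apply: eq_Rintegral => t _; rewrite /W; ring.
    apply: continuous_integrable => t _; apply: continuousM; first exact: cW.
    exact: continuous_cosM.
  - apply: measurable_funM; first exact: mfst.
    apply: measurable_funM; first exact: msnd.
    apply: (@mfun_comp _ _ (@cos R) _ (@measurable_cos R)); apply: measurable_funM; first exact: measurable_fst.
    by apply: measurable_funB => //; exact: msnd.
  - move=> t y; rewrite /J /= in_itv/= => /(fejer_bound T0)/andP[W0 W1] _.
    rewrite mul1r !normrM (ger0_norm W0); apply: (le_trans (y := 1 * (`|f y| * 1))); last by rewrite mul1r mulr1.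
    by apply: ler_pM; rewrite ?mulr_ge0//; apply: ler_pM => //; exact: cos_max.
have T0' := ltW T0.
have ifk x : mu.-integrable D (EFin \o (fun y => f y * kappa T (ln x - ln y))).
  apply: (integrable_le mD _ _ (@integrableZl _ _ _ mu D mD (3 * T) _ fni)).
    apply: measurable_funM => //; apply: (@mfun_comp _ _ _ _ (@measurable_kappa R T)).
    exact: measurable_funB.
  move=> y _ /=; rewrite normrM mulrC ler_wpM2r//.
  by rewrite ger0_norm ?kappa_ge0// kappa_le.
pose G (z : R * R) : R := 2^-1 * (f z.1 ^+ 2 * z.1 `^ 1) * (kappa T (ln z.1 - ln z.2) * z.2 `^ (-1)).
have mG : measurable_fun setT G.
  apply: measurable_funM.
    apply: measurable_funM => //; apply: measurable_funM; first by apply: measurable_funX; exact: mfst.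
    exact: (mfst (fun x => x `^ 1) (@measurable_powR R 1)).
  apply: measurable_funM; last exact: (msnd (fun x => x `^ (-1)) (@measurable_powR R (-1))).
  apply: (@mfun_comp _ _ _ _ (@measurable_kappa R T)).
  by apply: measurable_funB; [exact: mfst|exact: msnd].
have G0 z : 0 <= G z.
  by rewrite /G; apply: mulr_ge0; apply: mulr_ge0; rewrite ?powR_ge0 ?kappa_ge0 ?invr_ge0//;
    apply: mulr_ge0; rewrite ?sqr_ge0 ?powR_ge0.
have GE x y : G (x, y) = 2^-1 * (f x ^+ 2 * x `^ 1) * (kappa T (ln x - ln y) * y `^ (-1)) by [].
clearbody G.
have D0 x : D x -> 0 < x by rewrite /D /= in_itv/= andbT => h; lra.
have mk2 x : measurable_fun setT (fun y : R => kappa T (ln x - ln y)).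
  by apply: (@mfun_comp _ _ _ _ (@measurable_kappa R T)); exact: measurable_funB.
have GQ : (\int[mu]_(x in D) \int[mu]_(y in D) (G (x, y))%:E <= (3 / 2 * pi * Q)%:E)%E.
  apply: (@le_trans _ _ (\int[mu]_(x in D) ((3 / 2 * pi)%:E * (f x ^+ 2 * x `^ 1)%:E))%E).
    apply: ge0_le_integral => //.
    - by move=> x _; apply: integral_ge0 => y _; rewrite lee_fin.
    - by apply: (@measurable_funS _ _ _ _ setT) => //; exact: measurable_integral_param.
    - apply/measurable_EFinP; apply: measurable_funM => //.
      apply: (@measurable_funS _ _ _ _ setT) => //; apply: measurable_funM; first exact: measurable_funX.
      exact: measurable_powR.
    move=> x _; under eq_integral do rewrite GE EFinM.
    have f20 : 0 <= 2^-1 * (f x ^+ 2 * x `^ 1) by apply: mulr_ge0; [rewrite invr_ge0|apply: mulr_ge0; rewrite ?sqr_ge0 ?powR_ge0].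
    rewrite ge0_integralZl//=.
    + apply: (@le_trans _ _ ((2^-1 * (f x ^+ 2 * x `^ 1))%:E * (3 * pi)%:E)%E).
        apply: lee_wpmul2l; first by rewrite lee_fin.
        by apply: kappa_integral => //; lra.
      by rewrite -!EFinM lee_fin le_eqVlt; apply/orP; left; apply/eqP; field.
    + apply/measurable_EFinP; apply: (@measurable_funS _ _ _ _ setT) => //.
      by apply: measurable_funM; [exact: mk2|exact: (@measurable_powR R (-1))].
    + by move=> y _; rewrite lee_fin mulr_ge0 ?powR_ge0 ?kappa_ge0.
  rewrite ge0_integralZl//=.
  - apply: (@le_trans _ _ ((3 / 2 * pi)%:E * Q%:E)%E).
      by apply: lee_wpmul2l => //; rewrite lee_fin !mulr_ge0// pi_ge0.
    by rewrite -EFinM.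
  - apply/measurable_EFinP; apply: (@measurable_funS _ _ _ _ setT) => //.
    by apply: measurable_funM; [exact: measurable_funX|exact: measurable_powR].
  - by move=> x _; rewrite lee_fin mulr_ge0 ?powR_ge0 ?sqr_ge0.
  - by rewrite lee_fin !mulr_ge0// pi_ge0.
pose h x := \int[mu]_(y in D) (f y * fejer_hat T (ln x - ln y)).
pose hk x := \int[mu]_(y in D) (`|f y| * kappa T (ln x - ln y)).
have ifk' x : mu.-integrable D (EFin \o (fun y => `|f y| * kappa T (ln x - ln y))).
  have := @integrable_norm _ _ _ mu D _ (ifk x).
  rewrite (_ : _ \o _ = EFin \o (fun y => `|f y| * kappa T (ln x - ln y)))//.
  by apply/funext => y /=; rewrite normrM (ger0_norm (kappa_ge0 _ T0')).
have mfn : measurable_fun setT (fun x => `|f x|) by exact: measurableT_comp.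
have mhk : measurable_fun setT hk.
  apply: (measurableT_comp (@fine_measurable R setT measurableT)).
  apply: (@measurable_integral_param D (fun z => `|f z.2| * kappa T (ln z.1 - ln z.2)) mD).
  apply: measurable_funM; first exact: (msnd _ mfn).
  apply: (@mfun_comp _ _ _ _ (@measurable_kappa R T)).
  by apply: measurable_funB; [exact: mfst|exact: msnd].
have mh : measurable_fun setT h.
  apply: (measurableT_comp (@fine_measurable R setT measurableT)).
  apply: (@measurable_integral_param D (fun z => f z.2 * fejer_hat T (ln z.1 - ln z.2)) mD).
  apply: measurable_funM; first exact: (msnd _ mf).
  apply: (@mfun_comp _ _ _ _ (measurable_fejer_hat T)).
  by apply: measurable_funB; [exact: mfst|exact: msnd].
have ifh x : mu.-integrable D (EFin \o (fun y => f y * fejer_hat T (ln x - ln y))).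
  apply: (integrable_le mD _ _ (ifk' x)).
    apply: measurable_funM => //; apply: (@mfun_comp _ _ _ _ (measurable_fejer_hat T)).
    exact: measurable_funB.
  by move=> y _; rewrite normrM ler_wpM2l// fejer_hat_le.
have hhk x : `|h x| <= hk x.
  apply: (le_trans (@le_normr_Rintegral _ _ _ mu D _ mD (ifh x))).
  apply: le_Rintegral => //; first exact: (@integrable_norm _ _ _ mu).
  by move=> y _; rewrite normrM ler_wpM2l// fejer_hat_le.
have hkA x : hk x <= 3 * T * A.
  rewrite /A -(@RintegralZl _ _ _ mu D)//; apply: le_Rintegral => //.
    exact: (@integrableZl _ _ _ mu D mD (3 * T) _ fni).
  by move=> y _; rewrite mulrC ler_wpM2r// kappa_le.
have hk0 x : 0 <= hk x by apply: Rintegral_ge0 => y _; rewrite mulr_ge0// kappa_ge0.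
have i1 : mu.-integrable D (EFin \o (fun x => `|f x| * hk x)).
  apply: (integrable_le mD _ _ (@integrableZl _ _ _ mu D mD (3 * T * A) _ fni)).
    exact: measurable_funM.
  by move=> x _ /=; rewrite ger0_norm ?mulr_ge0// mulrC ler_wpM2r.
have i2 : mu.-integrable D (EFin \o (fun x => f x * h x)).
  apply: (integrable_le mD _ _ i1); first exact: measurable_funM.
  by move=> x _; rewrite normrM ler_wpM2l.
have NQ : N <= 3 * pi * Q.
  apply: (@le_trans _ _ (\int[mu]_(x in D) (`|f x| * hk x))).
    rewrite step1 (@eq_Rintegral _ _ _ mu _ (fun x => f x * h x)); last first.
      by move=> x _; rewrite step2.
    apply: le_Rintegral => // x _; apply: (le_trans (ler_norm _)).
    by rewrite normrM ler_wpM2l.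
  rewrite -lee_fin /Rintegral fineK; last exact: integrable_fin_num.
  have mG' : measurable_fun setT (fun z : R * R => G (z.2, z.1)).
    by apply: (measurableT_comp mG); exact: measurable_swap.
  have GQ' : (\int[mu]_(x in D) \int[mu]_(y in D) (G (y, x))%:E <= (3 / 2 * pi * Q)%:E)%E.
    by have := @tonelli_box R D D mD mD (fun z => G (z.2, z.1)) mG' (fun z => G0 _) => /= ->.
  have E : (3 * pi * Q)%:E = ((3 / 2 * pi * Q)%:E + (3 / 2 * pi * Q)%:E)%E :> \bar R.
    by rewrite -EFinD; congr EFin; field.
  rewrite E; apply: le_trans (leeD GQ GQ').
  have p1 : measurable_fun D (fun x => \int[mu]_(y in D) (G (x, y))%:E)%E.
    by apply: (@measurable_funS _ _ _ _ setT) => //; exact: measurable_integral_param.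
  have p2 : measurable_fun D (fun x => \int[mu]_(y in D) (G (y, x))%:E)%E.
    by apply: (@measurable_funS _ _ _ _ setT) => //; exact: (@measurable_integral_param D (fun z => G (z.2, z.1)) mD mG').
  have q1 x : D x -> (0 <= \int[mu]_(y in D) (G (x, y))%:E)%E.
    by move=> _; apply: integral_ge0 => y _; rewrite lee_fin.
  have q2 x : D x -> (0 <= \int[mu]_(y in D) (G (y, x))%:E)%E.
    by move=> _; apply: integral_ge0 => y _; rewrite lee_fin.
  rewrite -(@ge0_integralD _ _ _ mu D mD _ _ q1 p1 q2 p2).
  apply: ge0_le_integral => //.
  - by move=> x _; rewrite lee_fin mulr_ge0.
  - by have /integrableP[] := i1.
  - exact: (emeasurable_funD p1 p2).
  move=> x Dx; have x0 := D0 x Dx.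
  have mGx : measurable_fun D (fun y => (G (x, y))%:E).
    apply/measurable_EFinP; apply: (@measurable_funS _ _ _ _ setT) => //.
    by apply: (measurableT_comp mG); exact: pair1_measurable.
  have mGy : measurable_fun D (fun y => (G (y, x))%:E).
    apply/measurable_EFinP; apply: (@measurable_funS _ _ _ _ setT) => //.
    by apply: (measurableT_comp mG); exact: pair2_measurable.
  have r1 y : D y -> (0 <= (G (x, y))%:E)%E by rewrite lee_fin.
  have r2 y : D y -> (0 <= (G (y, x))%:E)%E by rewrite lee_fin.
  rewrite -(@ge0_integralD _ _ _ mu D mD _ _ r1 mGx r2 mGy).
  have -> : (`|f x| * hk x)%:E = (\int[mu]_(y in D) (`|f x| * (`|f y| * kappa T (ln x - ln y)))%:E)%E.
    rewrite /hk -(@RintegralZl _ _ _ mu D)// /Rintegral fineK//.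
    by apply: integrable_fin_num => //; exact: (@integrableZl _ _ _ mu D mD _ _ (ifk' x)).
  apply: ge0_le_integral => //.
  - by move=> y _; rewrite lee_fin; apply: mulr_ge0 => //; apply: mulr_ge0 => //; exact: kappa_ge0.
  - by have /integrableP[] := @integrableZl _ _ _ mu D mD `|f x| _ (ifk' x).
  - exact: (emeasurable_funD mGx mGy).
  move=> y Dy; have y0 := D0 y Dy; rewrite -EFinD lee_fin !GE.
  rewrite !powRr1 ?(ltW x0) ?(ltW y0)// !powR_inv1 ?(ltW x0) ?(ltW y0)//.
  have -> : kappa T (ln y - ln x) = kappa T (ln x - ln y) by rewrite -kappaN opprB.
  have k0 : 0 <= kappa T (ln x - ln y) by exact: kappa_ge0.
  have amgm : `|f x| * `|f y| <= 2^-1 * (f x ^+ 2 * x * y^-1 + f y ^+ 2 * y * x^-1).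
    have : 0 <= (`|f x| * x - `|f y| * y) ^+ 2 / (x * y).
      by rewrite divr_ge0 ?sqr_ge0// mulr_ge0// ltW.
    have -> : (`|f x| * x - `|f y| * y) ^+ 2 / (x * y) =
       `|f x| ^+ 2 * x * y^-1 + `|f y| ^+ 2 * y * x^-1 - 2 * (`|f x| * `|f y|).
      by field; rewrite !gt_eqF.
    by rewrite !real_normK ?num_real//; clear; lra.
  apply: (@le_trans _ _ (2^-1 * (f x ^+ 2 * x * y^-1 + f y ^+ 2 * y * x^-1) * kappa T (ln x - ln y))).
    by rewrite mulrA ler_wpM2r.
  by rewrite le_eqVlt; apply/orP; left; apply/eqP; ring.
apply: (le_trans step0).
have -> : 6 * pi * Q = 2 * (3 * pi * Q) by ring.
by rewrite ler_pM2l.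
Qed.

End Bessel.

(** * Mean squares of Dirichlet polynomials *)

Section Kernels.
Variable R : realType.
Notation mu := (@lebesgue_measure R).

Definition harm (N : nat) : R := \sum_(1 <= n < N.+1) n%:R^-1.

Lemma harm_ge0 N : 0 <= harm N.
Proof. by apply: sumr_ge0 => n _; rewrite invr_ge0. Qed.

Lemma harm_ge1 N : (0 < N)%N -> 1 <= harm N.
Proof.
move=> N0; rewrite /harm big_ltn// invr1 lerDl.
by apply: sumr_ge0 => n _; rewrite invr_ge0.
Qed.

Lemma harm_le (N : nat) (dl : R) : 0 < dl -> (0 < N)%N -> harm N <= (1 + dl^-1) * N%:R `^ dl.
Proof.
move=> d0 N0; have N1 : 1 <= N%:R :> R by rewrite ler1n.
apply: (@le_trans _ _ (\sum_(1 <= n < N.+1) N%:R `^ dl * n%:R `^ (-1 - dl))).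
  apply: ler_sum_nat => n /andP[n0]; rewrite ltnS => nN.
  have n0' : 0 < n%:R :> R by rewrite ltr0n.
  have -> : n%:R^-1 = n%:R `^ dl * n%:R `^ (-1 - dl) :> R.
    by rewrite -powRD_pos// addrCA subrr addr0 powR_inv1// ltW.
  rewrite ler_wpM2r ?powR_ge0//; apply: ge0_ler_powR; rewrite ?nnegrE ?(ltW d0)//.
  by rewrite ler_nat.
rewrite -mulr_sumr mulrC ler_wpM2r ?powR_ge0// big_ltn// powR1 lerD2l.
by have := sum_powR_tail N d0 (ltnSn 0); rewrite powR1 mulr1.
Qed.

Lemma sum_rev_harm N : \sum_(1 <= n < N) (N%:R - n%:R)^-1 <= harm N :> R.
Proof.
rewrite big_nat_rev /=; apply: (@le_trans _ _ (\sum_(1 <= n < N) n%:R^-1)).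
  apply: ler_sum_nat => n /andP[n0 nN].
  by rewrite add1n subSS natrB ?(ltnW nN)// opprB addrC subrK.
case: N => [|N]; first by rewrite big_geq// harm_ge0.
rewrite /harm [leRHS]big_nat_recr//= lerDl invr_ge0//.
Qed.

Lemma sum_shift_harm N m : (m <= N)%N ->
  \sum_(1 <= n < N.+1) (if (m < n)%N then (n%:R - m%:R)^-1 else 0) <= harm N :> R.
Proof.
move=> mN; rewrite (@big_cat_nat _ _ _ m.+1)//=.
rewrite [X in X + _]big_nat_cond [X in X + _]big1 ?add0r; last first.
  by move=> n /andP[/andP[_]]; rewrite ltnS leqNgt => /negbTE ->.
rewrite -{1}(add1n m) big_addn subSn//.
apply: (@le_trans _ _ (\sum_(1 <= n < (N - m).+1) n%:R^-1)).
  apply: ler_sum_nat => n /andP[n0 _].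
  by rewrite -[X in (X < _)%N]add0n ltn_add2r n0 natrD addrK.
rewrite /harm [leRHS](@big_cat_nat _ _ _ (N - m).+1)//= ?ltnS ?leq_subr//.
by rewrite lerDl; apply: sumr_ge0 => n _; rewrite invr_ge0.
Qed.

Lemma ln_sub_ge (x n : R) : 0 < n -> n <= x -> (x - n) / x <= ln x - ln n.
Proof.
move=> n0 nx; have x0 : 0 < x by lra.
have := @le_ln1Dx R (n / x - 1); rewrite addrCA subrr addr0.
rewrite ln_div ?posrE// => h; rewrite mulrBl divff ?gt_eqF//.
have q0 : 0 < n / x by rewrite divr_gt0.
have {}h : ln n - ln x <= n / x - 1 by apply: h; lra.
by lra.
Qed.

(* After ln x - ln n >= (x - n) / x, everything reduces to harmonic sums by
   x / (n (x - n)) = 1 / n + 1 / (x - n). *)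
Lemma kernel_sum (A v : nat -> R) (N : nat) (B c T x : R) : (0 < N)%N -> N%:R <= x ->
  0 <= B -> 0 <= c -> T <= 2 * N%:R ->
  (forall n, (0 < n <= N)%N -> 0 <= A n <= B / n%:R) ->
  (forall n, (0 < n <= N)%N -> 0 <= v n <= c * T /\ (ln x - ln n%:R) * v n <= c) ->
  \sum_(1 <= n < N.+1) A n * v n <= B * c * (4 * harm N).
Proof.
move=> N0 Nx B0 c0 TN HA Hv; have N1 : 1 <= N%:R :> R by rewrite ler1n.
have x0 : 0 < x by lra.
have h1 := harm_ge1 N0.
have Bc : 0 <= B * c by rewrite mulr_ge0.
apply: (@le_trans _ _ (B * c * (2 + (harm N + harm N)))); last first.
  by rewrite ler_wpM2l//; lra.
rewrite big_nat_recr//= addrC mulrDr; apply: lerD.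
  have NI : (0 < N <= N)%N by rewrite N0 leqnn.
  have /andP[a0 a1] := HA N NI; have [/andP[v0 v1] _] := Hv N NI.
  apply: (@le_trans _ _ (B / N%:R * (c * T))); first exact: ler_pM.
  have -> : B / N%:R * (c * T) = B * c * (T / N%:R) by ring.
  by rewrite ler_wpM2l// ler_pdivrMr ?ltr0n// mulrC.
apply: (@le_trans _ _ (\sum_(1 <= n < N) (B * c * n%:R^-1 + B * c * (N%:R - n%:R)^-1))).
  apply: ler_sum_nat => n /andP[n0 nN]; have n0' : 0 < n%:R :> R by rewrite ltr0n.
  have nN' : n%:R + 1 <= N%:R :> R by rewrite natr1 ler_nat.
  have nI : (0 < n <= N)%N by rewrite n0 ltnW.
  have /andP[a0 a1] := HA n nI; have [/andP[v0 v1] v2] := Hv n nI.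
  have xn : 0 < x - n%:R by lra.
  have Nn : 0 < N%:R - n%:R :> R by lra.
  have hv : v n <= c * (x / (x - n%:R)).
    have l1 : (x - n%:R) / x * v n <= c.
      by apply: le_trans v2; rewrite ler_wpM2r// ln_sub_ge//; lra.
    rewrite mulrA ler_pdivlMr// mulrC.
    by move: l1; rewrite mulrAC ler_pdivrMr.
  apply: (@le_trans _ _ (B / n%:R * (c * (x / (x - n%:R))))); first exact: ler_pM.
  have -> : B / n%:R * (c * (x / (x - n%:R))) = B * c * (n%:R^-1 + (x - n%:R)^-1).
    by field; rewrite !gt_eqF.
  rewrite -mulrDr ler_wpM2l// lerD2l lef_pV2 ?posrE//; lra.
rewrite big_split/= -!mulr_sumr; apply: (@le_trans _ _ (B * c * harm N + B * c * harm N)); last by rewrite mulrDr.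
apply: lerD; rewrite ler_wpM2l//; last exact: sum_rev_harm.
by rewrite /harm [leRHS]big_nat_recr//= lerDl invr_ge0.
Qed.

Lemma double_kernel_sum (A : nat -> R) (v : nat -> nat -> R) (N : nat) (B c : R) : (0 < N)%N ->
  0 <= B -> 0 <= c ->
  (forall n, (0 < n <= N)%N -> 0 <= A n <= B / n%:R) ->
  (forall m n, (0 < m)%N -> (0 < n)%N -> m != n -> 0 <= v m n /\ `|ln m%:R - ln n%:R| * v m n <= c) ->
  \sum_(1 <= m < N.+1) \sum_(1 <= n < N.+1) (if m == n then 0 else A m * A n * v m n) <=
    2 * c * B ^+ 2 * harm N ^+ 2.
Proof.
move=> N0 B0 c0 HA Hv.
pose e (m n : nat) : R := if (m < n)%N then m%:R^-1 * (n%:R - m%:R)^-1 else 0.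
have e_sum : \sum_(1 <= m < N.+1) \sum_(1 <= n < N.+1) e m n <= harm N ^+ 2.
  rewrite expr2 {1}/harm mulr_suml; apply: ler_sum_nat => m /andP[m0]; rewrite ltnS => mN.
  rewrite (eq_bigr (fun n => m%:R^-1 * (if (m < n)%N then (n%:R - m%:R)^-1 else 0))); last first.
    by move=> n _; rewrite /e; case: ifP; rewrite ?mulr0.
  by rewrite -mulr_sumr ler_wpM2l ?invr_ge0// sum_shift_harm.
have key m n : (0 < m <= N)%N -> (0 < n <= N)%N -> (m < n)%N ->
    A m * A n * v m n <= c * B ^+ 2 * e m n /\ A n * A m * v n m <= c * B ^+ 2 * e m n.
  move=> mI nI mn; have /andP[m0 _] := mI; have /andP[n0 _] := nI.
  have m0' : 0 < m%:R :> R by rewrite ltr0n.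
  have n0' : 0 < n%:R :> R by rewrite ltr0n.
  have mn' : m%:R < n%:R :> R by rewrite ltr_nat.
  have d0 : 0 < n%:R - m%:R :> R by rewrite subr_gt0.
  have g v' : 0 <= v' -> (ln n%:R - ln m%:R) * v' <= c -> A m * A n * v' <= c * B ^+ 2 * e m n.
    move=> v0 v1; have /andP[a0 a1] := HA m mI; have /andP[b0 b1] := HA n nI.
    have l1 : (n%:R - m%:R) / n%:R * v' <= c.
      by apply: le_trans v1; rewrite ler_wpM2r// ln_sub_ge// ltW.
    have l2 : v' <= c * (n%:R / (n%:R - m%:R)).
      by rewrite mulrA ler_pdivlMr// mulrC; move: l1; rewrite mulrAC ler_pdivrMr.
    apply: (@le_trans _ _ ((B / m%:R) * (B / n%:R) * (c * (n%:R / (n%:R - m%:R))))).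
      by apply: ler_pM; rewrite ?mulr_ge0//; apply: ler_pM.
    rewrite /e mn le_eqVlt; apply/orP; left; apply/eqP; field.
    by rewrite !gt_eqF.
  split.
    have [v0 v1] := Hv m n m0 n0 (negbT (ltn_eqF mn)).
    apply: g => //; apply: le_trans v1; rewrite ler_wpM2r// distrC.
    exact: ler_norm.
  have [v0 v1] := Hv n m n0 m0 (negbT (gtn_eqF mn)).
  rewrite [A n * A m]mulrC; apply: g => //; apply: le_trans v1; rewrite ler_wpM2r//.
  exact: ler_norm.
apply: (@le_trans _ _ (\sum_(1 <= m < N.+1) \sum_(1 <= n < N.+1) (c * B ^+ 2 * e m n + c * B ^+ 2 * e n m))).
  apply: ler_sum_nat => m mI; apply: ler_sum_nat => n nI.
  have e0 p q : 0 <= e p q.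
    rewrite /e; case: ltnP => // pq; rewrite mulr_ge0 ?invr_ge0// subr_ge0 ler_nat ltnW//.
  have K0 : 0 <= c * B ^+ 2 by rewrite mulr_ge0// sqr_ge0.
  case: (ltngtP m n) => mn.
  - have [h _] := key m n mI nI mn; apply: (le_trans h); rewrite lerDl mulr_ge0//.
  - have [_ h] := key n m nI mI mn; apply: (le_trans h); rewrite lerDr mulr_ge0//.
  - by rewrite addr_ge0// mulr_ge0.
rewrite (eq_bigr (fun m => c * B ^+ 2 * (\sum_(1 <= n < N.+1) e m n) + c * B ^+ 2 * (\sum_(1 <= n < N.+1) e n m))); last first.
  by move=> m _; rewrite big_split /= -!mulr_sumr.
rewrite big_split/= -!mulr_sumr [X in _ + _ * X]exchange_big /=.
have K0 : 0 <= c * B ^+ 2 by rewrite mulr_ge0// sqr_ge0.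
have := ler_wpM2l K0 e_sum; lra.
Qed.

Definition Kcos (T w : R) : R := \int[mu]_(t in `[1%R, T]) cos (t * w).
Definition Kmix (sg T w : R) : R := \int[mu]_(t in `[1%R, T]) (sg * cos (t * w) + t * sin (t * w)).

Lemma Kcos_le (T w : R) : 1 <= T -> `|Kcos T w| <= T.
Proof.
move=> T1; have := @Rintegral_bound R 1 T (fun t => cos (t * w)) 1 T1; rewrite mulr1 => H.
apply: le_trans (H _ _) _; last by lra.
- by apply: continuous_integrable => t _; exact: continuous_cosM.
- by move=> t _; exact: cos_max.
Qed.

Lemma Kcos0 (T : R) : 1 <= T -> Kcos T 0 = T - 1.
Proof.
move=> T1; rewrite /Kcos (@eq_Rintegral _ _ _ mu _ (fun=> 1)); last first.
  by move=> t _; rewrite mulr0 cos0.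
rewrite Rintegral_cst//= lebesgue_measure_itv/= lte_fin.
by move: T1; rewrite le_eqVlt => /predU1P[<-|->//=]; rewrite ?ltxx ?subrr ?mulr0 ?mul1r.
Qed.

Lemma Kcos_mul_le (T w : R) : 1 <= T -> `|w| * `|Kcos T w| <= 2.
Proof.
move=> T1; have [->|w0] := eqVneq w 0; first by rewrite normr0 mul0r.
have dA (x : R) : is_derive x (1 : R) (fun t => sin (t * w) / w) (cos (x * w)).
  apply: is_derive_eq (is_deriveM (is_derive_sinM w x) (is_derive_cst w^-1 x (1 : R))) _.
  by rewrite /GRing.scale /=; field.
have -> : Kcos T w = sin (T * w) / w - sin (1 * w) / w.
  exact: (@FTC_derive R _ (fun t => sin (t * w) / w) 1 T T1 (fun x _ => dA x) (fun x _ => @continuous_cosM R w x)).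
rewrite -normrM mulrBr ![w * _]mulrC !divfK//.
apply: (le_trans (ler_normB _ _)).
by have := sin_max (T * w); have := sin_max (1 * w); lra.
Qed.

Lemma continuous_mix (sg w : R) : continuous (fun t : R => sg * cos (t * w) + t * sin (t * w)).
Proof.
move=> t; apply: cvgD; apply: cvgM; [exact: cvg_cst|exact: continuous_cosM|exact: cvg_id|exact: continuous_sinM].
Qed.

Lemma Kmix_le (sg T w : R) : 1 <= T -> 0 <= sg <= 1 -> `|Kmix sg T w| <= 6 * T * T.
Proof.
move=> T1 /andP[s0 s1].
have H := @Rintegral_bound R 1 T (fun t => sg * cos (t * w) + t * sin (t * w)) (1 + T) T1.
apply: le_trans (H _ _) _; last by nra.
- by apply: continuous_integrable => t _; exact: continuous_mix.
- move=> t /andP[t1 tT]; apply: (le_trans (ler_normD _ _)); rewrite !normrM.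
  apply: lerD; first by rewrite (ger0_norm s0) mulr_ile1// cos_max.
  rewrite (ger0_norm (le_trans ler01 t1)) -[leRHS]mulr1.
  by apply: ler_pM => //; [lra|exact: sin_max].
Qed.

Lemma Kmix_mul_le (sg T w : R) : 1 <= T -> 0 <= sg <= 1 -> `|w| * `|Kmix sg T w| <= 6 * T.
Proof.
move=> T1 /andP[s0 s1]; have [->|w0] := eqVneq w 0; first by rewrite normr0 mul0r; lra.
pose A (t : R) := sg * sin (t * w) / w - t * cos (t * w) / w + sin (t * w) / w ^+ 2.
have dA (x : R) : is_derive x (1 : R) A (sg * cos (x * w) + x * sin (x * w)).
  have d0 := is_deriveM (is_derive_cst sg x (1 : R)) (is_derive_sinM w x).
  have d1 := is_deriveM d0 (is_derive_cst w^-1 x (1 : R)).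
  have d2 := is_deriveM (is_deriveM (is_derive_id x (1 : R)) (is_derive_cosM w x)) (is_derive_cst w^-1 x (1 : R)).
  have d3 := is_deriveM (is_derive_sinM w x) (is_derive_cst (w ^+ 2)^-1 x (1 : R)).
  apply: is_derive_eq (is_deriveD (is_deriveB d1 d2) d3) _.
  by rewrite /GRing.scale /=; field.
have -> : Kmix sg T w = A T - A 1.
  exact: (@FTC_derive R _ A 1 T T1 (fun x _ => dA x) (fun x _ => @continuous_mix sg w x)).
have bd t : 1 <= t -> t <= T -> `|w| * `|A t| <= 3 * T.
  move=> t1 tT; rewrite -normrM.
  have -> : w * A t = sg * sin (t * w) - t * cos (t * w) + sin (t * w) / w by rewrite /A; field.
  apply: (le_trans (ler_normD _ _)).
  have h1 : `|sg * sin (t * w)| <= 1 by rewrite normrM (ger0_norm s0) mulr_ile1// sin_max.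
  have t0 : 0 <= t by lra.
  have h2 : `|t * cos (t * w)| <= t by rewrite normrM (ger0_norm t0) ler_piMr// cos_max.
  have h3 : `|sin (t * w) / w| <= t.
    rewrite normrM normfV ler_pdivrMr ?normr_gt0//.
    by apply: (le_trans (sin_norm_le _)); rewrite normrM (ger0_norm t0).
  by have := ler_normB (sg * sin (t * w)) (t * cos (t * w)); lra.
have b1 := bd 1 (lexx _) T1; have b2 := bd T T1 (lexx _).
apply: (@le_trans _ _ (`|w| * (`|A T| + `|A 1|))).
  by rewrite ler_wpM2l// ler_normB.
by rewrite mulrDr; lra.
Qed.

End Kernels.

Section ContInt.
Variable R : realType.
Notation mu := (@lebesgue_measure R).
Implicit Types f g : R -> R.

Lemma contD f g : continuous f -> continuous g -> continuous (fun t => f t + g t).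
Proof. by move=> cf cg t; apply: cvgD; [exact: cf|exact: cg]. Qed.

Lemma contM f g : continuous f -> continuous g -> continuous (fun t => f t * g t).
Proof. by move=> cf cg t; apply: cvgM; [exact: cf|exact: cg]. Qed.

Lemma contN f : continuous f -> continuous (fun t => - f t).
Proof. by move=> cf t; apply: cvgN; exact: cf. Qed.

Lemma cont_cst (a : R) : continuous (fun _ : R => a).
Proof. by move=> t; exact: cvg_cst. Qed.

Lemma cont_id : continuous (fun t : R => t).
Proof. by move=> t; exact: cvg_id. Qed.

Lemma cont_sum (I : Type) (r : seq I) (F : I -> R -> R) : (forall i, continuous (F i)) ->
  continuous (fun t => \sum_(i <- r) F i t).
Proof.
move=> cF; elim: r => [|i r IH].
  by under eq_fun do rewrite big_nil; exact: cont_cst.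
by under eq_fun do rewrite big_cons; exact: contD.
Qed.

Variables (a b : R).

Lemma cont_int f : continuous f -> mu.-integrable `[a, b] (EFin \o f).
Proof. by move=> cf; apply: continuous_integrable => x _; exact: cf. Qed.

Lemma RintD f g : continuous f -> continuous g ->
  \int[mu]_(t in `[a, b]) (f t + g t) =
  \int[mu]_(t in `[a, b]) f t + \int[mu]_(t in `[a, b]) g t.
Proof. by move=> cf cg; rewrite (@RintegralD _ _ _ mu `[a, b]%classic)//; exact: cont_int. Qed.

Lemma RintZ (c : R) f : continuous f ->
  \int[mu]_(t in `[a, b]) (c * f t) = c * \int[mu]_(t in `[a, b]) f t.
Proof. by move=> cf; rewrite (@RintegralZl _ _ _ mu `[a, b]%classic)//; exact: cont_int. Qed.

Lemma Rint_sum (I : Type) (r : seq I) (F : I -> R -> R) : (forall i, continuous (F i)) ->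
  \int[mu]_(t in `[a, b]) (\sum_(i <- r) F i t) = \sum_(i <- r) \int[mu]_(t in `[a, b]) F i t.
Proof.
move=> cF; elim: r => [|i r IH].
  by under eq_Rintegral do rewrite big_nil; rewrite Rintegral_cst// mul0r big_nil.
under eq_Rintegral do rewrite big_cons.
by rewrite RintD// ?IH ?big_cons//; exact: cont_sum.
Qed.

Lemma Rint_le f g : continuous f -> continuous g ->
  (forall t, a <= t <= b -> f t <= g t) ->
  \int[mu]_(t in `[a, b]) f t <= \int[mu]_(t in `[a, b]) g t.
Proof.
move=> cf cg fg; apply: (@le_Rintegral _ _ _ mu `[a, b]%classic) => //; exact: cont_int.
Qed.

Lemma Rint_norm_le f g : continuous f -> continuous g ->
  (forall t, a <= t <= b -> `|f t| <= g t) ->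
  `|\int[mu]_(t in `[a, b]) f t| <= \int[mu]_(t in `[a, b]) g t.
Proof.
move=> cf cg fg; rewrite ler_norml; apply/andP; split.
  rewrite -[X in - X]mul1r -mulNr -RintZ//.
  apply: Rint_le => //; first by apply: contM => //; exact: cont_cst.
  by move=> t /fg; rewrite ler_norml mulN1r => /andP[].
by apply: Rint_le => // t /fg; rewrite ler_norml => /andP[].
Qed.

Lemma eq_Rint f g : (forall t, a <= t <= b -> f t = g t) ->
  \int[mu]_(t in `[a, b]) f t = \int[mu]_(t in `[a, b]) g t.
Proof. by move=> fg; apply: eq_Rintegral => t; rewrite inE/= in_itv/= => /fg. Qed.

End ContInt.

Section DirichletMeanSquare.
Variable R : realType.
Notation mu := (@lebesgue_measure R).
Variables (A : nat -> R) (N : nat) (B T sg : R).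
Hypotheses (N0 : (0 < N)%N) (T1 : 1 <= T) (TN : T <= 2 * N%:R) (B0 : 0 <= B).
Hypotheses (sg01 : 0 <= sg <= 1).
Hypothesis HA : forall n, (0 < n <= N)%N -> 0 <= A n <= B / n%:R.

Definition dir_re (t : R) : R := \sum_(1 <= n < N.+1) A n * cos (t * ln n%:R).
Definition dir_im (t : R) : R := - \sum_(1 <= n < N.+1) A n * sin (t * ln n%:R).

Lemma continuous_dir_re : continuous dir_re.
Proof. by apply: cont_sum => n; apply: contM; [exact: cont_cst|exact: continuous_cosM]. Qed.

Lemma continuous_dir_im : continuous dir_im.
Proof.
apply: contN; apply: cont_sum => n.
by apply: contM; [exact: cont_cst|exact: continuous_sinM].
Qed.

Lemma sum_coef_le : \sum_(1 <= n < N.+1) A n <= B * harm R N.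
Proof.
rewrite /harm mulr_sumr; apply: ler_sum_nat => n nI.
by have /andP[] := HA nI.
Qed.

Lemma dir_sum_le (F : nat -> R) : (forall n, `|F n| <= 1) ->
  `|\sum_(1 <= n < N.+1) A n * F n| <= B * harm R N.
Proof.
move=> F1; apply: (le_trans (ler_norm_sum _ _ _)); apply: le_trans sum_coef_le.
apply: ler_sum_nat => n nI; have /andP[a0 _] := HA nI.
by rewrite normrM (ger0_norm a0) ler_piMr.
Qed.

Lemma dir_re_le t : `|dir_re t| <= B * harm R N.
Proof. by apply: dir_sum_le => n; exact: cos_max. Qed.

Lemma dir_im_le t : `|dir_im t| <= B * harm R N.
Proof. by rewrite normrN; apply: dir_sum_le => n; exact: sin_max. Qed.

Lemma dir_cos (t w : R) : dir_re t * cos (t * w) - dir_im t * sin (t * w) =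
  \sum_(1 <= n < N.+1) A n * cos (t * (w - ln n%:R)).
Proof.
rewrite mulNr opprK !mulr_suml -big_split/=; apply: eq_bigr => n _.
by rewrite mulrBr cosB; ring.
Qed.

Lemma dir_sin (t w : R) : dir_re t * sin (t * w) + dir_im t * cos (t * w) =
  \sum_(1 <= n < N.+1) A n * sin (t * (w - ln n%:R)).
Proof.
rewrite mulNr !mulr_suml -sumrB/=; apply: eq_bigr => n _.
by rewrite mulrBr sinB; ring.
Qed.

Lemma msq_dir : `|\int[mu]_(t in `[1, T]) (dir_re t ^+ 2 + dir_im t ^+ 2) -
    T * \sum_(1 <= n < N.+1) A n ^+ 2| <= 5 * B ^+ 2 * harm R N ^+ 2.
Proof.
have E : \int[mu]_(t in `[1, T]) (dir_re t ^+ 2 + dir_im t ^+ 2) =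
    \sum_(1 <= m < N.+1) \sum_(1 <= n < N.+1) A m * A n * Kcos T (ln m%:R - ln n%:R).
  transitivity (\int[mu]_(t in `[1, T]) (\sum_(1 <= m < N.+1) \sum_(1 <= n < N.+1)
     A m * A n * cos (t * (ln m%:R - ln n%:R)))).
    apply: eq_Rint => t _.
    transitivity (\sum_(1 <= m < N.+1) A m * (dir_re t * cos (t * ln m%:R) - dir_im t * sin (t * ln m%:R))).
      rewrite (eq_bigr (fun m => dir_re t * (A m * cos (t * ln m%:R)) - dir_im t * (A m * sin (t * ln m%:R)))).
        by rewrite sumrB -!mulr_sumr -/(dir_re t) /dir_im; ring.
      by move=> m _; ring.
    apply: eq_bigr => m _; rewrite dir_cos mulr_sumr; apply: eq_bigr => n _; by rewrite mulrA.
  have cc m n : continuous (fun t : R => A m * A n * cos (t * (ln m%:R - ln n%:R))).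
    by apply: contM; [exact: cont_cst|exact: continuous_cosM].
  rewrite Rint_sum; last by move=> m; apply: cont_sum => n; exact: cc.
  apply: eq_bigr => m _; rewrite Rint_sum//; apply: eq_bigr => n _.
  by rewrite RintZ//; exact: continuous_cosM.
pose off := \sum_(1 <= m < N.+1) \sum_(1 <= n < N.+1)
  (if m == n then 0 else A m * A n * Kcos T (ln m%:R - ln n%:R)).
have E2 : \int[mu]_(t in `[1, T]) (dir_re t ^+ 2 + dir_im t ^+ 2) =
   off + (T - 1) * \sum_(1 <= n < N.+1) A n ^+ 2.
  rewrite E /off mulr_sumr -big_split/=; apply: eq_big_nat => m mI.
  rewrite (bigD1_seq m) ?iota_uniq ?mem_index_iota//= addrC; congr (_ + _); last first.
    by rewrite subrr Kcos0//; ring.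
  rewrite [RHS](bigD1_seq m) ?iota_uniq ?mem_index_iota//= eqxx add0r.
  by apply: eq_bigr => n; rewrite eq_sym => /negbTE ->.
have h1 := harm_ge1 R N0.
have K0 n : (0 < n <= N)%N -> 0 <= A n by move=> nI; have /andP[] := HA nI.
have off_le : `|off| <= 2 * 2 * B ^+ 2 * harm R N ^+ 2.
  apply: le_trans (@double_kernel_sum R A (fun m n => `|Kcos T (ln m%:R - ln n%:R)|) N B 2 N0 B0 _ HA _) => //.
    rewrite /off; apply: (le_trans (ler_norm_sum _ _ _)); apply: ler_sum_nat => m mI.
    apply: (le_trans (ler_norm_sum _ _ _)); apply: ler_sum_nat => n nI.
    case: ifP => _; rewrite ?normr0// normrM (ger0_norm (mulr_ge0 (K0 m mI) (K0 n nI)))//.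
  by move=> m n m0 n0 mn; split => //; exact: Kcos_mul_le.
have sq_le : 0 <= \sum_(1 <= n < N.+1) A n ^+ 2 <= B ^+ 2 * harm R N ^+ 2.
  rewrite sumr_ge0/=; last by move=> n _; exact: sqr_ge0.
  apply: (@le_trans _ _ (\sum_(1 <= n < N.+1) B * (B * harm R N) * n%:R^-1)).
    apply: ler_sum_nat => n nI; have /andP[a0 a1] := HA nI.
    have n1 : 1 <= n%:R :> R by rewrite ler1n; case/andP: nI.
    apply: (@le_trans _ _ (B * (B / n%:R))).
      rewrite expr2; apply: ler_pM => //; apply: (le_trans a1).
      by rewrite ler_pdivrMr ?ler_peMr//; lra.
    rewrite [leRHS](_ : _ = B * (B / n%:R) * harm R N); last by ring.
    rewrite ler_peMr// mulr_ge0// divr_ge0//; lra.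
  rewrite -mulr_sumr -/(harm R N); lra.
have -> : \int[mu]_(t in `[1, T]) (dir_re t ^+ 2 + dir_im t ^+ 2) - T * \sum_(1 <= n < N.+1) A n ^+ 2 =
   off - \sum_(1 <= n < N.+1) A n ^+ 2 by rewrite E2; ring.
apply: (le_trans (ler_normB _ _)); case/andP: sq_le => q0 q1.
by rewrite (ger0_norm q0); lra.
Qed.

Lemma msq_cross_cst (X w : R) : N%:R <= X ->
  `|\int[mu]_(t in `[1, T]) (dir_re t * (w * cos (t * ln X)) - dir_im t * (w * sin (t * ln X)))| <=
  8 * `|w| * B * harm R N.
Proof.
move=> NX.
have -> : \int[mu]_(t in `[1, T]) (dir_re t * (w * cos (t * ln X)) - dir_im t * (w * sin (t * ln X))) =
    w * \sum_(1 <= n < N.+1) A n * Kcos T (ln X - ln n%:R).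
  transitivity (\int[mu]_(t in `[1, T]) (w * \sum_(1 <= n < N.+1) A n * cos (t * (ln X - ln n%:R)))).
    by apply: eq_Rint => t _; rewrite -dir_cos; ring.
  have cc n : continuous (fun t : R => A n * cos (t * (ln X - ln n%:R))).
    by apply: contM; [exact: cont_cst|exact: continuous_cosM].
  rewrite RintZ; last exact: cont_sum.
  rewrite Rint_sum//; congr (_ * _); apply: eq_bigr => n _.
  by rewrite RintZ//; exact: continuous_cosM.
rewrite normrM.
have H : `|\sum_(1 <= n < N.+1) A n * Kcos T (ln X - ln n%:R)| <= B * 2 * (4 * harm R N).
  apply: le_trans (@kernel_sum R A (fun n => `|Kcos T (ln X - ln n%:R)|) N B 2 T X N0 NX B0 _ TN HA _) => //.
    apply: (le_trans (ler_norm_sum _ _ _)); apply: ler_sum_nat => n nI.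
    by have /andP[a0 _] := HA nI; rewrite normrM (ger0_norm a0).
  move=> n /andP[n0 nN]; split.
    by rewrite normr_ge0/=; apply: (le_trans (Kcos_le _ T1)); move: T1; lra.
  apply: le_trans (Kcos_mul_le (ln X - ln n%:R) T1).
  by rewrite ler_wpM2r// ler_norm.
by apply: (le_trans (ler_wpM2l (normr_ge0 w) H)); lra.
Qed.

Lemma msq_cross_tail (X : R) (f c s : R -> R) : N%:R <= X -> measurable_fun setT f ->
  mu.-integrable `[X, +oo[ (EFin \o f) ->
  (forall t, c t = \int[mu]_(x in `[X, +oo[) (f x * cos (t * ln x))) ->
  (forall t, s t = \int[mu]_(x in `[X, +oo[) (f x * sin (t * ln x))) ->
  `|\int[mu]_(t in `[1, T]) (dir_re t * (sg * c t + t * s t) + dir_im t * (t * c t - sg * s t))| <=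
  24 * B * T * harm R N * \int[mu]_(x in `[X, +oo[) `|f x|.
Proof.
set D := [set` `[X, +oo[]; move=> NX mf fi cE sE.
have mD : measurable (D : set R) by exact: measurable_itv.
have mJ : measurable ([set` `[1, T]] : set R) by exact: measurable_itv.
pose S (t w : R) := \sum_(1 <= n < N.+1) A n *
  (sg * cos (t * (w - ln n%:R)) + t * sin (t * (w - ln n%:R))).
have SE t w : S t w = dir_re t * (sg * cos (t * w) + t * sin (t * w)) +
    dir_im t * (t * cos (t * w) - sg * sin (t * w)).
  transitivity (sg * (dir_re t * cos (t * w) - dir_im t * sin (t * w)) + t * (dir_re t * sin (t * w) + dir_im t * cos (t * w))); last by ring.
  rewrite dir_cos dir_sin !mulr_sumr -big_split/=; apply: eq_bigr => n _; ring.
pose F (z : R * R) := f z.2 * S z.1 (ln z.2).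
have bnd (g : R -> R) : measurable_fun setT g -> (forall x, `|g x| <= 1) ->
    mu.-integrable D (EFin \o (fun x => f x * g x)).
  move=> mg g1; apply: (integrable_le mD _ _ (@integrable_norm _ _ _ mu D _ fi)).
    exact: measurable_funM.
  by move=> x _ /=; rewrite normrM ler_piMr.
have mln (h : R -> R) (t : R) : measurable_fun setT h -> measurable_fun setT (fun x => h (t * ln x)).
  move=> mh; apply: (@mfun_comp _ _ _ h) => //; exact: measurable_funM.
have icos t : mu.-integrable D (EFin \o (fun x => f x * cos (t * ln x))).
  by apply: bnd => [|x]; [exact: (mln _ _ (@measurable_cos R))|exact: cos_max].
have isin t : mu.-integrable D (EFin \o (fun x => f x * sin (t * ln x))).
  by apply: bnd => [|x]; [exact: (mln _ _ (@measurable_sin R))|exact: sin_max].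
have inner t : dir_re t * (sg * c t + t * s t) + dir_im t * (t * c t - sg * s t) =
    \int[mu]_(x in D) F (t, x).
  transitivity (\int[mu]_(x in D) ((sg * dir_re t + t * dir_im t) * (f x * cos (t * ln x)) +
     (t * dir_re t - sg * dir_im t) * (f x * sin (t * ln x)))).
    rewrite (@RintegralD _ _ _ mu D)//; last first.
    - exact: (@integrableZl _ _ _ mu D mD _ _ (isin t)).
    - exact: (@integrableZl _ _ _ mu D mD _ _ (icos t)).
    rewrite !(@RintegralZl _ _ _ mu D)// -cE -sE; ring.
  by apply: eq_Rintegral => x _; rewrite /F SE /=; ring.
have msnd : measurable_fun setT (fun z : R * R => ln z.2).
  by apply: (@mfun_comp _ _ _ (@ln R)); [exact: measurable_ln|exact: measurable_snd].
have mF : measurable_fun setT F.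
  apply: measurable_funM; first by apply: (@mfun_comp _ _ _ f) => //; exact: measurable_snd.
  apply: measurable_sum => n; apply: measurable_funM => //.
  have mw : measurable_fun setT (fun z : R * R => z.1 * (ln z.2 - ln n%:R)).
    by apply: measurable_funM; [exact: measurable_fst|exact: measurable_funB].
  apply: measurable_funD; apply: measurable_funM => //.
  - exact: (@mfun_comp _ _ _ _ _ (@measurable_cos R)).
  - exact: (@mfun_comp _ _ _ _ _ (@measurable_sin R)).
have h1 := harm_ge1 R N0.
have Bh : 0 <= B * harm R N by rewrite mulr_ge0// harm_ge0.
have Fle x y : `[1, T]%classic x -> D y -> `|F (x, y)| <= 2 * T * (B * harm R N) * `|f y|.
  rewrite /= in_itv/= => /andP[x1 xT] _; rewrite /F normrM mulrC ler_wpM2r//.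
  have -> : S x (ln y) = sg * (\sum_(1 <= n < N.+1) A n * cos (x * (ln y - ln n%:R))) +
      x * (\sum_(1 <= n < N.+1) A n * sin (x * (ln y - ln n%:R))).
    by rewrite !mulr_sumr -big_split/=; apply: eq_bigr => n _; ring.
  have b1 := dir_sum_le (fun n => cos_max (x * (ln y - ln n%:R))).
  have b2 := dir_sum_le (fun n => sin_max (x * (ln y - ln n%:R))).
  apply: (le_trans (ler_normD _ _)); rewrite !normrM.
  have /andP[s0 s1] := sg01.
  have T0 : 0 <= T by lra.
  apply: (@le_trans _ _ (1 * (B * harm R N) + T * (B * harm R N))).
    apply: lerD; apply: ler_pM => //; rewrite ger0_norm//; lra.
  by rewrite -mulrDl ler_wpM2r//; move: T1; lra.
have inner2 x : \int[mu]_(t in `[1, T]) F (t, x) =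
    f x * \sum_(1 <= n < N.+1) A n * Kmix sg T (ln x - ln n%:R).
  have cc n : continuous (fun t : R => A n * (sg * cos (t * (ln x - ln n%:R)) + t * sin (t * (ln x - ln n%:R)))).
    by apply: contM; [exact: cont_cst|exact: continuous_mix].
  rewrite /F /= RintZ; last exact: cont_sum.
  rewrite Rint_sum//; congr (_ * _); apply: eq_bigr => n _.
  by rewrite RintZ//; exact: continuous_mix.
have mK : measurable_fun setT (Kmix sg T).
  apply: (measurableT_comp (@fine_measurable R setT measurableT)).
  apply: (@measurable_integral_param _ _ (fun z => sg * cos (z.2 * z.1) + z.2 * sin (z.2 * z.1))) => //.
  have mw : measurable_fun setT (fun z : R * R => z.2 * z.1).
    by apply: measurable_funM; [exact: measurable_snd|exact: measurable_fst].
  apply: measurable_funD; apply: measurable_funM => //.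
  - exact: (@mfun_comp _ _ _ _ _ (@measurable_cos R)).
  - exact: (@mfun_comp _ _ _ _ _ (@measurable_sin R)).
pose G x := f x * \sum_(1 <= n < N.+1) A n * Kmix sg T (ln x - ln n%:R).
have mG : measurable_fun setT G.
  apply: measurable_funM => //; apply: measurable_sum => n; apply: measurable_funM => //.
  apply: (@mfun_comp _ _ _ _ _ mK); apply: measurable_funB => //; exact: measurable_ln.
have GE : \int[mu]_(t in `[1, T]) (dir_re t * (sg * c t + t * s t) + dir_im t * (t * c t - sg * s t)) =
    \int[mu]_(x in D) G x.
  transitivity (\int[mu]_(t in `[1, T]) \int[mu]_(x in D) F (t, x)).
    by apply: eq_Rintegral => t _; exact: inner.
  rewrite (@fubini_box R _ D mJ mD F _ f mF (lebesgue_itvcc_lty 1 T) fi Fle).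
  by apply: eq_Rintegral => x _; exact: inner2.
have Gle x : D x -> `|G x| <= 24 * B * T * harm R N * `|f x|.
  rewrite /D /= in_itv/= andbT => Xx.
  have NX' : N%:R <= x := le_trans NX Xx.
  have c0 : 0 <= 6 * T by move: T1; lra.
  rewrite /G normrM mulrC ler_wpM2r//.
  have H := @kernel_sum R A (fun n => `|Kmix sg T (ln x - ln n%:R)|) N B (6 * T) T x N0 NX' B0 c0 TN HA _.
  apply: (@le_trans _ _ (B * (6 * T) * (4 * harm R N))); last by lra.
  apply: le_trans (H _).
    apply: (le_trans (ler_norm_sum _ _ _)); apply: ler_sum_nat => n nI.
    by have /andP[a0 _] := HA nI; rewrite normrM (ger0_norm a0).
  move=> n /andP[n0 nN]; split; first by rewrite normr_ge0/= Kmix_le.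
  apply: le_trans (Kmix_mul_le (ln x - ln n%:R) T1 sg01).
  by rewrite ler_wpM2r// ler_norm.
have ifn := @integrable_norm _ _ _ mu D _ fi.
have iGh : mu.-integrable D (EFin \o (fun x => 24 * B * T * harm R N * `|f x|)).
  exact: (@integrableZl _ _ _ mu D mD _ _ ifn).
have iG := integrable_le mD mG Gle iGh.
rewrite GE; apply: (le_trans (@le_normr_Rintegral _ _ _ mu D _ mD iG)).
rewrite -(@RintegralZl _ _ _ mu D)//.
apply: (@le_Rintegral _ _ _ mu D) => //.
exact: (@integrable_norm _ _ _ mu D _ iG).
Qed.

End DirichletMeanSquare.

Section MeanSquare.
Variable R : realType.
Notation mu := (@lebesgue_measure R).

(* A majorant of 1 / t on [1, +oo[ which is continuous on the whole line and bounded by 1. *)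
Definition recip (t : R) : R := 2 * t / (1 + t ^+ 2).

Lemma recip_denom_gt0 (t : R) : 0 < 1 + t ^+ 2.
Proof. by rewrite ltr_pwDl// sqr_ge0. Qed.

Lemma continuous_recip : continuous recip.
Proof.
apply: contM; first by apply: contM; [exact: cont_cst|exact: cont_id].
have cd : continuous (fun t : R => 1 + t ^+ 2).
  by apply: contD; [exact: cont_cst|exact: (@continuous_sqr R id (@cont_id R))].
by move=> t; apply: cvgV; [rewrite gt_eqF// recip_denom_gt0|exact: cd].
Qed.

Lemma recip_bounds (t : R) : 1 <= t -> t^-1 <= recip t <= 1.
Proof.
move=> t1; have t0 : 0 < t by lra.
have d := recip_denom_gt0 t; rewrite /recip; apply/andP; split.
  by rewrite ler_pdivlMr// mulrC ler_pdivrMr//; nra.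
by rewrite ler_pdivrMr//; nra.
Qed.

Lemma recip_int (T : R) : 1 <= T -> 0 <= \int[mu]_(t in `[1, T]) recip t <= ln (1 + T ^+ 2).
Proof.
move=> T1.
have d (x : R) : is_derive x (1 : R) (fun t => ln (1 + t ^+ 2)) (recip x).
  have d1 : is_derive x (1 : R) (fun t : R => 1 + t ^+ 2) (2 * x).
    have -> : (fun t : R => 1 + t ^+ 2) = (fun t => 1 + t * t) by apply/funext => t; rewrite expr2.
    have dx := is_derive_id x (1 : R).
    apply: is_derive_eq (is_deriveD (is_derive_cst (1 : R) x (1 : R)) (is_deriveM dx dx)) _.
    by rewrite /GRing.scale /=; ring.
  have d2 := is_derive1_ln (recip_denom_gt0 x).
  apply: is_derive_eq (@is_derive1_comp _ (@ln R) (fun t : R => 1 + t ^+ 2) x _ _ d2 d1) _.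
  by rewrite /recip mulrC.
rewrite (@FTC_derive R recip (fun t => ln (1 + t ^+ 2)) 1 T T1 (fun x _ => d x) (fun x _ => @continuous_recip x)).
rewrite subr_ge0 ler_ln ?posrE ?recip_denom_gt0// lerD2l expr1n exprn_ege1//=.
by rewrite gerBl// ln_ge0// lerDl.
Qed.

Variables (A : nat -> R) (N : nat) (B T sg : R).
Hypotheses (N0 : (0 < N)%N) (T1 : 1 <= T) (TN : T <= 2 * N%:R) (B0 : 0 <= B).
Hypotheses (sg01 : 0 <= sg <= 1).
Hypothesis HA : forall n, (0 < n <= N)%N -> 0 <= A n <= B / n%:R.
Variables (X w G Q : R) (f c s b1 b2 Z : R -> R).
Hypotheses (X1 : 1 <= X) (NX : N%:R <= X) (G0 : 0 <= G) (mf : measurable_fun setT f).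
Hypothesis fi : mu.-integrable `[X, +oo[ (EFin \o f).
Hypothesis fQ : (\int[mu]_(x in `[X, +oo[) (f x ^+ 2 * x `^ 1)%:E <= Q%:E)%E.
Hypothesis cE : forall t, c t = \int[mu]_(x in `[X, +oo[) (f x * cos (t * ln x)).
Hypothesis sE : forall t, s t = \int[mu]_(x in `[X, +oo[) (f x * sin (t * ln x)).
Hypotheses (cc : continuous c) (cs : continuous s) (cb1 : continuous b1) (cb2 : continuous b2).
Hypothesis bG : forall t, 1 <= t <= T -> `|b1 t| <= G / t /\ `|b2 t| <= G / t.
Hypothesis ZE : forall t, 1 <= t <= T -> Z t =
  (dir_re A N t + b1 t + w * cos (t * ln X) + (sg * c t + t * s t)) ^+ 2 +
  (dir_im A N t + b2 t - w * sin (t * ln X) + (t * c t - sg * s t)) ^+ 2.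

Let h := harm R N.
Let L := ln (1 + T ^+ 2).

Lemma mean_square_tail : \int[mu]_(t in `[1, T]) (c t ^+ 2 + s t ^+ 2) <= 6 * pi * Q.
Proof.
have T0 : 0 < T by move: T1; lra.
have [cE' sE'] : (fun t => \int[mu]_(x in `[X, +oo[) (f x * cos (t * ln x))) = c /\
   (fun t => \int[mu]_(x in `[X, +oo[) (f x * sin (t * ln x))) = s.
  by split; apply/funext => t; rewrite ?cE ?sE.
have := bessel X1 T0 mf fi fQ; rewrite /= cE' sE' => /(_ cc cs) H.
have {H} : \int[mu]_(t in `[0, T]) (c t ^+ 2 + s t ^+ 2) <= 6 * pi * Q.
  by move: H; congr (_ <= _); apply: eq_Rint => t _; rewrite cE sE.
apply: le_trans.
have cq : continuous (fun t : R => c t ^+ 2 + s t ^+ 2) by apply: contD; exact: continuous_sqr.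
have fin a : (\int[mu]_(t in `[a, T]) (c t ^+ 2 + s t ^+ 2)%:E)%E \is a fin_num.
  by apply: (@integrable_fin_num _ _ _ mu `[a, T]%classic) => //; exact: cont_int.
rewrite /Rintegral fine_le//; apply: ge0_subset_integral => //.
- by apply/measurable_EFinP; apply: measurable_funTS; exact: continuous_measurable_fun.
- by move=> t _; rewrite lee_fin addr_ge0// sqr_ge0.
- by move=> t /=; rewrite !in_itv/= => /andP[t1 ->]; rewrite andbT; lra.
Qed.

Lemma mean_square_cross_main :
  `|\int[mu]_(t in `[1, T]) (dir_re A N t * b1 t + dir_im A N t * b2 t)| <= 2 * (B * h) * G * L.
Proof.
have Bh : 0 <= B * h by rewrite mulr_ge0// harm_ge0.
have cd1 := @continuous_dir_re R A N; have cd2 := @continuous_dir_im R A N.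
apply: (@le_trans _ _ (\int[mu]_(t in `[1, T]) (2 * (B * h) * G * recip t))).
  apply: Rint_norm_le.
  - by apply: contD; apply: contM.
  - by apply: contM; [exact: cont_cst|exact: continuous_recip].
  move=> t tI; have [g1 g2] := bG tI; have /andP[t1 _] := tI.
  have /andP[r1 _] := recip_bounds t1.
  have gr : G / t <= G * recip t by rewrite ler_wpM2l.
  have -> : 2 * (B * h) * G * recip t = B * h * (G * recip t) + B * h * (G * recip t) by ring.
  apply: (le_trans (ler_normD _ _)); rewrite !normrM.
  apply: lerD; apply: ler_pM => //.
  - exact: dir_re_le.
  - exact: le_trans gr.
  - exact: dir_im_le.
  - exact: le_trans gr.
rewrite RintZ; last exact: continuous_recip.
rewrite ler_wpM2l//; first by rewrite mulr_ge0// mulr_ge0.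
by have /andP[] := recip_int T1.
Qed.

Let rest t := (b1 t + w * cos (t * ln X) + (sg * c t + t * s t)) ^+ 2 +
  (b2 t - w * sin (t * ln X) + (t * c t - sg * s t)) ^+ 2.

Lemma continuous_e1 : continuous (fun t : R => sg * c t + t * s t).
Proof. by apply: contD; apply: contM => //; [exact: cont_cst|exact: cont_id]. Qed.

Lemma continuous_e2 : continuous (fun t : R => t * c t - sg * s t).
Proof.
apply: contD; first by apply: contM => //; exact: cont_id.
by apply: contN; apply: contM => //; exact: cont_cst.
Qed.

Lemma continuous_w1 : continuous (fun t : R => w * cos (t * ln X)).
Proof. by apply: contM; [exact: cont_cst|exact: continuous_cosM]. Qed.

Lemma continuous_w2 : continuous (fun t : R => w * sin (t * ln X)).
Proof. by apply: contM; [exact: cont_cst|exact: continuous_sinM]. Qed.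

Lemma continuous_rest : continuous rest.
Proof.
apply: contD; apply: continuous_sqr; apply: contD; first last.
- exact: continuous_e2.
- by apply: contD => //; apply: contN; exact: continuous_w2.
- exact: continuous_e1.
- by apply: contD => //; exact: continuous_w1.
Qed.

Lemma mean_square_rest : 0 <= \int[mu]_(t in `[1, T]) rest t <=
  6 * G ^+ 2 * L + 3 * T * w ^+ 2 + 36 * pi * T ^+ 2 * Q.
Proof.
have crest := continuous_rest.
rewrite Rintegral_ge0/=; last by move=> t _; rewrite addr_ge0// sqr_ge0.
pose q t := c t ^+ 2 + s t ^+ 2.
have cq : continuous q by apply: contD; exact: continuous_sqr.
apply: (@le_trans _ _ (\int[mu]_(t in `[1, T]) (6 * G ^+ 2 * recip t + 3 * w ^+ 2 + 6 * T ^+ 2 * q t))).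
  apply: Rint_le => //.
    apply: contD; last by apply: contM => //; exact: cont_cst.
    by apply: contD; [apply: contM; [exact: cont_cst|exact: continuous_recip]|exact: cont_cst].
  move=> t tI; have [g1 g2] := bG tI; have /andP[t1 tT] := tI.
  have /andP[r1 r2] := recip_bounds t1.
  have t0 : 0 < t by lra.
  have gr : (G / t) ^+ 2 <= G ^+ 2 * recip t.
    rewrite exprMn ler_wpM2l ?sqr_ge0// (le_trans _ r1)// expr2 ler_piMl ?invr_ge0 ?(ltW t0)//.
    by rewrite invf_le1.
  have g1' : b1 t ^+ 2 <= G ^+ 2 * recip t.
    by apply: le_trans gr; rewrite -[b1 t ^+ 2]real_normK ?num_real// lerXn2r ?nnegrE// divr_ge0// ltW.
  have g2' : b2 t ^+ 2 <= G ^+ 2 * recip t.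
    by apply: le_trans gr; rewrite -[b2 t ^+ 2]real_normK ?num_real// lerXn2r ?nnegrE// divr_ge0// ltW.
  have sq3 (x y z : R) : (x + y + z) ^+ 2 <= 3 * x ^+ 2 + 3 * y ^+ 2 + 3 * z ^+ 2.
    by have := sqr_ge0 (x - y); have := sqr_ge0 (y - z); have := sqr_ge0 (x - z); rewrite !sqrrB; nra.
  have /andP[s0 s1] := sg01.
  have e12 : (sg * c t + t * s t) ^+ 2 + (t * c t - sg * s t) ^+ 2 <= 2 * T ^+ 2 * q t.
    have -> : (sg * c t + t * s t) ^+ 2 + (t * c t - sg * s t) ^+ 2 = (sg ^+ 2 + t ^+ 2) * q t by rewrite /q; ring.
    rewrite ler_wpM2r ?addr_ge0 ?sqr_ge0//.
    by nra.
  have w12 : (w * cos (t * ln X)) ^+ 2 + (- (w * sin (t * ln X))) ^+ 2 = w ^+ 2.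
    by rewrite sqrrN !exprMn -mulrDr cos2Dsin2 mulr1.
  have k1 := sq3 (b1 t) (w * cos (t * ln X)) (sg * c t + t * s t).
  have k2 := sq3 (b2 t) (- (w * sin (t * ln X))) (t * c t - sg * s t).
  rewrite /rest; lra.
rewrite RintD; last first.
- by apply: contM => //; exact: cont_cst.
- by apply: contD; [apply: contM; [exact: cont_cst|exact: continuous_recip]|exact: cont_cst].
rewrite RintD; last first.
- exact: cont_cst.
- by apply: contM; [exact: cont_cst|exact: continuous_recip].
rewrite RintZ; last exact: continuous_recip.
rewrite (RintZ _ _ _ cq).
have k1 : \int[mu]_(t in `[1, T]) (3 * w ^+ 2) <= 3 * T * w ^+ 2.
  apply: (le_trans (ler_norm _)).
  have ic : mu.-integrable `[1, T] (EFin \o (fun _ : R => 3 * w ^+ 2)) by apply: cont_int; exact: cont_cst.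
  apply: (le_trans (Rintegral_bound (M := 3 * w ^+ 2) T1 ic _)).
    by move=> x _; rewrite ger0_norm// mulr_ge0// sqr_ge0.
  by have := sqr_ge0 w; move: T1; nra.
have k2 : 6 * T ^+ 2 * \int[mu]_(t in `[1, T]) q t <= 36 * pi * T ^+ 2 * Q.
  rewrite [leRHS](_ : _ = 6 * T ^+ 2 * (6 * pi * Q)); last by ring.
  by rewrite ler_wpM2l ?mean_square_tail// mulr_ge0// sqr_ge0.
have k3 : 6 * G ^+ 2 * \int[mu]_(t in `[1, T]) recip t <= 6 * G ^+ 2 * L.
  by rewrite ler_wpM2l ?mulr_ge0 ?sqr_ge0//; have /andP[] := recip_int T1.
lra.
Qed.

Lemma mean_square_bound :
  `|\int[mu]_(t in `[1, T]) Z t - T * \sum_(1 <= n < N.+1) A n ^+ 2| <=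
  5 * B ^+ 2 * h ^+ 2 + 16 * `|w| * B * h +
  48 * B * T * h * \int[mu]_(x in `[X, +oo[) `|f x| + 4 * (B * h) * G * L +
  (6 * G ^+ 2 * L + 3 * T * w ^+ 2 + 36 * pi * T ^+ 2 * Q).
Proof.
have cd1 := @continuous_dir_re R A N; have cd2 := @continuous_dir_im R A N.
pose p0 t := dir_re A N t ^+ 2 + dir_im A N t ^+ 2.
pose p1 t := dir_re A N t * (w * cos (t * ln X)) - dir_im A N t * (w * sin (t * ln X)).
pose p2 t := dir_re A N t * (sg * c t + t * s t) + dir_im A N t * (t * c t - sg * s t).
pose p3 t := dir_re A N t * b1 t + dir_im A N t * b2 t.
have c0 : continuous p0 by apply: contD; exact: continuous_sqr.
have c1 : continuous p1.
  apply: contD; first by apply: contM => //; exact: continuous_w1.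
  by apply: contN; apply: contM => //; exact: continuous_w2.
have c2 : continuous p2.
  by apply: contD; apply: contM => //; [exact: continuous_e1|exact: continuous_e2].
have c3 : continuous p3 by apply: contD; apply: contM.
have E : \int[mu]_(t in `[1, T]) Z t = \int[mu]_(t in `[1, T]) p0 t +
    2 * \int[mu]_(t in `[1, T]) p1 t + 2 * \int[mu]_(t in `[1, T]) p2 t +
    2 * \int[mu]_(t in `[1, T]) p3 t + \int[mu]_(t in `[1, T]) rest t.
  have cr := continuous_rest.
  have z1 : continuous (fun t : R => 2 * p1 t) by apply: contM => //; exact: cont_cst.
  have z2 : continuous (fun t : R => 2 * p2 t) by apply: contM => //; exact: cont_cst.
  have z3 : continuous (fun t : R => 2 * p3 t) by apply: contM => //; exact: cont_cst.
  have y1 := contD c0 z1; have y2 := contD y1 z2; have y3 := contD y2 z3.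
  rewrite -!RintZ// -!RintD//; apply: eq_Rint => t tI.
  by rewrite ZE// /p0 /p1 /p2 /p3 /rest; ring.
have k0 := msq_dir N0 T1 B0 HA.
have k1 := msq_cross_cst N0 T1 TN B0 HA w NX.
have k2 := msq_cross_tail N0 T1 TN B0 sg01 HA NX mf fi cE sE.
have k3 := mean_square_cross_main.
have /andP[k4 k5] := mean_square_rest.
move: k0 k1 k2 k3; rewrite -/h -/(p0 _); rewrite !ler_norml => /andP[k0 k0'] /andP[k1 k1'] /andP[k2 k2'] /andP[k3 k3'].
rewrite E; apply/andP; split; lra.
Qed.

End MeanSquare.

(** * The error term *)

Section DeltaMeanSquare.
Variable R : realType.
Notation mu := (@lebesgue_measure R).
Variables (k : nat) (P : {poly R}).

Definition delta_msq (b C x0 : R) : Prop := forall x, x0 <= x ->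
  (\int[mu]_(y in `[1%R, x]) (Delta k P y ^+ 2)%:E <= (C * x `^ (1 + 2 * b))%:E)%E.

Lemma measurable_Delta2 : measurable_fun setT (fun x => Delta k P x ^+ 2).
Proof.
under eq_fun do rewrite expr2.
by apply: measurable_funM; exact: measurable_Delta.
Qed.

Lemma Delta2_le : exists2 D, 0 <= D & forall x y, 1 <= y <= x ->
  `|Delta k P y ^+ 2| <= D * x `^ (2 * 2).
Proof.
have [D D0 HD] := Delta_bound k P (@ltr01 R).
exists (D ^+ 2) => [|x y /andP[y1 yx]]; first exact: sqr_ge0.
have x0 : 0 < x by lra.
have -> : D ^+ 2 * x `^ (2 * 2) = (D * x `^ (1 + 1)) ^+ 2.
  by rewrite exprMn -[x `^ _ ^+ 2]powR_mulrn ?powR_ge0// -powRrM.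
rewrite normrX lerXn2r ?nnegrE ?mulr_ge0 ?powR_ge0 ?(ltW D0)//.
apply: (le_trans (HD y y1)); rewrite ler_wpM2l ?(ltW D0)//.
by apply: ge0_ler_powR; rewrite ?nnegrE//; lra.
Qed.

Lemma integrable_Delta2 (x : R) :
  mu.-integrable `[1, x] (EFin \o (fun y => Delta k P y ^+ 2)).
Proof.
have mI : measurable ([set` `[1, x]] : set R) by exact: measurable_itv.
have [D D0 HD] := Delta2_le.
apply: (integrable_le mI measurable_Delta2 (h := fun=> D * x `^ (2 * 2))); last first.
  by apply: cont_int; exact: cont_cst.
by move=> y /=; rewrite in_itv/=; exact: HD.
Qed.

Lemma vinogradov_delta_msq (b : R) :
  vinogradov (fun x : R => (\int[mu]_(y in `[1%R, x]) Delta k P y ^+ 2)%R)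
    (fun x : R => x `^ (1 + 2 * b)) ->
  exists C x0, [/\ 0 <= C, 1 <= x0 & delta_msq b C x0].
Proof.
move=> [C [M [_ H]]]; exists `|C|, (Num.max 1 (M + 1)); split => //; first by rewrite le_max lexx.
move=> x; rewrite ge_max => /andP[x1 xM].
rewrite -[leLHS]fineK; last exact: integrable_fin_num (integrable_Delta2 x).
rewrite lee_fin; apply: (le_trans (ler_norm _)).
apply: (le_trans (H x _)); first by lra.
rewrite (ger0_norm (powR_ge0 _ _)) ler_wpM2r ?powR_ge0//; exact: ler_norm.
Qed.

Variables (b C x0 : R).
Hypotheses (b0 : 0 <= b) (C0 : 0 <= C) (x01 : 1 <= x0) (Hd : delta_msq b C x0).

Lemma delta_msq_sub (X Z : R) : x0 <= X -> X <= Z ->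
  (\int[mu]_(x in `[X, Z]) (Delta k P x ^+ 2)%:E <= (C * Z `^ (1 + 2 * b))%:E)%E.
Proof.
move=> xX XZ; apply: le_trans (Hd (le_trans xX XZ)).
apply: ge0_subset_integral => //.
- by apply/measurable_EFinP; apply: measurable_funTS; exact: measurable_Delta2.
- by move=> t _; rewrite lee_fin sqr_ge0.
- by move=> t /=; rewrite !in_itv/= => /andP[t1 ->]; rewrite andbT; move: x01; lra.
Qed.

Lemma delta_sqr_tail (a : R) : 2 * b < a -> exists2 K, 0 <= K & forall X, x0 <= X ->
  (\int[mu]_(x in `[X, +oo[) (Delta k P x ^+ 2 * x `^ (- (1 + a)))%:E <= (K * X `^ (2 * b - a))%:E)%E.
Proof.
move=> ba; have [||K K0 H] := @dyadic_bound R (1 + 2 * b) (1 + a).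
- by rewrite addr_ge0// mulr_ge0.
- by rewrite ltrD2l.
exists (K * C) => [|X xX]; first by rewrite mulr_ge0// ltW.
apply: le_trans (H (fun x => Delta k P x ^+ 2) C X _ measurable_Delta2 _ C0 _) _.
- by move=> x; exact: sqr_ge0.
- by move: x01; lra.
- by move=> Z; exact: delta_msq_sub.
by rewrite opprD addrACA subrr add0r.
Qed.

Lemma delta_msq_tail_bounded : tail_bounded k P b x0.
Proof.
move=> a ba; have [|K K0 H] := @delta_sqr_tail (a + b); first by move: ba; lra.
have [||K' K'0 H'] := @dyadic_bound R 1 (1 + (a - b)) => //.
  by move: ba; lra.
exists (K + K') => [|X xX]; first by rewrite ltr_wpDl.
have X0 : 0 < X by move: x01; lra.
have mD : measurable ([set` `[X, +oo[] : set R) by exact: measurable_itv.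
have g1 := H X xX.
have g2 := H' (fun=> 1) 1 X (fun=> ler01) (measurable_cst _) X0 ler01 _.
have {}g2 : (\int[mu]_(x in `[X, +oo[) (1 * x `^ (- (1 + (a - b))))%:E <= (K' * 1 * X `^ (1 - (1 + (a - b))))%:E)%E.
  apply: g2 => Z XZ; rewrite integral_cst//= mul1e lebesgue_measure_itv/= lte_fin.
  rewrite powRr1; last by lra.
  by case: ifPn => _; rewrite -?EFinD lee_fin; lra.
have e1 : 2 * b - (a + b) = b - a by ring.
have e2 : 1 - (1 + (a - b)) = b - a by ring.
rewrite e1 in g1; rewrite e2 mulr1 in g2.
rewrite mulrDl EFinD; apply: le_trans (leeD g1 g2).
rewrite -ge0_integralD//=; last first.
- by apply/measurable_EFinP; apply: measurable_funTS; apply: measurable_funM; [exact: measurable_cst|exact: measurable_powRx].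
- by move=> x _; rewrite lee_fin mul1r powR_ge0.
- apply/measurable_EFinP; apply: measurable_funTS; apply: measurable_funM; [exact: measurable_Delta2|exact: measurable_powRx].
- by move=> x _; rewrite lee_fin mulr_ge0 ?sqr_ge0 ?powR_ge0.
apply: ge0_le_integral => //=.
- by move=> x _; rewrite lee_fin mulr_ge0 ?powR_ge0.
- apply/measurable_EFinP; apply: measurable_funTS; apply: measurable_funM; last exact: measurable_powRx.
  by apply: measurableT_comp => //; exact: measurable_DeltaV.
- apply: emeasurable_funD; apply/measurable_EFinP; apply: measurable_funTS; apply: measurable_funM;
    [exact: measurable_Delta2|exact: measurable_powRx|exact: measurable_cst|exact: measurable_powRx].
move=> x; rewrite in_itv/= andbT => Xx; rewrite -EFinD lee_fin.
have xp : 0 < x by lra.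
rewrite mul1r normrM normfV (gtr0_norm xp) -powR_inv1 ?(ltW xp)//.
set d := `|_|; have -> : Delta k P x ^+ 2 = d ^+ 2 by rewrite real_normK ?num_real.
set u := x `^ (- b); set v := x `^ b; set z := x `^ (-1) * x `^ (- a).
have uv : u * v = 1 by rewrite -powRD_pos// addNr powRr0.
have u0 : 0 < u by exact: powR_gt0.
have v0 : 0 < v by exact: powR_gt0.
have z0 : 0 <= z by rewrite mulr_ge0 ?powR_ge0.
have -> : x `^ (- (1 + (a + b))) = z * u.
  by rewrite /z /u -!powRD_pos//; congr (_ `^ _); ring.
have -> : x `^ (- (1 + (a - b))) = z * v.
  by rewrite /z /v -!powRD_pos//; congr (_ `^ _); ring.
rewrite -mulrA -/z.
have -> : d ^+ 2 * (z * u) + z * v = (d ^+ 2 * u + v) * z by ring.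
rewrite ler_wpM2r//.
(* AM-GM *)
have h : 0 <= u * (d - v) ^+ 2 by rewrite mulr_ge0 ?sqr_ge0// ltW.
have h2 : u * (d - v) ^+ 2 = d ^+ 2 * u - 2 * d * (u * v) + (u * v) * v by ring.
have d0 : 0 <= d by exact: normr_ge0.
rewrite uv in h2; lra.
Qed.

(* Otherwise the mean square of Delta over [Y, 2 Y] would be too large. *)
Lemma delta_small (Y : R) : x0 <= Y -> exists2 X, Y <= X <= 2 * Y &
  Delta k P X ^+ 2 <= (C * 2 `^ (1 + 2 * b) + 1) * Y `^ (2 * b).
Proof.
move=> xY; have Y0 : 0 < Y by move: x01; lra.
set C' := C * _ + 1; have C'0 : 0 < C' by rewrite /C' ltr_wpDl// mulr_ge0 ?powR_ge0.
apply: contrapT => nX.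
have big X : Y <= X <= 2 * Y -> C' * Y `^ (2 * b) <= Delta k P X ^+ 2.
  by move=> XI; rewrite leNgt; apply/negP => h; apply: nX; exists X => //; exact: ltW.
have Y2 : Y <= 2 * Y by lra.
have := delta_msq_sub xY Y2; apply/negP; rewrite -ltNge.
apply: (@lt_le_trans _ _ (\int[mu]_(x in `[Y, (2 * Y)%R]) (C' * Y `^ (2 * b))%:E)%E); last first.
  apply: ge0_le_integral => //=.
  - by move=> x _; rewrite lee_fin mulr_ge0 ?powR_ge0// ltW.
  - by apply/measurable_EFinP; apply: measurable_funTS; exact: measurable_Delta2.
rewrite integral_cst//= lebesgue_measure_itv/= lte_fin ifT; last by lra.
rewrite -EFinD -EFinM lte_fin powRM ?(ltW Y0)//.
have -> : 2 * Y - Y = Y by ring.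
rewrite [Y `^ (1 + _)]powRD_pos// powRr1 ?(ltW Y0)//.
have : 0 < Y * Y `^ (2 * b) by rewrite mulr_gt0// powR_gt0.
rewrite /C'; set t := Y `^ _; set p := 2 `^ _ => h.
have -> : C * (p * (Y * t)) = C * p * (Y * t) by ring.
have -> : (C * p + 1) * t * Y = C * p * (Y * t) + Y * t by ring.
lra.
Qed.

End DeltaMeanSquare.

Section Decomposition.
Variable R : realType.
Notation mu := (@lebesgue_measure R).

Definition main_term (P : {poly R}) (X : R) (s : R[i]) : R[i] :=
  cexp ((1 - s) * (ln X)%:C) * (rpol P s (ln X) - (P.[ln X])%:C).

Lemma main_term_bound (P : {poly R}) (sg e : R) : 0 < e -> 0 <= sg <= 1 ->
  exists2 C, 0 < C & forall X t, 1 <= X -> 1 <= t ->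
    normc (main_term P X (sg +i* t)) <= C * X `^ (1 - sg + e) / t.
Proof.
move=> e0 /andP[s0 s1]; have [C C0 H] := derivs_ln_bound P (size P) e0.
exists (2 * C) => [|X t X1 t1]; first by rewrite mulr_gt0.
have X0 : 0 < X by lra.
have t0 : 0 < t by lra.
set s := sg +i* t; set u := ln X.
rewrite /main_term normcM normc_cexp_lnM//=.
have s10 : s - 1 != 0.
  by rewrite subr_eq0 /s eq_complex /= negb_and (gt_eqF t0) orbT.
have n1 : normc (1 : R[i]) = 1 by rewrite -[1 in LHS]/(1%:C) normcC normr1.
have nV : normc (s - 1)^-1 <= t^-1.
  have E : normc (s - 1)^-1 * normc (s - 1) = 1.
    by rewrite -normcM mulVf.
  have tl : t <= normc (s - 1).
    by have := normc_Im (s - 1); rewrite /s /= subr0 ger0_norm// ltW.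
  have n0 : 0 < normc (s - 1) by lra.
  have -> : normc (s - 1)^-1 = (normc (s - 1))^-1.
    by apply: (mulIf (lt0r_neq0 n0)); rewrite E mulVf// gt_eqF.
  by rewrite lef_pV2.
have t1' : t^-1 <= 1 by rewrite invf_le1.
have nV0 := normc_ge0 (s - 1)^-1.
have nX n : normc ((s - 1)^-1 ^+ n.+1) <= t^-1.
  elim: n => [|n IH]; first by rewrite expr1.
  by rewrite exprS normcM (le_trans _ IH)// ler_piMl ?normc_ge0//; lra.
have sV : s / (s - 1) = 1 + (s - 1)^-1 by field.
have key j : normc (s / (s - 1) ^+ j.+1 - (j == 0)%:R) <= 2 * t^-1.
  case: j => [|j]; first by rewrite expr1 sV addrAC subrr add0r; lra.
  have -> : s / (s - 1) ^+ j.+2 - (j.+1 == 0)%:R = (1 + (s - 1)^-1) * (s - 1)^-1 ^+ j.+1.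
    by rewrite subr0 -sV exprS invfM mulrA exprVn.
  rewrite normcM; apply: ler_pM; rewrite ?normc_ge0//.
  by apply: (le_trans (le_normcD _ _)); rewrite n1; lra.
have rE : rpol P s u - (P.[u])%:C = \sum_(j < size P) (P^`(j).[u])%:C * (s / (s - 1) ^+ j.+1 - (j == 0 :> nat)%:R).
  rewrite /rpol [RHS](eq_bigr (fun j : 'I_(size P) => (P^`(j).[u])%:C * (s / (s - 1) ^+ j.+1) - (P^`(j).[u])%:C * (j == 0 :> nat)%:R)); last first.
    by move=> j _; rewrite mulrBr.
  rewrite sumrB; congr (_ - _).
  case E : (size P) => [|n].
    by rewrite big_ord0; move/eqP: E; rewrite size_poly_eq0 => /eqP ->; rewrite horner0.
  by rewrite big_ord_recl/= mulr1 big1 ?addr0// => j _; rewrite mulr0.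
have rb : normc (rpol P s u - (P.[u])%:C) <= 2 * t^-1 * (C * X `^ e).
  rewrite rE; apply: (le_trans (normc_sum _ _ _)).
  apply: (@le_trans _ _ (\sum_(j < size P) `|P^`(j).[u]| * (2 * t^-1))).
    by apply: ler_sum => j _; rewrite normcM normcC ler_wpM2l.
  rewrite -mulr_suml mulrC ler_wpM2l// ?H//.
  by rewrite mulr_ge0// invr_ge0 ltW.
have -> : 2 * C * X `^ (1 - sg + e) / t = X `^ (1 - sg) * (2 * t^-1 * (C * X `^ e)).
  by rewrite powRD_pos//; ring.
by rewrite ler_wpM2l// powR_ge0.
Qed.

Variables (k : nat) (P : {poly R}).

Lemma zapprox_split (X : R) (s : R[i]) : 0 < X -> zapprox k P X s =
  dirpoly k X s + main_term P X s - (Delta k P X)%:C * cexp (- s * (ln X)%:C) + s * dtail k P X s.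
Proof.
move=> X0; rewrite /zapprox /main_term; congr (_ + _); rewrite -addrA; congr (_ + _).
have -> : cexp ((1 - s) * (ln X)%:C) = X%:C * cexp (- s * (ln X)%:C).
  rewrite mulrDl mul1r cexpD; congr (_ * _).
  by rewrite /cexp /= lnK ?posrE// cos0 sin0 mulr1.
rewrite /Delta -/(sumd k X) rmorphB rmorphM /=; ring.
Qed.

Lemma cexp_negM (sg t x : R) : 0 < x ->
  cexp (- (sg +i* t) * (ln x)%:C) =
  (x `^ (- sg) * cos (t * ln x)) +i* (- (x `^ (- sg) * sin (t * ln x))).
Proof.
move=> x0; have -> : - (sg +i* t) * (ln x)%:C = (- sg * ln x) +i* (- (t * ln x)).
  by apply/eqP; rewrite eq_complex /=; apply/andP; split; apply/eqP; ring.
rewrite /cexp /powR gt_eqF// [complex.Re _]/= [complex.Im _]/= cosN sinN.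
by apply/eqP; rewrite eq_complex /=; apply/andP; split; apply/eqP; ring.
Qed.

Definition dcoef (sg : R) (n : nat) : R := (divisor_fun k n)%:R * n%:R `^ (- sg).

Lemma dirpolyE (X sg t : R) : dirpoly k X (sg +i* t) =
  dir_re (dcoef sg) (Num.truncn X) t +i* dir_im (dcoef sg) (Num.truncn X) t.
Proof.
rewrite /dirpoly /dir_re /dir_im; set N := (Num.truncn X).+1.
have H (n0 n1 : nat) : (0 < n0)%N ->
   \sum_(n0 <= n < n1) (divisor_fun k n)%:R * cexp (- (sg +i* t) * (ln n%:R)%:C) =
   (\sum_(n0 <= n < n1) dcoef sg n * cos (t * ln n%:R)) +i* (- \sum_(n0 <= n < n1) dcoef sg n * sin (t * ln n%:R)).
  move=> n00; rewrite big_nat [in RHS]big_nat [X in _ +i* (- X)]big_nat.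
  elim/big_rec3 : _ => [|n x y z /andP[nn _] ->]; first by rewrite oppr0.
  have np : 0 < n%:R :> R by rewrite ltr0n (leq_trans n00).
  rewrite cexp_negM// /dcoef -(rmorph_nat (real_complex R)).
  by apply/eqP; rewrite eq_complex /=; apply/andP; split; apply/eqP; ring.
exact: H.
Qed.

Definition tailf (sg x : R) : R := Delta k P x / x * x `^ (- sg).

Lemma measurable_tailf (sg : R) : measurable_fun setT (tailf sg).
Proof. by apply: measurable_funM; [exact: measurable_DeltaV|exact: measurable_powRx]. Qed.

Lemma dtailE (X sg t : R) : 0 < X ->
  mu.-integrable `[X, +oo[ (EFin \o tailf sg) -> dtail k P X (sg +i* t) =
  (\int[mu]_(x in `[X, +oo[) (tailf sg x * cos (t * ln x))) +i*
  (- \int[mu]_(x in `[X, +oo[) (tailf sg x * sin (t * ln x))).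
Proof.
move=> X0 fi; rewrite /dtail.
rewrite (@eq_cint R _ _ (fun x => (tailf sg x * cos (t * ln x)) +i* (- (tailf sg x * sin (t * ln x))))); last first.
  move=> x; rewrite inE/= in_itv/= andbT => Xx; rewrite cexp_negM; last by lra.
  by apply/eqP; rewrite eq_complex /= /tailf; apply/andP; split; apply/eqP; ring.
rewrite /cint /=; congr (_ +i* _).
have mD : measurable ([set` `[X, +oo[] : set R) by exact: measurable_itv.
have msin : measurable_fun setT (fun x : R => sin (t * ln x)).
  by apply: (@mfun_comp _ _ _ _ _ (@measurable_sin R)); apply: measurable_funM => //; exact: measurable_ln.
have fs : mu.-integrable `[X, +oo[ (EFin \o (fun x => tailf sg x * sin (t * ln x))).
  apply: (integrable_le mD _ _ (@integrable_norm _ _ _ mu _ _ fi)).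
    by apply: measurable_funM => //; exact: measurable_tailf.
  by move=> x _ /=; rewrite normrM ler_piMr// sin_max.
rewrite -mulN1r -(@RintegralZl _ _ _ mu `[X, +oo[%classic)//.
by apply: eq_Rintegral => x _; rewrite mulN1r.
Qed.

End Decomposition.

Section Assembly.
Variable R : realType.
Notation mu := (@lebesgue_measure R).

(* To be read with W = X^(1 - sigma), E = X^e and V = X^(b - sigma). *)
Lemma combine_bounds (K W E V T h w F L : R) : 1 <= K -> 0 <= W -> 1 <= E -> 0 <= V ->
  V <= W -> 0 <= T -> T * V <= W -> 0 <= h <= K * E -> 0 <= w <= K * V ->
  0 <= F <= K * V -> 0 <= L <= K * E ->
  5 * (K * W * E) ^+ 2 * h ^+ 2 + 16 * w * (K * W * E) * h +
  48 * (K * W * E) * T * h * F + 4 * ((K * W * E) * h) * (K * W * E) * L +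
  (6 * (K * W * E) ^+ 2 * L + 3 * T * w ^+ 2 + 36 * pi * T ^+ 2 * (K * V ^+ 2)) <=
  (82 + 36 * pi) * (K ^+ 4 * (W ^+ 2 * E ^+ 4)).
Proof.
move=> K1 W0 E1 V0 VW T0 TV /andP[h0 hE] /andP[w0 wV] /andP[F0 FV] /andP[L0 LE].
set U := K ^+ 4 * (W ^+ 2 * E ^+ 4).
have [K0 E0] : 0 <= K /\ 0 <= E by split; lra.
have mono i j : (i <= 4)%N -> (j <= 4)%N -> K ^+ i * (W ^+ 2 * E ^+ j) <= U.
  move=> i4 j4; apply: ler_pM; rewrite ?mulr_ge0 ?exprn_ge0//.
    exact: ler_weXn2l.
  by rewrite ler_wpM2l ?exprn_ge0// ler_weXn2l.
have B0 : 0 <= K * W * E by rewrite !mulr_ge0.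
have KE0 : 0 <= K * E by rewrite mulr_ge0.
have KV0 : 0 <= K * V by rewrite mulr_ge0.
have KW0 : 0 <= K * W by rewrite mulr_ge0.
have wW : w <= K * W by apply: (le_trans wV); rewrite ler_wpM2l.
have TF : T * F <= K * W.
  by apply: (@le_trans _ _ (T * (K * V))); [rewrite ler_wpM2l|rewrite mulrCA ler_wpM2l].
have t1 : (K * W * E) ^+ 2 * h ^+ 2 <= U.
  apply: (@le_trans _ _ ((K * W * E) ^+ 2 * (K * E) ^+ 2)).
    by rewrite ler_wpM2l ?sqr_ge0// lerXn2r.
  by rewrite le_eqVlt; apply/orP; left; apply/eqP; rewrite /U; ring.
have t2 : w * (K * W * E) * h <= U.
  apply: le_trans (mono 3 2 isT isT).
  rewrite [leRHS](_ : _ = (K * W) * (K * W * E) * (K * E)); last by ring.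
  by apply: ler_pM => //; [rewrite mulr_ge0|rewrite ler_wpM2r].
have t3 : (K * W * E) * T * h * F <= U.
  apply: le_trans (mono 3 2 isT isT).
  rewrite [leRHS](_ : _ = (K * W * E) * (K * E) * (K * W)); last by ring.
  rewrite [leLHS](_ : _ = (K * W * E) * h * (T * F)); last by ring.
  by apply: ler_pM => //; rewrite ?mulr_ge0// ler_wpM2l.
have t4 : ((K * W * E) * h) * (K * W * E) * L <= U.
  rewrite [U](_ : _ = ((K * W * E) * (K * E)) * (K * W * E) * (K * E)); last by rewrite /U; ring.
  by apply: ler_pM => //; rewrite ?mulr_ge0// ler_wpM2r// ler_wpM2l.
have t5 : (K * W * E) ^+ 2 * L <= U.
  apply: le_trans (mono 3 3 isT isT).
  rewrite [leRHS](_ : _ = (K * W * E) ^+ 2 * (K * E)); last by ring.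
  by rewrite ler_wpM2l ?sqr_ge0.
have t6 : T * w ^+ 2 <= U.
  apply: le_trans (mono 2 0 isT isT).
  apply: (@le_trans _ _ (T * (K * V) ^+ 2)); first by rewrite ler_wpM2l// lerXn2r.
  rewrite [leLHS](_ : _ = K ^+ 2 * ((T * V) * V)); last by ring.
  by rewrite expr0 mulr1 ler_wpM2l ?sqr_ge0// expr2 ler_pM// mulr_ge0.
have t7 : T ^+ 2 * (K * V ^+ 2) <= U.
  apply: le_trans (mono 1 0 isT isT).
  rewrite [leLHS](_ : _ = K * (T * V) ^+ 2); last by ring.
  by rewrite expr0 mulr1 expr1 ler_wpM2l// lerXn2r ?nnegrE ?mulr_ge0.
have p0 : 0 <= pi :> R by exact: pi_ge0.
have := ler_wpM2l p0 t7; lra.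
Qed.

Variable k : nat.

Lemma dcoef_bound (sg e : R) : 0 < e -> exists2 C, 0 < C &
  forall n, (0 < n)%N -> 0 <= dcoef k sg n <= C * n%:R `^ (e - sg).
Proof.
move=> e0; have [C C0 H] := divisor_fun_bound k e0; exists C => // n n0.
rewrite /dcoef mulr_ge0 ?powR_ge0//= powRD_pos ?ltr0n// mulrA.
by rewrite ler_wpM2r ?powR_ge0 ?H.
Qed.

Lemma mean_coef_tail (sg e : R) : 0 < e -> e < 2 * sg - 1 -> exists2 C, 0 < C &
  forall N, (0 < N)%N ->
    `|mean_coef k sg - \sum_(1 <= n < N.+1) dcoef k sg n ^+ 2| <= C * N%:R `^ (- (2 * sg - 1 - e)).
Proof.
move=> e0 es; set dl := 2 * sg - 1 - e; have d0 : 0 < dl by rewrite subr_gt0.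
have e20 : 0 < e / 2 by rewrite divr_gt0.
have [C C0 H] := dcoef_bound sg e20.
pose u n : R := (divisor_fun k n.+1)%:R ^+ 2 * n.+1%:R `^ (- (2 * sg)).
have uE n : u n = dcoef k sg n.+1 ^+ 2.
  rewrite /u /dcoef exprMn -[X in _ = _ * X]powR_mulrn ?powR_ge0// -powRrM.
  by congr (_ * _ `^ _); ring.
have sE M : series u M = \sum_(1 <= n < M.+1) dcoef k sg n ^+ 2.
  by rewrite /series/= big_add1/=; apply: eq_bigr => n _; exact: uE.
have sq n : (0 < n)%N -> dcoef k sg n ^+ 2 <= C ^+ 2 * n%:R `^ (-1 - dl).
  move=> n0; have /andP[h0 h1] := H n n0.
  have -> : -1 - dl = (e / 2 - sg) * 2%:R by rewrite /dl; field.
  rewrite powRrM powR_mulrn ?powR_ge0// -exprMn lerXn2r ?nnegrE//.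
  exact: le_trans h1.
have nd : nondecreasing_seq (series u).
  by apply/nondecreasing_seqP => n; rewrite -subr_ge0 seriesEord/= big_ord_recr/= addrAC subrr add0r uE sqr_ge0.
have tail N M : (0 < N)%N -> series u M <= series u N + C ^+ 2 * (dl^-1 * N%:R `^ (- dl)).
  move=> N0; have r0 : 0 <= C ^+ 2 * (dl^-1 * N%:R `^ (- dl)).
    by rewrite mulr_ge0 ?sqr_ge0// mulr_ge0 ?powR_ge0// invr_ge0 ltW.
  have [MN|NM] := leP M N; first by apply: (le_trans (nd _ _ MN)); rewrite lerDl.
  rewrite !sE (@big_cat_nat _ _ _ N.+1)//=; last by rewrite ltnS ltnW.
  rewrite lerD2l; apply: le_trans (ler_wpM2l (sqr_ge0 C) (sum_powR_tail M d0 N0)).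
  by rewrite mulr_sumr; apply: ler_sum_nat => n /andP[n0 _]; apply: sq; case: n n0.
have ub : has_ubound (range (series u)).
  by exists (series u 1 + C ^+ 2 * (dl^-1 * 1%:R `^ (- dl))) => _ [M _ <-]; exact: tail.
have cu : cvgn (series u) by exact: nondecreasing_is_cvgn.
exists (C ^+ 2 * dl^-1) => [|N N0]; first by rewrite mulr_gt0 ?invr_gt0// exprn_gt0.
rewrite -sE ger0_norm; last by rewrite subr_ge0; exact: nondecreasing_cvgn_le.
rewrite lerBlDr addrC -mulrA; apply: limr_le => //.
by apply: nearW => M; exact: tail.
Qed.

End Assembly.

Section ErrorBound.
Variable R : realType.
Notation mu := (@lebesgue_measure R).

Lemma normc_sqr (z : R[i]) : normc z ^+ 2 = complex.Re z ^+ 2 + complex.Im z ^+ 2.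
Proof. by case: z => x y; rewrite /normc sqr_sqrtr// addr_ge0// sqr_ge0. Qed.

Variables (zeta : R[i] -> R[i]) (k : nat) (P : {poly R}) (sg b C x0 : R).
Hypotheses (Hz : is_riemann_zeta zeta) (k0 : (0 < k)%N).
Hypotheses (b0 : 0 <= b) (bsg : b < sg) (sg2 : 1 / 2 < sg) (sg1 : sg < 1).
Hypotheses (C0 : 0 <= C) (x01 : 1 <= x0) (Hd : delta_msq k P b C x0).

Let tb := delta_msq_tail_bounded b0 C0 x01 Hd.

Lemma tailf_integral : exists2 K, 0 <= K & forall X, x0 <= X ->
  mu.-integrable `[X, +oo[ (EFin \o tailf k P sg) /\
  0 <= \int[mu]_(x in `[X, +oo[) `|tailf k P sg x| <= K * X `^ (b - sg).
Proof.
have [K K0 H] := tb bsg; exists K => [|X xX]; first exact: ltW.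
have mD : measurable ([set` `[X, +oo[] : set R) by exact: measurable_itv.
have E x : `|tailf k P sg x| = `|Delta k P x / x| * x `^ (- sg).
  by rewrite normrM [X in _ * X]ger0_norm// powR_ge0.
have [i1 i2] : mu.-integrable `[X, +oo[ (EFin \o (fun x => `|tailf k P sg x|)) /\
   \int[mu]_(x in `[X, +oo[) `|tailf k P sg x| <= K * X `^ (b - sg).
  apply: ge0_integrable => //.
  - by apply: measurableT_comp => //; exact: measurable_tailf.
  - by apply: le_trans (H X xX); rewrite le_eqVlt; apply/orP; left; apply/eqP; apply: eq_integral => x _; rewrite E.
split.
  by apply: (integrable_le mD (measurable_tailf k P sg) _ i1).
by rewrite i2 andbT; apply: Rintegral_ge0.
Qed.

Lemma tailf_sqr : exists2 K, 0 <= K & forall X, x0 <= X ->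
  (\int[mu]_(x in `[X, +oo[) (tailf k P sg x ^+ 2 * x `^ 1)%:E <= (K * X `^ (b - sg) ^+ 2)%:E)%E.
Proof.
have [|K K0 H] := @delta_sqr_tail R k P b C x0 b0 C0 x01 Hd (2 * sg); first by rewrite ltr_pM2l.
exists K => // X xX; have X0 : 0 < X by move: x01; lra.
have -> : X `^ (b - sg) ^+ 2 = X `^ (2 * b - 2 * sg).
  by rewrite -powR_mulrn ?powR_ge0// -powRrM; congr (_ `^ _); ring.
apply: le_trans (H X xX).
rewrite le_eqVlt; apply/orP; left; apply/eqP; apply: eq_integral => x.
rewrite inE/= in_itv/= andbT => Xx; have xp : 0 < x by lra.
congr (_%:E); rewrite /tailf powRr1 ?(ltW xp)// opprD powRD_pos// powR_inv1 ?(ltW xp)//.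
have -> : - (2 * sg) = - sg + - sg by ring.
by rewrite powRD_pos//; field; rewrite gt_eqF.
Qed.

Lemma zeta_mean_square (e D : R) : 0 < e -> 0 <= D -> exists2 K, 0 <= K & forall X T,
    x0 <= X -> 2 <= X -> 1 <= T -> T <= X `^ (1 - b) ->
    Delta k P X ^+ 2 <= D * X `^ (2 * b) ->
    `|\int[mu]_(t in `[1, T]) normc (zeta (sg +i* t)) ^+ (2 * k) -
      T * \sum_(1 <= n < (Num.truncn X).+1) dcoef k sg n ^+ 2| <=
    K * X `^ (2 * (1 - sg) + 4 * e).
Proof.
move=> e0 D0.
have sg0 : 0 < sg by move: sg2; lra.
have sg01 : 0 <= sg <= 1 by rewrite !ltW.
have [K1 K10 H1] := dcoef_bound k sg e0.
have [K4 K40 H4] := tailf_integral.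
have [K5 K50 H5] := tailf_sqr.
have [K6 K60 H6] := main_term_bound P e0 sg01.
have ei : 0 < e^-1 by rewrite invr_gt0.
pose K := 1 + K1 + (1 + e^-1) + (D + 1) + K4 + K5 + K6 + 3 * e^-1.
have [K1' kK1 ke kD] : [/\ 1 <= K, K1 <= K, 1 + e^-1 <= K & D + 1 <= K].
  by rewrite /K; split; lra.
have [k4 k5 k6 kL] : [/\ K4 <= K, K5 <= K, K6 <= K & 3 * e^-1 <= K].
  by rewrite /K; split; lra.
have e30 : 0 <= 1 + e^-1 by lra.
have D1 : 0 <= D + 1 by lra.
have DD : D <= (D + 1) ^+ 2 by nra.
have K0 : 0 <= K by lra.
clearbody K.
exists ((82 + 36 * pi) * K ^+ 4) => [|X T xX X2 T1 TX HD].
  by rewrite mulr_ge0 ?exprn_ge0// addr_ge0// mulr_ge0 ?pi_ge0.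
have X0 : 0 < X by exact: lt_le_trans X2.
have X1 : 1 <= X by apply: le_trans X2; rewrite ler1n.
have XX : 1 + X ^+ 2 <= X ^+ 3.
  have X4 : 2 * 2 <= X * X by apply: ler_pM.
  have : 2 * (X * X) <= X * (X * X) by rewrite ler_wpM2r// mulr_ge0// ltW.
  by rewrite expr2 exprS expr2; lra.
have T0 : 0 <= T by exact: le_trans T1.
set W := X `^ (1 - sg); set E := X `^ e; set V := X `^ (b - sg).
have W0 : 0 <= W by exact: powR_ge0.
have V0 : 0 <= V by exact: powR_ge0.
have E1 : 1 <= E by apply: powR_ge1 => //; exact: ltW.
have bl1 : b < 1 by exact: lt_trans sg1.
have VW : V <= W by rewrite /V /W ler_powR// lerD2r ltW.
have TV : T * V <= W.
  apply: (@le_trans _ _ (X `^ (1 - b) * V)); first by rewrite ler_wpM2r.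
  by rewrite /V /W -powRD_pos// le_eqVlt; apply/orP; left; apply/eqP; congr (_ `^ _); ring.
have TX1 : T <= X.
  by apply: (le_trans TX); rewrite -[leRHS]powRr1 ?(ltW X0)// ler_powR// gerBl.
set N := Num.truncn X.
have NX : N%:R <= X by exact/truncn_le_ge0/ltW.
have XN : X < N.+1%:R by exact: truncnS_gt.
have N0 : (0 < N)%N by rewrite /N truncn_gt0.
have N1 : 1 <= N%:R :> R by rewrite ler1n.
have TN : T <= 2 * N%:R by rewrite (le_trans TX1)// (le_trans (ltW XN))// -natr1 mulr_natl mulr2n lerD2l.
pose B := K * W * E.
have E0 : 0 <= E by exact: powR_ge0.
have KW0 : 0 <= K * W by rewrite mulr_ge0.
have B0 : 0 <= B by rewrite mulr_ge0.
have WE : X `^ (1 - sg + e) = W * E by rewrite powRD_pos.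
have HA n : (0 < n <= N)%N -> 0 <= dcoef k sg n <= B / n%:R.
  move=> /andP[n0 nN]; have /andP[a0 a1] := H1 n n0; rewrite a0/=.
  have n0' : 0 < n%:R :> R by rewrite ltr0n.
  rewrite ler_pdivlMr//.
  apply: (@le_trans _ _ (K1 * (n%:R `^ (e - sg) * n%:R))); first by rewrite mulrA ler_wpM2r// ltW.
  rewrite -[X in _ `^ _ * X]powRr1 ?(ltW n0')// -powRD_pos// /B -mulrA -WE.
  apply: ler_pM; rewrite ?powR_ge0 ?(ltW K10)//.
  have -> : e - sg + 1 = 1 - sg + e by ring.
  apply: ge0_ler_powR; rewrite ?nnegrE ?(ltW n0') ?(ltW X0)//; first by rewrite addr_ge0 ?subr_ge0 ?(ltW sg1) ?(ltW e0).
  by apply: le_trans NX; rewrite ler_nat.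
have [fi /andP[F0 FV]] := H4 X xX.
have fQ := H5 X xX.
pose w := - (Delta k P X * X `^ (- sg)).
pose c (t : R) := complex.Re (dtail k P X (sg +i* t)).
pose s (t : R) := - complex.Im (dtail k P X (sg +i* t)).
have cE t : c t = \int[mu]_(x in `[X, +oo[) (tailf k P sg x * cos (t * ln x)).
  by rewrite /c dtailE.
have sE t : s t = \int[mu]_(x in `[X, +oo[) (tailf k P sg x * sin (t * ln x)).
  by rewrite /s dtailE//= opprK.
have line (g : R[i] -> R[i]) : (forall t, cdiff g (sg +i* t)) ->
    continuous (fun t : R => complex.Re (g (sg +i* t))) /\ continuous (fun t : R => complex.Im (g (sg +i* t))).
  move=> dg; have lE t : sg +i* t = sg%:C + 'i * t%:C.
    by apply/eqP; rewrite eq_complex /=; apply/andP; split; apply/eqP; ring.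
  have r t : rcont (fun y : R => g (sg +i* y)) t.
    have -> : (fun y : R => g (sg +i* y)) = (fun y => g (sg%:C + 'i * y%:C)) by apply/funext => y; rewrite lE.
    by apply: ccont_rcont; rewrite -lE; exact: cdiff_cont.
  by split=> t; [exact: (rcont_Re (r t))|exact: (rcont_Im (r t))].
have [cc cs'] := line (dtail k P X) (fun t => cdiff_mellin X1 (measurable_DeltaV k P)
   (fun a ba => tail_integrable tb ba xX) (bsg : b < complex.Re (sg +i* t))).
have cs : continuous s by exact: contN.
have sn1 t : sg +i* t != 1 by rewrite eq_complex /= negb_and lt_eqF.
have [z1 z2] := line (zapprox k P X) (fun t => cdiff_zapprox x01 tb xX (bsg : b < complex.Re (sg +i* t)) (sn1 t)).
pose b1 t := complex.Re (zapprox k P X (sg +i* t)) - dir_re (dcoef k sg) N t - w * cos (t * ln X) - (sg * c t + t * s t).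
pose b2 t := complex.Im (zapprox k P X (sg +i* t)) - dir_im (dcoef k sg) N t + w * sin (t * ln X) - (t * c t - sg * s t).
have cb1 : continuous b1.
  apply: contD; last by apply: contN; exact: continuous_e1.
  apply: contD; last by apply: contN; exact: continuous_w1.
  by apply: contD => //; apply: contN; exact: continuous_dir_re.
have cb2 : continuous b2.
  apply: contD; last by apply: contN; exact: continuous_e2.
  apply: contD; last exact: continuous_w2.
  by apply: contD => //; apply: contN; exact: continuous_dir_im.
have bE t : main_term P X (sg +i* t) = b1 t +i* b2 t.
  rewrite /b1 /b2 zapprox_split// dirpolyE cexp_negM//.
  have -> : dtail k P X (sg +i* t) = c t +i* (- s t) by rewrite /c /s opprK; case: (dtail k P X _).
  case: (main_term P X _) => m1 m2.
  by apply/eqP; rewrite eq_complex /= /w; apply/andP; split; apply/eqP; ring.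
have bG t : 1 <= t <= T -> `|b1 t| <= B / t /\ `|b2 t| <= B / t.
  move=> /andP[t1 _]; have m := H6 X t X1 t1.
  have mB : K6 * X `^ (1 - sg + e) / t <= B / t.
    rewrite ler_wpM2r ?invr_ge0 ?(le_trans ler01)//.
    by rewrite WE /B -mulrA ler_wpM2r// mulr_ge0.
  rewrite bE in m; split.
    exact: le_trans (normc_Re (b1 t +i* b2 t)) (le_trans m mB).
  exact: le_trans (normc_Im (b1 t +i* b2 t)) (le_trans m mB).
pose Z t := normc (zeta (sg +i* t)) ^+ (2 * k).
have ZE t : 1 <= t <= T -> Z t =
    (dir_re (dcoef k sg) N t + b1 t + w * cos (t * ln X) + (sg * c t + t * s t)) ^+ 2 +
    (dir_im (dcoef k sg) N t + b2 t - w * sin (t * ln X) + (t * c t - sg * s t)) ^+ 2.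
  move=> /andP[t1 _]; rewrite /Z mulnC exprM.
  have -> : normc (zeta (sg +i* t)) ^+ k = normc (zeta (sg +i* t) ^+ k).
    elim: {+}k => [|n IH]; first by rewrite !expr0 -[1 in RHS]/(1%:C) normcC normr1.
    by rewrite !exprS normcM IH.
  rewrite (zeta_formula Hz k0 x01 tb b0 xX bsg sg1 t1) normc_sqr.
  by congr (_ ^+ 2 + _ ^+ 2); rewrite /b1 /b2; ring.
have main := mean_square_bound N0 T1 TN B0 sg01 HA X1 NX B0 (measurable_tailf k P sg) fi fQ cE sE cc cs cb1 cb2 bG ZE.
apply: (le_trans main).
have h0 : 0 <= harm R N <= K * E.
  rewrite harm_ge0/=; apply: (le_trans (harm_le e0 N0)).
  apply: ler_pM; rewrite ?powR_ge0//.
  by apply: ge0_ler_powR; rewrite ?nnegrE ?(ltW e0) ?(ltW X0) ?(le_trans ler01 N1)//.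
have w0 : 0 <= `|w| <= K * V.
  rewrite normr_ge0/=; apply: (@le_trans _ _ ((D + 1) * V)); last first.
    by rewrite ler_wpM2r.
  have DV0 : 0 <= (D + 1) * V by rewrite mulr_ge0.
  rewrite -(@ler_sqr R) ?nnegrE// real_normK ?num_real// /w sqrrN exprMn.
  have VE : X `^ (2 * b) * X `^ (- sg) ^+ 2 = V ^+ 2.
    rewrite -!powR_mulrn ?powR_ge0// -!powRrM -powRD_pos//; congr (_ `^ _); ring.
  apply: (@le_trans _ _ (D * V ^+ 2)); first by rewrite -VE mulrA ler_wpM2r ?sqr_ge0.
  by rewrite exprMn ler_wpM2r ?sqr_ge0.
have FK : 0 <= \int[mu]_(x in `[X, +oo[) `|tailf k P sg x| <= K * V.
  by rewrite F0/=; apply: (le_trans FV); rewrite ler_wpM2r.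
have L0 : 0 <= ln (1 + T ^+ 2) <= K * E.
  rewrite ln_ge0/=; last by rewrite lerDl sqr_ge0.
  apply: (@le_trans _ _ (3 * ln X)).
    have -> : 3 * ln X = ln (X ^+ 3) by rewrite lnXn ?mulr_natl.
    rewrite ler_ln ?posrE ?exprn_gt0 ?recip_denom_gt0//.
    by apply: le_trans XX; rewrite lerD2l lerXn2r ?nnegrE// ltW.
  apply: (@le_trans _ _ (3 * (e^-1 * E))); first by rewrite ler_wpM2l// ln_le_powR.
  by rewrite mulrA ler_wpM2r.
have fin := combine_bounds K1' W0 E1 V0 VW T0 TV h0 w0 FK L0.
have EE : W ^+ 2 * E ^+ 4 = X `^ (2 * (1 - sg) + 4 * e).
  by rewrite -!powR_mulrn ?powR_ge0// -!powRrM -powRD_pos//; congr (_ `^ _); ring.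
rewrite -/B (real_normK (num_real w)) EE [leRHS]mulrA in fin; apply: le_trans fin.
rewrite lerD2l lerD2l; apply: ler_wpM2l; first by rewrite mulr_ge0 ?sqr_ge0// mulr_ge0 ?pi_ge0.
by rewrite ler_wpM2r// sqr_ge0.
Qed.

End ErrorBound.

Lemma vinogradov_delta_msq_two (R : realType) (k : nat) (P : {poly R}) :
  vinogradov (fun x : R => (\int[lebesgue_measure]_(y in `[1%R, x]) Delta k P y ^+ 2)%R)
    (fun x : R => x `^ (1 + 2 * 2)).
Proof.
have [D D0 HD] := Delta2_le k P.
exists D, 1; split; first exact: num_real.
move=> x x1; have x0 : 0 < x by lra.
apply: (le_trans (Rintegral_bound (ltW x1) (integrable_Delta2 k P x) (HD x))).
rewrite (ger0_norm (powR_ge0 _ _)) mulrCA ler_wpM2l// powRD_pos// powRr1 ?(ltW x0)//.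
by rewrite ler_wpM2r ?powR_ge0//; lra.
Qed.

Theorem theorem1 (R : realType) (zeta : R[i] -> R[i]) (k : nat) (P : {poly R})
    (sigma : R) :
  is_riemann_zeta zeta ->
  (3 <= k)%N ->
  is_main_poly zeta k P ->
  Num.max (beta k P) (1 / 2) < sigma ->
  sigma < 1 ->
  forall eps : R, 0 < eps ->
    vinogradov (fun T : R => Rerr zeta k sigma T)
      (fun T : R => T `^ (2 * (1 - sigma) / (1 - beta k P) + eps)).

Proof.
move=> Hz k3 _ bs sg1 eps eps0.
move: bs; rewrite gt_max => /andP[bs sg2].
pose S := [set b : R | 0 <= b /\
    vinogradov
      (fun x : R => (\int[lebesgue_measure]_(y in `[1%R, x]) Delta k P y ^+ 2)%R)
      (fun x : R => x `^ (1 + 2 * b))].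
have S2 : S 2 by split => //; exact: vinogradov_delta_msq_two.
have Sinf : has_inf S by split; [exists 2|exists 0 => b []].
set be := beta k P in bs *.
have be0 : 0 <= be by apply: lb_le_inf; [exists 2|move=> b []].
have be1 : 0 < 1 - be by lra.
pose M := 2 * (1 - sigma) / (1 - be) + eps.
have M0 : 0 < M by rewrite ltr_wpDl// divr_ge0 ?(ltW be1)//; lra.
pose z := eps * (1 - be) / 2; have z0 : 0 < z by rewrite divr_gt0// mulr_gt0.
have [b [b0 bv] bE] : exists2 b, S b & b < be + Num.min (z / M) (sigma - be).
  by apply: inf_adherent => //; rewrite lt_min divr_gt0// subr_gt0.
have [bM bsg] : b < be + z / M /\ b < sigma.
  move: bE; rewrite -ltrBlDl lt_min => /andP[h1 h2]; split; lra.
have b1 : 0 < 1 - b by lra.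
pose e := Num.min (z / 4) ((2 * sigma - 1) / 2).
have e0 : 0 < e.
  rewrite lt_min; apply/andP; split; first exact: divr_gt0.
  by apply: divr_gt0 => //; lra.
have [e1 e2] : e <= z / 4 /\ e < 2 * sigma - 1.
  split; first by rewrite /e ge_min lexx.
  by apply: (@le_lt_trans _ _ ((2 * sigma - 1) / 2)); [rewrite /e ge_min lexx orbT|lra].
pose p := 2 * (1 - sigma) + 4 * e.
have p0 : 0 < p by rewrite /p; lra.
pose dl := 2 * sigma - 1 - e.
have [dl0 dlp b1'] : [/\ 0 <= dl, 1 - dl <= p & 1 - b <= 1] by rewrite /dl /p; split; lra.
have pM : p * (1 - b)^-1 <= M.
  rewrite ler_pdivrMr//.
  have h1 : M * (1 - be) = 2 * (1 - sigma) + 2 * z by rewrite /M /z; field; lra.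
  have h2 : M * (b - be) <= z.
    by rewrite mulrC -ler_pdivlMr//; lra.
  have -> : M * (1 - b) = M * (1 - be) - M * (b - be) by ring.
  rewrite h1 /p; lra.
have [C [x0 [C0 x01 Hd]]] := vinogradov_delta_msq bv.
pose D := C * 2 `^ (1 + 2 * b) + 1.
have D0 : 0 <= D by rewrite addr_ge0// mulr_ge0// powR_ge0.
have k0 : (0 < k)%N by exact: leq_trans k3.
have [K K0 HK] := zeta_mean_square Hz k0 b0 bsg sg2 sg1 C0 x01 Hd e0 D0.
have [C8 C80 H8] := mean_coef_tail k e0 e2.
pose x1 := Num.max x0 2.
exists ((K + C8 * 2 `^ dl) * 2 `^ p), (Num.max 1 (x1 `^ (1 - b))); split; first exact: num_real.
move=> T; rewrite gt_max => /andP[T1 Tx].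
have T0 : 0 < T by exact: lt_trans T1.
pose Y := T `^ (1 - b)^-1.
have x10 : 0 <= x1 by rewrite le_max ler0n orbT.
have Yx : x1 <= Y.
  have -> : x1 = (x1 `^ (1 - b)) `^ (1 - b)^-1 by rewrite -powRrM divff ?gt_eqF// powRr1.
  by apply: ge0_ler_powR; rewrite ?nnegrE ?powR_ge0 ?invr_ge0 ?(ltW b1) ?(ltW T0) ?(ltW Tx).
have [Yx0 Y2] : x0 <= Y /\ 2 <= Y by move: Yx; rewrite /x1 ge_max => /andP.
have Y0 : 0 < Y by exact: lt_le_trans Y2.
have TE : T = Y `^ (1 - b) by rewrite /Y -powRrM mulVf ?gt_eqF// powRr1// ltW.
have [X /andP[YX X2Y] HX] := delta_small C0 x01 Hd Yx0.
have X0 : 0 < X by exact: lt_le_trans YX.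
have X2 : 2 <= X by exact: le_trans YX.
have X1 : 1 <= X by apply: le_trans X2; rewrite ler1n.
have TX : T <= X `^ (1 - b).
  by rewrite TE; apply: ge0_ler_powR; rewrite ?nnegrE ?(ltW b1) ?(ltW X0) ?(ltW Y0).
have HX' : Delta k P X ^+ 2 <= D * X `^ (2 * b).
  apply: (le_trans HX); rewrite ler_wpM2l//; apply: ge0_ler_powR; rewrite ?nnegrE ?mulr_ge0 ?(ltW X0) ?(ltW Y0)//.
have m1 := HK X T (le_trans Yx0 YX) X2 (ltW T1) TX HX'.
set N := Num.truncn X in m1.
have XN : X < N.+1%:R by exact: truncnS_gt.
have N0 : (0 < N)%N by rewrite /N truncn_gt0.
have m2 := H8 N N0; rewrite -/dl in m2.
have XN2 : X / 2 <= N%:R.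
  have N1 : 1 <= N%:R :> R by rewrite ler1n.
  rewrite ler_pdivrMr// (le_trans (ltW XN))// -natr1 [leRHS]mulr_natr mulr2n.
  by rewrite lerD2l.
have TX1 : T <= X.
  by apply: (le_trans TX); rewrite -[leRHS]powRr1 ?(ltW X0)// ler_powR.
have m3 : T * N%:R `^ (- dl) <= 2 `^ dl * X `^ p.
  have h : N%:R `^ (- dl) <= 2 `^ dl * X `^ (- dl).
    have -> : 2 `^ dl * X `^ (- dl) = (X / 2) `^ (- dl).
      by rewrite powRM ?(ltW X0)// -powR_inv1// -powRrM mulrC; congr (_ * _ `^ _); ring.
    rewrite !powRN lef_pV2 ?posrE ?powR_gt0 ?ltr0n ?divr_gt0//.
    by apply: ge0_ler_powR; rewrite ?nnegrE ?divr_ge0// ltW.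
  apply: (@le_trans _ _ (X * (2 `^ dl * X `^ (- dl)))).
    by apply: ler_pM; rewrite ?powR_ge0 ?(ltW T0).
  rewrite mulrCA ler_wpM2l ?powR_ge0// -[X in X * _]powRr1 ?(ltW X0)// -powRD_pos//.
  by rewrite ler_powR.
set I := \int[lebesgue_measure]_(t in _) _ in m1.
have -> : Rerr zeta k sigma T = (I - T * \sum_(1 <= n < N.+1) dcoef k sigma n ^+ 2) -
    T * (mean_coef k sigma - \sum_(1 <= n < N.+1) dcoef k sigma n ^+ 2).
  by rewrite /Rerr -/I; ring.
apply: (le_trans (ler_normB _ _)).
have m4 : `|T * (mean_coef k sigma - \sum_(1 <= n < N.+1) dcoef k sigma n ^+ 2)| <= C8 * 2 `^ dl * X `^ p.
  rewrite normrM (gtr0_norm T0); apply: (@le_trans _ _ (T * (C8 * N%:R `^ (- dl)))).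
    by rewrite ler_wpM2l// ltW.
  by rewrite mulrCA -mulrA ler_wpM2l// ltW.
apply: (@le_trans _ _ ((K + C8 * 2 `^ dl) * X `^ p)); first by rewrite mulrDl; exact: lerD m1 m4.
rewrite -[leRHS]mulrA ler_wpM2l//.
  by rewrite addr_ge0// mulr_ge0 ?powR_ge0// ltW.
apply: (@le_trans _ _ ((2 * Y) `^ p)).
  by apply: ge0_ler_powR; rewrite ?nnegrE ?mulr_ge0 ?(ltW X0) ?(ltW Y0) ?(ltW p0).
rewrite powRM ?(ltW Y0)// ler_wpM2l ?powR_ge0// (ger0_norm (powR_ge0 _ _)).
by rewrite /Y -powRrM mulrC ler_powR// ltW.
Qed.
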